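(* Let $(\varphi,\vec\xi,\eta,\tilde g)$ be an almost contact metric structure on a smooth manifold $X$ of odd dimension $n$, with $\omega=d\eta$ non-degenerate on $D=\ker\eta$ and $\ker\omega=\mathrm{span}(\vec\xi)$, and let $g$ be the admissible metric on $D$ determined by $\tilde g$. Then the structure is a $K$-contact structure (i.e. $L_{\vec\xi}\tilde g=0$) if and only if $g$ is quasi-integrable.
   Context: All objects are $C^\infty$. An almost contact metric structure on $X$ is a tuple $(\varphi,\vec\xi,\eta,\tilde g)$, where $\varphi$ is a $(1,1)$-tensor field, $\vec\xi$ a vector field, $\eta$ a 1-form and $\tilde g$ a (pseudo-)Riemannian metric on $X$, such that $\eta(\vec\xi)=1$, $\varphi(\vec\xi)=0$, $\eta\circ\varphi=0$, $\varphi^2\vec X=-\vec X+\eta(\vec X)\vec\xi$ and $\tilde g(\varphi\vec X,\varphi\vec Y)=\tilde g(\vec X,\vec Y)-\eta(\vec X)\eta(\vec Y)$ for all vector fields $\vec X,\vec Y$. Here an almost contact metric structure is called $K$-contact if $\vec\xi$ is a Killing field of $\tilde g$, i.e. $L_{\vec\xi}\tilde g=0$, where $L_{\vec\xi}$ is the Lie derivative. Let $D^\perp=\mathrm{span}(\vec\xi)$, so $TX=D\oplus D^\perp$, and let $P:TX\to D$ be the corresponding projection. The admissible metric $g$ is the $(0,2)$-tensor field with $g(\vec u,\vec v)=\tilde g(\vec u,\vec v)$ for sections $\vec u,\vec v$ of $D$ and $g(\vec\xi,\cdot)=0$. An adapted coordinate map is a local chart $(x^1,\dots,x^n)$ of $X$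 with $\partial_n=\partial/\partial x^n=\vec\xi$; then $\vec e_a=P(\partial_a)$ ($a=1,\dots,n-1$) is a local frame of $D$ and $g=g_{ab}\,dx^a\otimes dx^b$ with $g_{ab}=g(\vec e_a,\vec e_b)$. The metric $g$ is quasi-integrable if $\partial_n g_{ab}=0$ in adapted coordinates. *)

(* Defs.v *)
From mathcomp Require Import all_boot all_order all_algebra.
From mathcomp Require Import all_classical all_reals.
From mathcomp Require Import topology normedtype derive.

Set Implicit Arguments.
Unset Strict Implicit.
Unset Printing Implicit Defensive.

Import Order.TTheory GRing.Theory Num.Theory.
Import numFieldNormedType.Exports.

Local Open Scope classical_set_scope.
Local Open Scope ring_scope.

(* [Ck k U f], for [U] open: the partial derivatives of [f] of order at most
   [k] exist and are continuous on [U]. *)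
Fixpoint Ck (R : realType) (n k : nat) (U : set 'rV[R]_n) (f : 'rV[R]_n -> R)
    : Prop :=
  (forall x, U x -> {for x, continuous f}) /\
  (if k is k'.+1 then
     forall i : 'I_n, (forall x, U x -> derivable f x 'e_i) /\
                      Ck k' U (fun x => 'D_'e_i f x)
   else True).

Definition smooth_on (R : realType) (n : nat) (U : set 'rV[R]_n)
    (f : 'rV[R]_n -> R) : Prop :=
  forall k, Ck k U f.

(* Only the restrictions of [cmap] to [cdom] and of [cinv] to [cimg] matter:
   both maps are extended arbitrarily to total functions. *)
Record chart (R : realType) (n : nat) (X : topologicalType) := Chart {
  cdom : set X;
  cmap : X -> 'rV[R]_n;
  cinv : 'rV[R]_n -> X
}.

Definition cimg (R : realType) (n : nat) (X : topologicalType)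
    (c : chart R n X) : set 'rV[R]_n :=
  cmap c @` cdom c.

Definition is_chart (R : realType) (n : nat) (X : topologicalType)
    (c : chart R n X) : Prop :=
  [/\ open (cdom c), open (cimg c),
      forall p, cdom c p -> cinv c (cmap c p) = p,
      forall p, cdom c p -> {for p, continuous (cmap c)} &
      forall x, cimg c x -> {for x, continuous (cinv c)}].

Definition transition (R : realType) (n : nat) (X : topologicalType)
    (c c' : chart R n X) : 'rV[R]_n -> 'rV[R]_n :=
  cmap c' \o cinv c.

Definition smooth_transition (R : realType) (n : nat) (X : topologicalType)
    (c c' : chart R n X) : Prop :=
  forall j : 'I_n, smooth_on (cmap c @` (cdom c `&` cdom c'))
                             (fun x => transition c c' x 0 j).

Definition compatible_charts (R : realType) (n : nat) (X : topologicalType)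
    (c c' : chart R n X) : Prop :=
  smooth_transition c c' /\ smooth_transition c' c.

Record smooth_manifold (R : realType) (n : nat) := SmoothManifold {
  carrier :> topologicalType;
  atlas : set (chart R n carrier);
  manifold_hausdorff : hausdorff_space carrier;
  manifold_second_countable : @second_countable carrier;
  atlas_chart : forall c, atlas c -> is_chart c;
  atlas_cover : forall p, exists2 c, atlas c & cdom c p;
  atlas_compatible : forall c c', atlas c -> atlas c' -> compatible_charts c c';
  atlas_maximal : forall c, is_chart c ->
    (forall c', atlas c' -> compatible_charts c c') -> atlas c
}.

(* Tensor fields are given by their components in all charts of the maximal
   atlas, subject to the usual transformation law.  Components are written as
   functions of a point of the manifold, and only matter at the points of the
   domain of the chart.  A tangent vector is a row of components, as in the
   library convention [v *m 'J f x] for the differential of [f] at [x]. *)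

Definition dcoord (R : realType) (n : nat) (X : topologicalType)
    (c : chart R n X) (i : 'I_n) (F : X -> R) (p : X) : R :=
  'D_'e_i (F \o cinv c) (cmap c p).

Definition smooth_in (R : realType) (n : nat) (X : topologicalType)
    (c : chart R n X) (F : X -> R) : Prop :=
  smooth_on (cimg c) (F \o cinv c).

Definition trans_jac (R : realType) (n : nat) (X : topologicalType)
    (c c' : chart R n X) (p : X) : 'M[R]_n :=
  'J (transition c c') (cmap c p).

Record vector_field (R : realType) (n : nat) (M : smooth_manifold R n) :=
  VectorField {
  vf_comp :> chart R n M -> M -> 'rV[R]_n;
  vf_smooth : forall c, atlas c ->
    forall i, smooth_in c (fun p => vf_comp c p 0 i);
  vf_change : forall c c', atlas c -> atlas c' ->
    forall p, cdom c p -> cdom c' p ->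
    vf_comp c' p = vf_comp c p *m trans_jac c c' p
}.

(* 1-forms; components form a column, so that [u *m eta c p] is the value of
   [eta] on [u]. *)
Record one_form (R : realType) (n : nat) (M : smooth_manifold R n) := OneForm {
  of_comp :> chart R n M -> M -> 'cV[R]_n;
  of_smooth : forall c, atlas c ->
    forall i, smooth_in c (fun p => of_comp c p i 0);
  of_change : forall c c', atlas c -> atlas c' ->
    forall p, cdom c p -> cdom c' p ->
    of_comp c p = trans_jac c c' p *m of_comp c' p
}.

(* (1,1)-tensor fields, acting on rows by [u |-> u *m phi c p]. *)
Record tensor11 (R : realType) (n : nat) (M : smooth_manifold R n) := Tensor11 {
  t11_comp :> chart R n M -> M -> 'M[R]_n;
  t11_smooth : forall c, atlas c ->
    forall i j, smooth_in c (fun p => t11_comp c p i j);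
  t11_change : forall c c', atlas c -> atlas c' ->
    forall p, cdom c p -> cdom c' p ->
    t11_comp c p *m trans_jac c c' p = trans_jac c c' p *m t11_comp c' p
}.

Record tensor02 (R : realType) (n : nat) (M : smooth_manifold R n) := Tensor02 {
  t02_comp :> chart R n M -> M -> 'M[R]_n;
  t02_smooth : forall c, atlas c ->
    forall i j, smooth_in c (fun p => t02_comp c p i j);
  t02_change : forall c c', atlas c -> atlas c' ->
    forall p, cdom c p -> cdom c' p ->
    t02_comp c p = trans_jac c c' p *m t02_comp c' p *m (trans_jac c c' p)^T
}.

Definition eval1 (R : realType) (n : nat) (w : 'cV[R]_n) (u : 'rV[R]_n) : R :=
  (u *m w) 0 0.

Definition eval2 (R : realType) (n : nat) (B : 'M[R]_n) (u v : 'rV[R]_n) : R :=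
  (u *m B *m v^T) 0 0.

Definition pseudo_riemannian (R : realType) (n : nat) (M : smooth_manifold R n)
    (gt : tensor02 M) : Prop :=
  forall c, atlas c -> forall p, cdom c p ->
    (forall u v, eval2 (gt c p) u v = eval2 (gt c p) v u) /\
    (forall u, (forall v, eval2 (gt c p) u v = 0) -> u = 0).

Definition almost_contact_metric (R : realType) (n : nat)
    (M : smooth_manifold R n) (phi : tensor11 M) (xi : vector_field M)
    (eta : one_form M) (gt : tensor02 M) : Prop :=
  pseudo_riemannian gt /\
  forall c, atlas c -> forall p, cdom c p ->
  [/\ eval1 (eta c p) (xi c p) = 1,
      xi c p *m phi c p = 0,
      forall u, eval1 (eta c p) (u *m phi c p) = 0,
      forall u, u *m phi c p *m phi c p = - u + eval1 (eta c p) u *: xi c p &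
      forall u v, eval2 (gt c p) (u *m phi c p) (v *m phi c p) =
        eval2 (gt c p) u v - eval1 (eta c p) u * eval1 (eta c p) v].

(* (d eta)_ij = d_i eta_j - d_j eta_i *)
Definition ext_d (R : realType) (n : nat) (M : smooth_manifold R n)
    (eta : one_form M) (c : chart R n M) (p : M) : 'M[R]_n :=
  \matrix_(i, j) (dcoord c i (fun q => eta c q j 0) p -
                  dcoord c j (fun q => eta c q i 0) p).

Definition d_nondegenerate_on_ker (R : realType) (n : nat)
    (M : smooth_manifold R n) (eta : one_form M) : Prop :=
  forall c, atlas c -> forall p, cdom c p ->
  forall u, eval1 (eta c p) u = 0 ->
    (forall v, eval1 (eta c p) v = 0 -> eval2 (ext_d eta c p) u v = 0) -> u = 0.

Definition ker_d_eq_span (R : realType) (n : nat) (M : smooth_manifold R n)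
    (eta : one_form M) (xi : vector_field M) : Prop :=
  forall c, atlas c -> forall p, cdom c p ->
  forall u, (forall v, eval2 (ext_d eta c p) u v = 0) <->
            (exists a : R, u = a *: xi c p).

(* Components of the Lie derivative of a (0,2)-tensor field:
   (L_xi g)_ij = xi^k d_k g_ij + g_kj d_i xi^k + g_ik d_j xi^k,
   that is, (L_xi g)(Y, Z) = xi (g(Y, Z)) - g([xi, Y], Z) - g(Y, [xi, Z])
   for the coordinate fields Y = d_i, Z = d_j. *)
Definition lie_derivative (R : realType) (n : nat) (M : smooth_manifold R n)
    (xi : vector_field M) (g : tensor02 M) (c : chart R n M) (p : M)
    : 'M[R]_n :=
  \matrix_(i, j) \sum_k
    (xi c p 0 k * dcoord c k (fun q => g c q i j) p +
     g c p k j * dcoord c i (fun q => xi c q 0 k) p +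
     g c p i k * dcoord c j (fun q => xi c q 0 k) p).

Definition K_contact (R : realType) (n : nat) (M : smooth_manifold R n)
    (xi : vector_field M) (gt : tensor02 M) : Prop :=
  forall c, atlas c -> forall p, cdom c p -> lie_derivative xi gt c p = 0.

Definition admissible_metric (R : realType) (n : nat) (M : smooth_manifold R n)
    (xi : vector_field M) (eta : one_form M) (gt g : tensor02 M) : Prop :=
  forall c, atlas c -> forall p, cdom c p ->
  [/\ forall u v, eval1 (eta c p) u = 0 -> eval1 (eta c p) v = 0 ->
        eval2 (g c p) u v = eval2 (gt c p) u v,
      forall v, eval2 (g c p) (xi c p) v = 0 &
      forall u, eval2 (g c p) u (xi c p) = 0].

Definition proj_D (R : realType) (n : nat) (M : smooth_manifold R n)
    (xi : vector_field M) (eta : one_form M) (c : chart R n M) (p : M)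
    (u : 'rV[R]_n) : 'rV[R]_n :=
  u - eval1 (eta c p) u *: xi c p.

(* The coordinates are indexed by ['I_n.+1]: [ord_max] is the last one, and
   [lift ord_max a], for [a : 'I_n], are the others. *)
Definition adapted (R : realType) (n : nat) (M : smooth_manifold R n.+1)
    (xi : vector_field M) (c : chart R n.+1 M) : Prop :=
  atlas c /\ forall p, cdom c p -> xi c p = 'e_ord_max.

Definition frame_D (R : realType) (n : nat) (M : smooth_manifold R n.+1)
    (xi : vector_field M) (eta : one_form M) (c : chart R n.+1 M) (a : 'I_n)
    (p : M) : 'rV[R]_n.+1 :=
  proj_D xi eta c p 'e_(lift ord_max a).

Definition quasi_integrable (R : realType) (n : nat)
    (M : smooth_manifold R n.+1) (xi : vector_field M) (eta : one_form M)
    (g : tensor02 M) : Prop :=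
  forall c, adapted xi c -> forall a b : 'I_n, forall p, cdom c p ->
    dcoord c ord_max
      (fun q => eval2 (g c q) (frame_D xi eta c a q) (frame_D xi eta c b q)) p
    = 0.

(* Main.v *)
Require Import Defs.
From mathcomp Require Import all_boot all_order all_algebra all_fingroup.
From mathcomp Require Import all_classical all_reals.
From mathcomp Require Import topology normedtype landau derive realfun sequences measure.
From mathcomp Require Import lebesgue_measure lebesgue_integral ftc.
From mathcomp Require Import ring lra.

Set Implicit Arguments.
Unset Strict Implicit.
Unset Printing Implicit Defensive.

Import Order.TTheory GRing.Theory Num.Theory.
Import numFieldNormedType.Exports.

Local Open Scope classical_set_scope.
Local Open Scope ring_scope.

(** Write e_i for the coordinate fields of an adapted chart, in which xi is the
last of them, and e_a, for a not the last index, for the frame of D obtained by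
projection.  Compatibility of the metric with phi, applied to xi, says that
gt(xi, .) = eta ([xi_dual_eta]), so that the coefficients of the admissible
metric are
    g_ab = gt_ab - eta_a eta_b      ([frame_metric]).
Since xi spans the kernel of d eta and eta(xi) = 1, the components of eta do
not depend on the last coordinate ([dcoord_eta]).  Hence g_ab and gt_ab have
the same last derivative ([dcoord_frame_metric]), and the components gt_in and
gt_ni, which are those of eta, have none.  As xi has constant components, the
components of the Lie derivative are exactly the last derivatives of the gt_ij
([lie_derivative_adapted]).  So in an adapted chart quasi-integrability and the
vanishing of the Lie derivative are the same condition.

This gives at once that K-contact implies quasi-integrable.  The converse asks
the Lie derivative to vanish in every chart, which takes two more facts.

The first is that every point lies in an adapted chart
([adapted_chart_exists]): as eta(xi) = 1, the field xi vanishes nowhere and can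
be straightened ([flow_box]); the straightened chart belongs to the atlas by
maximality.  The flow of a field V is obtained from an ordinary differential
equation with parameters, in the integral form
    X(t) = x0 + z P + z_n int_0^t V(X(s)) ds,    0 <= t <= 1,
where z P sweeps out a hypersurface transverse to V(x0) and the last coordinate
z_n of z rescales time.  For z near 0 the right-hand side is a contraction, so
that the equation has a solution on the fixed interval [0, 1]
([trajectory_exists]).  Differentiating formally in a parameter gives a linear
integral equation with matrix z_n DV(X), which is a contraction as well, and a
stability estimate for such equations ([linear_perturbation]) shows that its
solution is the derivative ([trajectory_deriv]).  All higher derivatives solve
equations with the same matrix, so that smoothness follows by induction on the
order ([Ck_curve_linear], [trajectory_smooth]).  With respect to z_n the
linear equation is solved by t V(X(t)), whence Phi(z) = X(1) satisfies
d_n Phi = V o Phi ([trajectory_time], [flow_map]); and the inverse function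
theorem ([inverse_map]) makes Phi a chart.

The second is that the Lie derivative is a tensor.  It suffices to compare an
adapted chart with an arbitrary one ([lie_derivative_pullback]): in the
transformation law gt' = J G J^T for the components of the metric, the last
derivative of the Jacobian matrix J is, by the symmetry of second derivatives
([clairaut]) and since the last row of J consists of the components of xi,
equal to J A with A the Jacobian matrix of xi; the product rule then yields J (A G + xi(G) + G A^T) J^T, whose middle
factor is the Lie derivative.  As J is invertible, the Lie derivative vanishes
in all charts as soon as it does in adapted ones. *)

(** * Mean value estimates and strict differentiability *)

Definition between (R : realType) (a b s : R) : Prop :=
  Num.min a b <= s <= Num.max a b.

Lemma is_derive_line (R : realType) (V : normedModType R) (f : V -> R)
    (w v : V) (s : R) :
  derivable f (w + s *: v) v ->
  is_derive s (1 : R) (fun s => f (w + s *: v)) ('D_v f (w + s *: v)).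
Proof.
move=> df.
have E : (fun h : R => h^-1 *: (((fun s : R => f (w + s *: v)) \o shift s)
            (h *: (1 : R)) - f (w + s *: v))) =
         (fun h => h^-1 *: ((f \o shift (w + s *: v)) (h *: v) - f (w + s *: v))).
  apply/funext => h /=; rewrite /shift /= scalerDl [h *: 1]mulr1.
  by rewrite addrCA.
split; first by rewrite /derivable E.
by rewrite /derive E.
Qed.

(** The mean value theorem in the form that the estimates below need: a bound
on the deviation of the derivative from a constant c bounds the deviation of f
from the affine function of slope c.  Taking c = 0 gives a Lipschitz bound, and
c the derivative at a centre gives differentiability. *)
Lemma mvt_line (R : realType) (V : normedModType R) (f : V -> R) (w v : V)
    (c e a b : R) :
  (forall s, between a b s ->
     derivable f (w + s *: v) v /\ `|'D_v f (w + s *: v) - c| <= e) ->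
  `|f (w + b *: v) - f (w + a *: v) - c * (b - a)| <= e * `|b - a|.
Proof.
move=> H.
wlog ab : a b H / a <= b => [W|].
  have [ab|/ltW ba] := leP a b; first exact: W.
  have -> : forall u v : R, v - u - c * (b - a) = - (u - v - c * (a - b)).
    by move=> u1 v1; ring.
  rewrite normrN [`|b - a|]distrC.
  by apply: W => // s; rewrite /between minC maxC => /H.
have inab s : s \in `[a, b] -> between a b s.
  by rewrite in_itv /between /= (min_idPl ab) (max_idPr ab).
pose g s := f (w + s *: v).
have dg s : s \in `[a, b] -> is_derive s (1 : R) g ('D_v f (w + s *: v)).
  by move=> /inab /H [? _]; exact: is_derive_line.
have dgo s : s \in `]a, b[ -> is_derive s (1 : R) g ('D_v f (w + s *: v)).
  by move=> sab; apply: dg; apply: subset_itv_oo_cc sab.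
have cg : {within `[a, b], continuous g}.
  apply: derivable_within_continuous => s sab.
  exact: @ex_derive _ _ _ _ _ _ _ (dg s sab).
have [s sab E] := MVT_segment ab dgo cg.
rewrite /g in E.
rewrite E -mulrBl normrM ler_wpM2r //.
by have [] := H s (inab s sab).
Qed.

(** From x to y along the edges of the box that they span, one coordinate at a
time: each edge is an instance of [mvt_line], so that partial derivatives
suffice. *)
Lemma mvt_box (R : realType) (n : nat) (f : 'rV[R]_n -> R) (c : 'I_n -> R)
    (e : R) (x y : 'rV[R]_n) :
  (forall z : 'rV[R]_n, (forall i, between (x 0 i) (y 0 i) (z 0 i)) ->
     forall i, derivable f z 'e_i /\ `|'D_'e_i f z - c i| <= e) ->
  `|f y - f x - \sum_i c i * (y 0 i - x 0 i)| <= e * \sum_i `|y 0 i - x 0 i|.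
Proof.
move=> H.
(* The vertices of the path along the edges. *)
pose h k : 'rV[R]_n := \row_i (if (i < k)%N then y 0 i else x 0 i).
have h0 : h 0%N = x by apply/rowP => i; rewrite mxE.
have hn : h n = y by apply/rowP => i; rewrite mxE ltn_ord.
have -> : f y - f x = \sum_(i < n) (f (h i.+1) - f (h i)).
  rewrite -{1}hn -{1}h0 -(telescope_sumr (fun k => f (h k)) (leq0n n)).
  by rewrite big_mkord.
rewrite -sumrB mulr_sumr (le_trans (ler_norm_sum _ _ _)) //.
apply: ler_sum => i _.
pose w : 'rV[R]_n := h i - x 0 i *: 'e_i.
have hi : h i = w + x 0 i *: 'e_i by rewrite subrK.
have wE s j : (w + s *: 'e_i) 0 j =
    if (j < i)%N then y 0 j else if j == i then s else x 0 j.
  rewrite !mxE eqxx /= -val_eqE; case: ltngtP => // [_|_|/val_inj ->].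
  - by rewrite !mulr0 subr0 addr0.
  - by rewrite !mulr0 subr0 addr0.
  - by rewrite !mulr1 subrr add0r.
have hi1 : h i.+1 = w + y 0 i *: 'e_i.
  apply/rowP => j; rewrite wE mxE ltnS leq_eqVlt orbC val_eqE.
  by have [->|ne] := eqVneq j i; rewrite ?ltnn ?eqxx //= orbF.
rewrite hi hi1; apply: mvt_line => s sb; apply: H => j; rewrite wE.
case: ifP => _; first by rewrite /between ge_min le_max !lexx !orbT.
case: eqP => [->//|_]; by rewrite /between ge_min le_max !lexx.
Qed.

Lemma coord_le_norm (R : realType) (m n : nat) (A : 'M[R]_(m, n)) i j :
  `|A i j| <= `|A|.
Proof.
rewrite [leRHS]/Num.Def.normr /= mx_normrE.
exact: (le_bigmax _ (fun ij => `|A ij.1 ij.2|) (i, j)).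
Qed.

Lemma norm_le_coord (R : realType) (m n : nat) (A : 'M[R]_(m, n)) e :
  0 <= e -> (forall i j, `|A i j| <= e) -> `|A| <= e.
Proof.
move=> e0 H; rewrite [leLHS]/Num.Def.normr /= mx_normrE.
by apply: bigmax_le => // -[i j] _; exact: H.
Qed.

Lemma norm_lt_coord (R : realType) (m n : nat) (A : 'M[R]_(m, n)) e :
  0 < e -> (forall i j, `|A i j| < e) -> `|A| < e.
Proof.
move=> e0 H; rewrite [ltLHS]/Num.Def.normr /= mx_normrE.
by apply: bigmax_lt => // -[i j] _; exact: H.
Qed.

Lemma between_dist (R : realType) (a b s c r : R) :
  between a b s -> `|c - a| < r -> `|c - b| < r -> `|c - s| < r.
Proof.
rewrite /between ge_min le_max => /andP[/orP[]l /orP[]u];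
rewrite !ltr_norml => /andP[? ?] /andP[? ?]; apply/andP; split; lra.
Qed.

Lemma between_ball (R : realType) (n : nat) (x y z w : 'rV[R]_n) r :
  ball x r y -> ball x r z -> (forall i, between (y 0 i) (z 0 i) (w 0 i)) ->
  ball x r w.
Proof.
rewrite -!ball_normE /ball_ /= => xy xz b.
apply: norm_lt_coord => [|i j]; first exact: le_lt_trans xy.
rewrite !mxE ord1; apply: between_dist (b j) _ _.
- by apply: le_lt_trans xy; have := coord_le_norm (x - y) 0 j; rewrite !mxE.
- by apply: le_lt_trans xz; have := coord_le_norm (x - z) 0 j; rewrite !mxE.
Qed.

Lemma sum_coord_le (R : realType) (n : nat) (x : 'rV[R]_n) :
  \sum_i `|x 0 i| <= n%:R * `|x|.
Proof.
rewrite mulr_natl -[X in _ *+ X]card_ord -sumr_const.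
by apply: ler_sum => i _; exact: coord_le_norm.
Qed.

Lemma sum_mul_coord_le (R : realType) (n : nat) (c : 'I_n -> R) (B : R)
    (x : 'rV[R]_n) :
  (forall i, `|c i| <= B) -> `|\sum_i c i * x 0 i| <= n%:R * B * `|x|.
Proof.
move=> H; rewrite (le_trans (ler_norm_sum _ _ _)) //.
rewrite [n%:R * B]mulrC -mulrA.
have [/eqP n0|n0] := eqVneq n 0%N.
  move: c x H; rewrite (eqP n0) => c x H.
  by rewrite big_ord0 mul0r mulr0.
have B0 : 0 <= B.
  by move: n0; rewrite -lt0n => n0; exact: le_trans (H (Ordinal n0)).
apply: le_trans (ler_wpM2l B0 (sum_coord_le x)).
by rewrite mulr_sumr; apply: ler_sum => i _; rewrite normrM ler_wpM2r.
Qed.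

(** Partial derivatives that are continuous at x are nearly constant on a small
ball, which is convex for the coordinatewise order of [between]; so [mvt_box]
applies with the derivatives at x as slopes.  The increment is controlled
between any two points of the ball, not only from its centre: this uniformity
is what compactness and inverse function arguments rest on. *)
Lemma C1_strict (R : realType) (n : nat) (U : set 'rV[R]_n) f x e :
  open U -> Ck 1 U f -> U x -> 0 < e ->
  \forall r \near 0^'+, ball x r `<=` U /\ forall y z, ball x r y -> ball x r z ->
    `|f z - f y - \sum_i 'D_'e_i f x * (z - y) 0 i| <= e * `|z - y|.
Proof.
move=> oU [cf df] Ux e0.
pose e' := e / n.+1%:R.
have e'0 : 0 < e' by rewrite divr_gt0 ?ltr0n.
have H : \forall y \near x, U y /\ forall i, `|'D_'e_i f y - 'D_'e_i f x| < e'.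
  have H1 : \forall y \near x, U y by exact: open_nbhs_nbhs.
  have H2 : \forall y \near x, forall i, `|'D_'e_i f y - 'D_'e_i f x| < e'.
    have Hi i : \forall y \near x, `|'D_'e_i f y - 'D_'e_i f x| < e'.
      have [_ [cd _]] := df i.
      have /cvgrPdist_lt /(_ _ e'0) := cd x Ux.
      by apply: filterS => y; rewrite distrC.
    exact: filter_forall Hi.
  by apply: filterS2 H1 H2.
have [r0 /= r00 Hr] := (@nbhs_ballP _ _ _ _).1 H.
near=> r.
have rr0 : r <= r0 by near: r; exact: nbhs_right_le.
have sub y : ball x r y -> ball x r0 y by exact: le_ball.
split=> [y xy|y z xy xz]; first by have [] := Hr y (sub y xy).
apply: (@le_trans _ _ (e' * \sum_i `|z 0 i - y 0 i|)).
  under eq_bigr do rewrite !mxE.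
  apply: mvt_box => w wb i.
  have [Uw Dw] := Hr w (sub w (between_ball xy xz wb)).
  by split; [apply: (df i).1|exact: ltW].
rewrite /e' -mulrA; apply: ler_wpM2l; first exact: ltW.
rewrite ler_pdivrMl ?ltr0n // (@le_trans _ _ (n%:R * `|z - y|)) //.
  by have := sum_coord_le (z - y); under eq_bigr do rewrite !mxE.
by rewrite ler_wpM2r // ler_nat.
Unshelve. all: by end_near. Qed.

(** * Curves converging uniformly on [0, 1] *)

Lemma cvg_sum_ord (R : realType) (T : Type) (F : set_system T) (n : nat)
    (f : 'I_n -> T -> R) (l : 'I_n -> R) :
  Filter F -> (forall i, f i x @[x --> F] --> l i) ->
  \sum_i f i x @[x --> F] --> \sum_i l i.
Proof.
move=> FF; elim: n f l => [|n IH] f l H.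
  rewrite big_ord0; under eq_fun do rewrite big_ord0; exact: cvg_cst.
rewrite big_ord_recl; under eq_fun do rewrite big_ord_recl.
by apply: cvgD; [exact: H|apply: IH => i; exact: H].
Qed.

Definition unif_cvg (R : realType) (T : Type) (F : set_system T)
    (u : T -> R -> R) (v : R -> R) : Prop :=
  forall e, 0 < e ->
    \forall s \near F, forall t, 0 <= t <= 1 -> `|u s t - v t| <= e.

Lemma itv01_bounded (R : realType) (v : R -> R) :
  continuous v -> exists2 M, 0 < M & forall t, 0 <= t <= 1 -> `|v t| <= M.
Proof.
move=> cv.
have cav : {within `[(0:R), 1], continuous (fun t => `|v t|)}.
  by apply: continuous_subspaceT => t; apply: cvg_norm; exact: cv.
have [c _ H] := EVT_max (ler01 : (0:R) <= 1) cav.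
exists (`|v c| + 1) => [|t t01]; first by rewrite ltr_wpDl.
by rewrite (le_trans (H t _)) // ?lerDl // in_itv.
Qed.

Section UnifCvg.
Context (R : realType) (T : Type) (F : set_system T) {FF : Filter F}.
Implicit Types (u : T -> R -> R) (v : R -> R).

Lemma unif_cvg_cst v : unif_cvg F (fun=> v) v.
Proof. by move=> e e0; apply: nearW => s t _; rewrite subrr normr0 ltW. Qed.

Lemma unif_cvg_ext u u' v v' :
  (\forall s \near F, forall t, 0 <= t <= 1 -> u s t = u' s t) ->
  (forall t, 0 <= t <= 1 -> v t = v' t) ->
  unif_cvg F u v -> unif_cvg F u' v'.
Proof.
move=> uu vv uv e e0; have := uv e e0.
by apply: filterS2 uu => s E H t t01; rewrite -E // -vv //; exact: H.
Qed.

Lemma unif_cvgD u1 u2 v1 v2 : unif_cvg F u1 v1 -> unif_cvg F u2 v2 ->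
  unif_cvg F (fun s t => u1 s t + u2 s t) (fun t => v1 t + v2 t).
Proof.
move=> H1 H2 e e0; have e20 : 0 < e / 2 by rewrite divr_gt0.
apply: filterS2 (H1 _ e20) (H2 _ e20) => s h1 h2 t t01.
rewrite opprD addrACA (le_trans (ler_normD _ _)) // (splitr e).
by apply: lerD; [exact: h1|exact: h2].
Qed.

Lemma unif_cvgM u1 u2 v1 v2 : continuous v1 -> continuous v2 ->
  unif_cvg F u1 v1 -> unif_cvg F u2 v2 ->
  unif_cvg F (fun s t => u1 s t * u2 s t) (fun t => v1 t * v2 t).
Proof.
move=> /itv01_bounded[M1 M10 b1] /itv01_bounded[M2 M20 b2] H1 H2 e e0.
(* With both deviations below d <= 1, the product deviates by at most
   d * d + M1 * d + d * M2 <= (1 + M1 + M2) * d. *)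
pose d := Num.min 1 (e / (M1 + M2 + 1)).
have M0 : 0 < M1 + M2 + 1 by rewrite !addr_gt0.
have d0 : 0 < d by rewrite lt_min ltr01 divr_gt0.
apply: filterS2 (H1 _ d0) (H2 _ d0) => s h1 h2 t t01.
have -> : u1 s t * u2 s t - v1 t * v2 t =
  (u1 s t - v1 t) * (u2 s t - v2 t) + v1 t * (u2 s t - v2 t) +
  (u1 s t - v1 t) * v2 t.
  by move: (u1 s t) (u2 s t) (v1 t) (v2 t) => a b c f; ring.
have {}h1 := h1 t t01; have {}h2 := h2 t t01.
have {}b1 := b1 t t01; have {}b2 := b2 t t01.
have dl : d <= 1 by rewrite ge_min lexx.
have dr : (M1 + M2 + 1) * d <= e.
  by rewrite -ler_pdivlMl // mulrC ge_min lexx orbT.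
apply: le_trans dr.
have -> : (M1 + M2 + 1) * d = 1 * d + M1 * d + d * M2 by ring.
rewrite (le_trans (ler_normD _ _)) // lerD //; last by rewrite normrM ler_pM.
rewrite (le_trans (ler_normD _ _)) // lerD //; last by rewrite normrM ler_pM.
by rewrite normrM ler_pM // (le_trans h1).
Qed.

Lemma unif_cvg_sum n (u : 'I_n -> T -> R -> R) (v : 'I_n -> R -> R) :
  (forall i, unif_cvg F (u i) (v i)) ->
  unif_cvg F (fun s t => \sum_i u i s t) (fun t => \sum_i v i t).
Proof.
elim: n u v => [|n IH] u v H.
  apply: (@unif_cvg_ext (fun=> fun=> 0) _ (fun=> 0)); last exact: unif_cvg_cst.
    by apply: nearW => s t _; rewrite big_ord0.
  by move=> t _; rewrite big_ord0.

have := unif_cvgD (H ord0) (IH (fun i => u (lift ord0 i))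
  (fun i => v (lift ord0 i)) (fun i => H (lift ord0 i))).
apply: unif_cvg_ext.
  by apply: nearW => s t _; rewrite big_ord_recl.
by move=> t _; rewrite big_ord_recl.
Qed.

End UnifCvg.

Lemma unif_cvg_comp (R : realType) (T T' : Type) (F : set_system T)
    (G : set_system T') (p : T' -> T) (u : T -> R -> R) v :
  p @ G `=>` F -> unif_cvg F u v -> unif_cvg G (fun s => u (p s)) v.
Proof. by move=> pG uv e e0; exact: (pG _ (uv e e0)). Qed.

Lemma cvg_line (R : realType) (V : normedModType R) (x v : V) :
  (fun h : R => h *: v + x) @ 0^' --> x.
Proof.
have H : (fun h : R => h *: v + x) @ (0 : R) --> x.
  rewrite -[X in _ --> X]add0r -(scale0r v).
  by apply: cvgD; [apply: cvgZr_tmp; exact: cvg_id|exact: cvg_cst].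
by move=> A /H; exact: nbhs_dnbhs.
Qed.

Lemma cvg_rV (R : realType) (T : Type) (F : set_system T) (n : nat)
    (f : T -> 'rV[R]_n) (l : 'rV[R]_n) :
  Filter F -> (forall i, f x 0 i @[x --> F] --> l 0 i) -> f x @[x --> F] --> l.
Proof.
move=> FF H; apply/cvgrPdist_lt => e e0.
have Hi i : \forall x \near F, `|l 0 i - f x 0 i| < e.
  by have /cvgrPdist_lt := H i; exact.
have := filter_forall FF Hi; apply: filterS => x Hx.
by apply: norm_lt_coord => // i j; rewrite !mxE ord1.
Qed.

(** A Lebesgue number argument: the property passes to smaller radii, so that one
radius can be found for all points of a compact set. *)
Lemma compact_uniform (R : realType) (V : normedModType R) (K : set V)
    (P : V -> V -> Prop) :
  compact K ->
  (forall x, K x ->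
     \forall r \near 0^'+, forall y z, ball x r y -> ball x r z -> P y z) ->
  exists2 d, 0 < d & forall x y, K x -> ball x d y -> P x y.
Proof.
move=> cK H.
suff /filter_ex[d [Hd d0]] : \forall d \near (0:R)^'+,
    (K `<=` [set x | forall y, ball x d y -> P x y]) /\ 0 < d.
  by exists d => // x y Kx; exact: Hd.
apply: filterI; last exact: nbhs_right_gt.
have nc := (compact_near_coveringP K).1 cK.
apply: (nc R (0:R)^'+ (fun d x => forall y, ball x d y -> P x y) _) => x Kx.
have /filter_ex[r [Hr r0]] : \forall r \near (0:R)^'+,
   (forall y z, ball x r y -> ball x r z -> P y z) /\ 0 < r.
  by apply: filterI (H x Kx) _; exact: nbhs_right_gt.
(* Half of the local radius goes to the distance from x to y, half to the one
   from y to z. *)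
near=> y d => /= z yz; have xy : ball x (r / 2) y.
  by near: y; apply: nbhsx_ballx; rewrite divr_gt0.
have dr : d <= r / 2.
  by near: d; apply: nbhs_right_le; rewrite divr_gt0.
apply: Hr; first by apply: le_ball xy; rewrite ler_pdivrMr // ler_peMr ?ler1n ?ltW.
by apply: ball_split xy (le_ball dr yz).
Unshelve. all: by end_near. Qed.

(** * Curves depending on a parameter in a C^k way *)

(** These are the C^k maps from Z to the space of continuous curves with the norm
of uniform convergence on [0, 1]: the difference quotients in a parameter
converge uniformly in time, to a family of curves that is again C^(k-1).
Solutions of integral equations depend on their parameters in this sense, and
integration in t acts on such families.  Families that are constant in time
are ordinary C^k functions, so that the product and composition rules proved
here yield those of [Ck] as well. *)
Fixpoint Ck_curve (R : realType) (m k : nat) (Z : set 'rV[R]_m)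
    (u : 'rV[R]_m -> R -> R) : Prop :=
  [/\ forall z, Z z -> continuous (u z),
      forall z, Z z -> unif_cvg (nbhs z) u (u z) &
      if k is k'.+1 then forall i : 'I_m, exists2 v, Ck_curve k' Z v &
        forall z, Z z -> unif_cvg 0^' (fun (h : R) t =>
          h^-1 * (u (h *: 'e_i + z) t - u z t)) (v z)
      else True].

Section CkCurveTheory.
Context (R : realType) (m : nat).
Implicit Types (Z : set 'rV[R]_m) (u v : 'rV[R]_m -> R -> R).

Lemma Ck_curve_cont k Z u z : Ck_curve k Z u -> Z z -> continuous (u z).
Proof. by case: k => [|k] [H _ _]; exact: H. Qed.

Lemma Ck_curve_unif k Z u z : Ck_curve k Z u -> Z z -> unif_cvg (nbhs z) u (u z).
Proof. by case: k => [|k] [_ H _]; exact: H. Qed.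

Lemma Ck_curve_unif_line k Z u z w : Ck_curve k Z u -> Z z ->
  unif_cvg 0^' (fun h : R => u (h *: w + z)) (u z).
Proof.
by move=> Cu Zz; apply: unif_cvg_comp (Ck_curve_unif Cu Zz); exact: cvg_line.
Qed.

Lemma Ck_curve_pred k Z u : Ck_curve k.+1 Z u -> Ck_curve k Z u.
Proof.
elim: k u => [|k IH] u [c1 c2 c3]; split=> // i.
by have [v Cv Hv] := c3 i; exists v => //; exact: IH.
Qed.

Lemma Ck_curve_ext k Z u v : open Z -> (forall z, Z z -> u z =1 v z) ->
  Ck_curve k Z u -> Ck_curve k Z v.
Proof.
move=> oZ uv.
have uvn z : Z z -> \forall y \near z, u y =1 v y.
  move=> Zz; have : \forall y \near z, Z y by exact: open_nbhs_nbhs.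
  by apply: filterS => y /uv.
have C1 : (forall z, Z z -> continuous (u z)) ->
          (forall z, Z z -> continuous (v z)).
  by move=> c z Zz; have <- : u z = v z; [exact/funext/uv|exact: c].
have C2 : (forall z, Z z -> unif_cvg (nbhs z) u (u z)) ->
          (forall z, Z z -> unif_cvg (nbhs z) v (v z)).
  move=> c z Zz; apply: unif_cvg_ext (c z Zz); last by move=> t _; exact: uv.
  by apply: filterS (uvn z Zz) => y E t _.
case: k => [|k] [c1 c2 c3]; split=> //; [exact: C1|exact: C2|exact: C1|
  exact: C2|].
move=> i; have [w Cw Hw] := c3 i; exists w => // z Zz.
apply: unif_cvg_ext (Hw z Zz) => //.
have H : \forall h \near (0:R)^', u (h *: 'e_i + z) =1 v (h *: 'e_i + z).
  exact: (@cvg_line R _ z 'e_i _ (uvn z Zz)).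
by apply: filterS H => h E t _; rewrite -E -uv.
Qed.

Lemma Ck_curve_cst k Z (c : R) : Ck_curve k Z (fun _ _ => c).
Proof.
elim: k c => [|k IH] c; split=> //.
- by move=> z _; apply: cst_continuous.
- by move=> z _; exact: unif_cvg_cst.
- by move=> z _; apply: cst_continuous.
- by move=> z _; exact: unif_cvg_cst.
- move=> i; exists (fun _ _ => 0) => // z _ e e0.
  by apply: nearW => h t _; rewrite subrr mulr0 subr0 normr0 ltW.
Qed.

Lemma Ck_curveD k Z u v : Ck_curve k Z u -> Ck_curve k Z v ->
  Ck_curve k Z (fun z t => u z t + v z t).
Proof.
have C1 (w1 w2 : 'rV[R]_m -> R -> R) : (forall z, Z z -> continuous (w1 z)) ->
    (forall z, Z z -> continuous (w2 z)) ->
    (forall z, Z z -> continuous (fun t => w1 z t + w2 z t)).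
  by move=> H1 H2 z Zz t; exact: (cvgD (H1 z Zz t) (H2 z Zz t)).
have C2 (w1 w2 : 'rV[R]_m -> R -> R) : (forall z, Z z -> unif_cvg (nbhs z) w1 (w1 z)) ->
    (forall z, Z z -> unif_cvg (nbhs z) w2 (w2 z)) ->
    (forall z, Z z -> unif_cvg (nbhs z) (fun z t => w1 z t + w2 z t)
                               (fun t => w1 z t + w2 z t)).
  by move=> H1 H2 z Zz; exact: (unif_cvgD (H1 z Zz) (H2 z Zz)).
elim: k u v => [|k IH] u v [cu uu du] [cv uv dv]; split=> //;
  [exact: C1|exact: C2|exact: C1|exact: C2|].
move=> i; have [u' Cu' Hu'] := du i; have [v' Cv' Hv'] := dv i.
exists (fun z t => u' z t + v' z t) => [|z Zz]; first exact: IH.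
apply: unif_cvg_ext (unif_cvgD (Hu' z Zz) (Hv' z Zz)) => //.
by apply: nearW => h t _; rewrite -mulrDr opprD addrACA.
Qed.

Lemma Ck_curveM k Z u v : Ck_curve k Z u -> Ck_curve k Z v ->
  Ck_curve k Z (fun z t => u z t * v z t).
Proof.
have C0 j w1 w2 z : Ck_curve j Z w1 -> Ck_curve j Z w2 -> Z z ->
    continuous (fun t => w1 z t * w2 z t).
  move=> C1 C2 Zz t.
  have H1 : continuous (w1 z) := Ck_curve_cont C1 Zz.
  have H2 : continuous (w2 z) := Ck_curve_cont C2 Zz.
  exact: cvgM (H1 t) (H2 t).
elim: k u v => [|k IH] u v Cu Cv; split=> //.
- by move=> z Zz t; exact: (C0 _ _ _ _ Cu Cv Zz).
- move=> z Zz; exact: (unif_cvgM (Ck_curve_cont Cu Zz) (Ck_curve_cont Cv Zz)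
    (Ck_curve_unif Cu Zz) (Ck_curve_unif Cv Zz)).
- by move=> z Zz t; exact: (C0 _ _ _ _ Cu Cv Zz).
- move=> z Zz; exact: (unif_cvgM (Ck_curve_cont Cu Zz) (Ck_curve_cont Cv Zz)
    (Ck_curve_unif Cu Zz) (Ck_curve_unif Cv Zz)).
move=> i; have [_ _ /(_ i)[u' Cu' Hu']] := Cu.
have [_ _ /(_ i)[v' Cv' Hv']] := Cv.
exists (fun z t => u' z t * v z t + u z t * v' z t).
  by apply: Ck_curveD; apply: IH => //; exact: Ck_curve_pred.
move=> z Zz.
have Hv := Ck_curve_unif_line 'e_i Cv Zz.
have FF : Filter (0:R)^' by exact: dnbhs_filter.
have H1 := unif_cvgM (FF := FF) (Ck_curve_cont Cu' Zz) (Ck_curve_cont Cv Zz) (Hu' z Zz) Hv.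
have H2 := unif_cvgM (FF := FF) (Ck_curve_cont Cu Zz) (Ck_curve_cont Cv' Zz)
             (unif_cvg_cst (FF := FF) (u z)) (Hv' z Zz).
apply: unif_cvg_ext (unif_cvgD (FF := FF) H1 H2) => //.
apply: nearW => h t _.
move: (u (h *: 'e_i + z) t) (v (h *: 'e_i + z) t) (u z t) (v z t) (h^-1).
by move=> a b c d e; ring.
Qed.

Lemma Ck_curve_sum k Z n (u : 'I_n -> 'rV[R]_m -> R -> R) :
  (forall i, Ck_curve k Z (u i)) -> Ck_curve k Z (fun z t => \sum_i u i z t).
Proof.
elim: n u => [|n IH] u H.
  by under eq_fun do under eq_fun do rewrite big_ord0; exact: Ck_curve_cst.
under eq_fun do under eq_fun do rewrite big_ord_recl.
by apply: Ck_curveD; [exact: H|apply: IH].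
Qed.

Lemma Ck_curveZ k Z (c : R) u : Ck_curve k Z u -> Ck_curve k Z (fun z t => c * u z t).
Proof. by move=> Cu; apply: Ck_curveM => //; exact: Ck_curve_cst. Qed.

Lemma Ck_curve_of_Ck k Z f : Ck k Z f -> Ck_curve k Z (fun z _ => f z).
Proof.
have C2 (g : 'rV[R]_m -> R) z : {for z, continuous g} ->
    unif_cvg (nbhs z) (fun z _ => g z) (fun=> g z).
  move=> /cvgrPdist_le cg e e0; have := cg e e0.
  by apply: filterS => y H t _; rewrite distrC.
elim: k f => [|k IH] f [cf df]; split=> //.
- by move=> z _; exact: cst_continuous.
- by move=> z Zz; apply: C2; exact: cf.
- by move=> z _; exact: cst_continuous.
- by move=> z Zz; apply: C2; exact: cf.
move=> i; exists (fun z _ => 'D_'e_i f z); first by apply: IH; exact: (df i).2.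
move=> z Zz e e0.
have /cvgrPdist_le/(_ e e0) := (df i).1 z Zz.
by apply: filterS => h H t _; rewrite distrC.
Qed.

Lemma Ck_cont k (Z : set 'rV[R]_m) (f : 'rV[R]_m -> R) z :
  Ck k Z f -> Z z -> {for z, continuous f}.
Proof. by case: k => [|k] [cf _]; exact: cf. Qed.

Lemma near_eq_on (T : topologicalType) (Y : Type) (Z : set T) (f g : T -> Y) z :
  open Z -> (forall z, Z z -> f z = g z) -> Z z -> \forall y \near z, f y = g y.
Proof.
move=> oZ fg Zz; have : \forall y \near z, Z y by exact: open_nbhs_nbhs.
by apply: filterS => y /fg.
Qed.

Lemma continuous_on_ext (Z : set 'rV[R]_m) (f g : 'rV[R]_m -> R) :
  open Z -> (forall z, Z z -> f z = g z) ->
  (forall z, Z z -> {for z, continuous f}) ->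
  forall z, Z z -> {for z, continuous g}.
Proof.
move=> oZ fg cf z Zz; have : f @ z --> f z := cf z Zz.
rewrite /prop_for /continuous_at fg // => H; apply: cvg_trans H.
exact: (near_eq_cvg (near_eq_on oZ fg Zz)).
Qed.

Lemma Ck_ext k (Z : set 'rV[R]_m) (f g : 'rV[R]_m -> R) :
  open Z -> (forall z, Z z -> f z = g z) -> Ck k Z f -> Ck k Z g.
Proof.
move=> oZ; elim: k f g => [|k IH] f g fg [cf df].
  by split=> //; exact: continuous_on_ext fg cf.
split=> [|i]; first exact: continuous_on_ext fg cf.
split=> [z Zz|].
  by apply: near_eq_derivable (near_eq_on oZ fg Zz) _; exact: (df i).1.
apply: IH (df i).2 => z Zz; exact: near_eq_derive (near_eq_on oZ fg Zz).
Qed.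

(** Evaluation at a fixed time is continuous for uniform convergence, hence
carries the derivatives of the family to derivatives of its values. *)
Lemma Ck_of_Ck_curve k Z u t : open Z -> 0 <= t <= 1 -> Ck_curve k Z u ->
  Ck k Z (fun z => u z t).
Proof.
move=> oZ t01.
have C2 (w : 'rV[R]_m -> R -> R) z :
    unif_cvg (nbhs z) w (w z) -> {for z, continuous (fun z => w z t)}.
  move=> H; apply/(@cvgrPdist_le _ _ _ (nbhs z)) => e e0.
  apply: filterS (H e e0) => y Hy.
  by rewrite distrC; exact: Hy.
elim: k u => [|k IH] u [cu uu du]; split=> //.
- by move=> z Zz; apply: C2; exact: uu.
- by move=> z Zz; apply: C2; exact: uu.
move=> i; have [v Cv Hv] := du i.
have D z : Z z -> (fun h : R => h^-1 *: (((fun z => u z t) \o shift z) (h *: 'e_i)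
    - u z t)) @ 0^' --> v z t.
  move=> Zz; apply/cvgrPdist_le => e e0; apply: filterS (Hv z Zz e e0) => h Hh.
  by rewrite distrC; exact: Hh.
split=> [z Zz|]; first by apply/cvg_ex; exists (v z t); exact: D.
apply: Ck_ext (IH v Cv) => // z Zz.
by apply/esym/cvg_lim => //; exact: D.
Qed.

End CkCurveTheory.

Lemma unif_cvg_rV (R : realType) (T : Type) (F : set_system T) (n : nat)
    (X : T -> R -> 'rV[R]_n) (x : R -> 'rV[R]_n) e :
  Filter F -> (forall i, unif_cvg F (fun s t => X s t 0 i) (fun t => x t 0 i)) ->
  0 < e ->
  \forall s \near F, forall t, 0 <= t <= 1 -> ball (x t) e (X s t).
Proof.
move=> FF H e0; have e20 : 0 < e / 2 by rewrite divr_gt0.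
have Hi i : \forall s \near F, forall t, 0 <= t <= 1 ->
  `|X s t 0 i - x t 0 i| <= e / 2 by exact: H.
have := filter_forall FF Hi; apply: filterS => s Hs t t01.
rewrite -ball_normE /ball_ /= distrC.
apply: norm_lt_coord => // i j; rewrite !mxE ord1.
by apply: le_lt_trans (Hs j t t01) _; rewrite ltr_pdivrMr // ltr_pMr // ltr1n.
Qed.

Lemma continuous_rV (R : realType) (T : topologicalType) (n : nat)
    (x : T -> 'rV[R]_n) :
  (forall i, continuous (fun t => x t 0 i)) -> continuous x.
Proof. by move=> H t; apply: cvg_rV => i; exact: H. Qed.

Lemma compact_curve (R : realType) (n : nat) (x : R -> 'rV[R]_n) :
  continuous x -> compact (x @` [set t | 0 <= t <= 1]).
Proof.
move=> cx; apply: continuous_compact; first exact: continuous_subspaceT.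
have -> : [set t : R | 0 <= t <= 1] = `[0, 1]%classic.
  by apply/seteqP; split=> t; rewrite /= in_itv.
exact: segment_compact.
Qed.

Lemma near_ball_uniform (R : realType) (V : normedModType R) (x : V) (Q : V -> Prop)
    (P : V -> V -> Prop) :
  (\forall y \near x, Q y) -> (forall y z, Q y -> Q z -> P y z) ->
  \forall r \near (0:R)^'+, forall y z, ball x r y -> ball x r z -> P y z.
Proof.
move=> /nbhs_ballP[r0 /= r00 H] QP; near=> r => y z xy xz.
have rr0 : r <= r0 by near: r; exact: nbhs_right_le.
by apply: QP; apply: H; exact: le_ball rr0 _ _.
Unshelve. all: by end_near. Qed.

Lemma unif_cvg_continuous_comp (R : realType) (T : Type) (F : set_system T)
    (n : nat) (U : set 'rV[R]_n) (V : 'rV[R]_n -> R)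
    (X : T -> R -> 'rV[R]_n) (x : R -> 'rV[R]_n) :
  Filter F -> (forall y, U y -> {for y, continuous V}) ->
  continuous x -> (forall t, U (x t)) ->
  (forall i, unif_cvg F (fun s t => X s t 0 i) (fun t => x t 0 i)) ->
  unif_cvg F (fun s t => V (X s t)) (fun t => V (x t)).
Proof.
move=> FF cV cx Ux H e e0; have e20 : 0 < e / 2 by rewrite divr_gt0.
have [|d d0 Hd] := @compact_uniform R _ _ (fun y z => `|V z - V y| <= e)
    (compact_curve cx).
  move=> _ [t _ <-].
  have /cvgrPdist_le/(_ _ e20) := cV _ (Ux t) => /near_ball_uniform; apply.
  move=> y z yV zV; rewrite (splitr e).
  rewrite -(subrKA (V (x t))) (le_trans (ler_normD _ _)) //.
  by apply: lerD => //; rewrite distrC.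
apply: filterS (unif_cvg_rV FF H d0) => s Hs t t01.
by apply: Hd; [exists t|exact: Hs].
Qed.

(** [C1_strict] uniformly along a compact set.  Its slopes are the derivatives at
the centre of a ball; replacing them by those at the first point of a pair
costs as much again, by continuity of the derivatives. *)
Lemma compact_taylor (R : realType) (n : nat) (U : set 'rV[R]_n)
    (V : 'rV[R]_n -> R) (K : set 'rV[R]_n) e :
  open U -> Ck 1 U V -> compact K -> K `<=` U -> 0 < e ->
  exists2 d, 0 < d & forall x y, K x -> ball x d y ->
    `|V y - V x - \sum_i 'D_'e_i V x * (y - x) 0 i| <= e * `|y - x|.
Proof.
move=> oU CV cK KU e0.
have cdV i y : U y -> {for y, continuous (fun y => 'D_'e_i V y)}.
  by move=> Uy; exact: (CV.2 i).2.1.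
apply: compact_uniform => // x /KU Ux.
pose e2 := e / 2 / n.+1%:R.
have e20 : 0 < e2 by rewrite !divr_gt0 // ltr0n.
have h20 : 0 < e / 2 by rewrite divr_gt0.
have N1 : \forall r \near (0:R)^'+, forall y z, ball x r y ->
    ball x r z -> forall i, `|'D_'e_i V y - 'D_'e_i V x| <= e2.
  apply: (@near_ball_uniform _ _ _
    (fun y => forall i, `|'D_'e_i V y - 'D_'e_i V x| <= e2)) => //.
  have Hi i : \forall y \near x, `|'D_'e_i V y - 'D_'e_i V x| <= e2.
    have /cvgrPdist_le/(_ _ e20) := cdV i _ Ux.
    by apply: filterS => y; rewrite distrC.
  exact: filter_forall Hi.
apply: filterS2 N1 (C1_strict oU CV Ux h20) => r H1 [_ H2] y z xy xz.
have -> : V z - V y - \sum_i 'D_'e_i V y * (z - y) 0 i =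
  (V z - V y - \sum_i 'D_'e_i V x * (z - y) 0 i) -
  \sum_i ('D_'e_i V y - 'D_'e_i V x) * (z - y) 0 i.
  have -> : \sum_i ('D_'e_i V y - 'D_'e_i V x) * (z - y) 0 i =
    \sum_i 'D_'e_i V y * (z - y) 0 i - \sum_i 'D_'e_i V x * (z - y) 0 i.
    by rewrite -sumrB; apply: eq_bigr => i _; rewrite mulrBl.
  by rewrite opprB addrA subrK.
rewrite (le_trans (ler_normB _ _)) // [e in leRHS]splitr mulrDl.
apply: lerD; first exact: H2.
apply: le_trans (sum_mul_coord_le _ (H1 y z xy xz)) _.
apply: ler_wpM2r => //; rewrite /e2 mulrCA.
by rewrite ger_pMr // ler_pdivrMr ?ltr0n // mul1r ler_nat.
Qed.

(** The chain rule for V o X, uniformly in time: the main term is the sum of the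
partial derivatives along x times the difference quotients of X, and the
remainder is small by [compact_taylor] on the compact image of x. *)
Lemma unif_cvg_deriv_comp (R : realType) (n : nat) (U : set 'rV[R]_n)
    (V : 'rV[R]_n -> R) (X : R -> R -> 'rV[R]_n) (x x' : R -> 'rV[R]_n) :
  open U -> Ck 1 U V -> continuous x -> (forall t, U (x t)) ->
  continuous x' ->
  (forall i, unif_cvg 0^' (fun h t => X h t 0 i) (fun t => x t 0 i)) ->
  (forall i, unif_cvg 0^' (fun (h : R) t => h^-1 * (X h t 0 i - x t 0 i))
                          (fun t => x' t 0 i)) ->
  unif_cvg 0^' (fun (h : R) t => h^-1 * (V (X h t) - V (x t)))
               (fun t => \sum_i 'D_'e_i V (x t) * x' t 0 i).
Proof.
move=> oU CV cx Ux cx' HX HX'.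
have FF : Filter (0:R)^' by exact: dnbhs_filter.
have cdV i y : U y -> {for y, continuous (fun y => 'D_'e_i V y)}.
  by move=> Uy; exact: (CV.2 i).2.1.
have cDx i : continuous (fun t => 'D_'e_i V (x t)).
  by move=> t; exact: (continuous_comp (cx t) (cdV i _ (Ux t))).
have cx'i i : continuous (fun t => x' t 0 i).
  move=> t; exact: (continuous_comp (cx' t) (@coord_continuous _ _ _ 0 i _)).
have S1 : unif_cvg 0^'
   (fun (h : R) t => \sum_i 'D_'e_i V (x t) * (h^-1 * (X h t 0 i - x t 0 i)))
   (fun t => \sum_i 'D_'e_i V (x t) * x' t 0 i).
  apply: (unif_cvg_sum (FF := FF)) => i.
  exact: (unif_cvgM (FF := FF) (cDx i) (cx'i i)
           (unif_cvg_cst (FF := FF) _) (HX' i)).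
pose rem (h : R) t := V (X h t) - V (x t) -
  \sum_i 'D_'e_i V (x t) * (X h t - x t) 0 i.
have S2 : unif_cvg 0^' (fun (h : R) t => h^-1 * rem h t) (fun=> 0).
  move=> e e0.
  have [M M0 bM] : exists2 M, 0 < M & forall t, 0 <= t <= 1 -> `|x' t| <= M.
    have cn : continuous (fun t => `|x' t|).
      by move=> t; apply: cvg_norm; exact: cx'.
    have [M M0 HM] := itv01_bounded cn; exists M => // t t01.
    by have := HM t t01; rewrite normr_id.
  have M10 : 0 < M + 1 by rewrite addr_gt0.
  (* The difference quotients of X are eventually bounded by M + 1. *)
  pose e' := e / (M + 1); have e'0 : 0 < e' by rewrite divr_gt0.
  have KU : x @` [set t | 0 <= t <= 1] `<=` U by move=> _ [t _ <-].
  have [d d0 Hd] := compact_taylor oU CV (compact_curve cx) KU e'0.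
  have N2 := @unif_cvg_rV _ _ _ _ _ _ _ FF HX d0.
  have N3 : \forall h \near (0:R)^', forall t, 0 <= t <= 1 ->
      ball (x' t) 1 (h^-1 *: (X h t - x t)).
    apply: (@unif_cvg_rV _ _ _ _ (fun h t => h^-1 *: (X h t - x t))) => // i.
    by apply: unif_cvg_ext (HX' i) => //; apply: nearW => h t _; rewrite !mxE.
  apply: filterS2 N2 N3 => h H2 H3 t t01.
  rewrite subr0 normrM.
  have Hr : `|rem h t| <= e' * `|X h t - x t|.
    by apply: Hd; [exists t|exact: H2].
  apply: le_trans (ler_wpM2l (normr_ge0 _) Hr) _.
  rewrite mulrCA -normrZ /e' -mulrA ger_pMr // ler_pdivrMl // mulr1.
  have := H3 t t01; rewrite -ball_normE /ball_ /= => /ltW H3t.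
  rewrite -[h^-1 *: _](subrKC (x' t)) (le_trans (ler_normD _ _)) //.
  by apply: lerD; [exact: bM|rewrite distrC].
have := unif_cvgD (FF := FF) S1 S2; apply: unif_cvg_ext.
  apply: nearW => h t _; rewrite /rem mulrBr addrC.
  rewrite mulr_sumr -[X in _ = X]addr0 -addrA; congr (_ + _).
  apply/eqP; rewrite addrC subr_eq0; apply/eqP/eq_bigr => i _.
  by rewrite !mxE mulrCA.
by move=> t _; rewrite addr0.
Qed.

Lemma Ck_S1 (R : realType) (n k : nat) (U : set 'rV[R]_n) f :
  Ck k.+1 U f -> Ck 1 U f.
Proof.
move=> [cf df]; split=> // i; split; first exact: (df i).1.
by split=> // x Ux; exact: Ck_cont (df i).2 Ux.
Qed.

Lemma Ck_curve_comp (R : realType) (m n k : nat) (Z : set 'rV[R]_m)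
    (U : set 'rV[R]_n) (V : 'rV[R]_n -> R) (X : 'rV[R]_m -> R -> 'rV[R]_n) :
  open U -> Ck k U V -> (forall i, Ck_curve k Z (fun z t => X z t 0 i)) ->
  (forall z t, Z z -> U (X z t)) -> Ck_curve k Z (fun z t => V (X z t)).
Proof.
move=> oU CV CX UX.
have cX z : Z z -> continuous (X z).
  by move=> Zz; apply: continuous_rV => i; exact: (Ck_curve_cont (CX i) Zz).
have base W : (forall y, U y -> {for y, continuous W}) ->
   (forall z, Z z -> continuous (fun t => W (X z t))) /\
   (forall z, Z z -> unif_cvg (nbhs z) (fun z t => W (X z t))
                                       (fun t => W (X z t))).
  move=> cW; split=> [z Zz t|z Zz].
    exact: continuous_comp (cX z Zz t) (cW _ (UX z t Zz)).
  apply: (@unif_cvg_continuous_comp _ _ _ _ U) => //; first exact: cX.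
    by move=> t; exact: UX.
  by move=> i; exact: Ck_curve_unif (CX i) Zz.
elim: k V CV CX => [|k IH] V CV CX.
  by have [? ?] := base V CV.1; split.
have [? ?] := base V CV.1; split=> // i.
have H j : exists v, Ck_curve k Z v /\ forall z, Z z -> unif_cvg 0^'
    (fun (h : R) t => h^-1 * (X (h *: 'e_i + z) t 0 j - X z t 0 j)) (v z).
  by have [_ _ /(_ i)[v ? ?]] := CX j; exists v.
have [v Hv] := choice H.
exists (fun z t => \sum_j 'D_'e_j V (X z t) * v j z t).
  apply: Ck_curve_sum => j; apply: Ck_curveM; last exact: (Hv j).1.
  apply: (IH (fun y => 'D_'e_j V y)); first exact: (CV.2 j).2.
  by move=> l; exact: Ck_curve_pred.
move=> z Zz.
pose x' t := \row_j v j z t.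
have E t : \sum_j 'D_'e_j V (X z t) * x' t 0 j =
           \sum_j 'D_'e_j V (X z t) * v j z t.
  by apply: eq_bigr => j _; rewrite mxE.
suff : unif_cvg 0^'
     (fun (h : R) t => h^-1 * (V (X (h *: 'e_i + z) t) - V (X z t)))
     (fun t => \sum_j 'D_'e_j V (X z t) * x' t 0 j).
  by move=> S; apply: unif_cvg_ext S => //; exact: nearW.
apply: (@unif_cvg_deriv_comp R n U V (fun h => X (h *: 'e_i + z))) => //.
- exact: Ck_S1 CV.
- exact: cX.
- by move=> t; apply: UX.
- apply: continuous_rV => j t; rewrite /x'; under eq_fun do rewrite mxE.
  have := Ck_curve_cont (Hv j).1 Zz; exact.
- by move=> j; exact: (Ck_curve_unif_line 'e_i (CX j) Zz).
- move=> j; have := (Hv j).2 z Zz; apply: unif_cvg_ext.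
    exact: nearW.
  by move=> t _; rewrite mxE.
Qed.

(** * Calculus of C^k functions *)

Section CkTheory.
Context (R : realType).

Lemma Ck_pred n k (U : set 'rV[R]_n) f : Ck k.+1 U f -> Ck k U f.
Proof.
elim: k f => [|k IH] f [cf df]; split=> // i.
by split; [exact: (df i).1|apply: IH; exact: (df i).2].
Qed.

Lemma Ck_comp m n k (Z : set 'rV[R]_m) (U : set 'rV[R]_n) f
    (G : 'rV[R]_m -> 'rV[R]_n) :
  open Z -> open U -> Ck k U f -> (forall i, Ck k Z (fun z => G z 0 i)) ->
  (forall z, Z z -> U (G z)) -> Ck k Z (fun z => f (G z)).
Proof.
move=> oZ oU Cf CG UG.
have l01 : 0 <= (0:R) <= 1 by rewrite lexx ler01.
apply: (Ck_of_Ck_curve (u := fun z _ => f (G z)) oZ l01).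
apply: (Ck_curve_comp (X := fun z _ => G z) oU Cf) => [i|z _ Zz]; last exact: UG.
exact: Ck_curve_of_Ck.
Qed.

Lemma CkD m k (Z : set 'rV[R]_m) f g :
  open Z -> Ck k Z f -> Ck k Z g -> Ck k Z (fun z => f z + g z).
Proof.
move=> oZ Cf Cg; have l01 : 0 <= (0:R) <= 1 by rewrite lexx ler01.
apply: (Ck_of_Ck_curve (u := fun z _ => f z + g z) oZ l01).
exact: Ck_curveD (Ck_curve_of_Ck Cf) (Ck_curve_of_Ck Cg).
Qed.

Lemma CkM m k (Z : set 'rV[R]_m) f g :
  open Z -> Ck k Z f -> Ck k Z g -> Ck k Z (fun z => f z * g z).
Proof.
move=> oZ Cf Cg; have l01 : 0 <= (0:R) <= 1 by rewrite lexx ler01.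
apply: (Ck_of_Ck_curve (u := fun z _ => f z * g z) oZ l01).
exact: Ck_curveM (Ck_curve_of_Ck Cf) (Ck_curve_of_Ck Cg).
Qed.

Lemma Ck_cst m k (Z : set 'rV[R]_m) (c : R) : Ck k Z (fun=> c).
Proof.
elim: k c => [|k IH] c; split=> //; try by move=> z _; exact: cst_continuous.
move=> i; split=> [z _|]; first exact: derivable_cst.
suff -> : (fun x => 'D_'e_i (fun=> c) x) = (fun=> 0) :> ('rV[R]_m -> R).
  exact: IH.
by apply: funext => z; exact: derive_cst.
Qed.

Lemma Ck_sum m k (Z : set 'rV[R]_m) (I : Type) (r : seq I) (P : pred I)
    (f : I -> 'rV[R]_m -> R) :
  open Z -> (forall i, Ck k Z (f i)) ->
  Ck k Z (fun z => \sum_(i <- r | P i) f i z).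
Proof.
move=> oZ H; elim: r => [|i r IH].
  by under eq_fun do rewrite big_nil; exact: Ck_cst.
under eq_fun do rewrite big_cons.
by case: (P i) => //; apply: CkD.
Qed.

Lemma Ck_prod m k (Z : set 'rV[R]_m) (I : Type) (r : seq I) (P : pred I)
    (f : I -> 'rV[R]_m -> R) :
  open Z -> (forall i, Ck k Z (f i)) ->
  Ck k Z (fun z => \prod_(i <- r | P i) f i z).
Proof.
move=> oZ H; elim: r => [|i r IH].
  by under eq_fun do rewrite big_nil; exact: Ck_cst.
under eq_fun do rewrite big_cons.
by case: (P i) => //; apply: CkM.
Qed.

Lemma is_derive_coord m (i : 'I_m) (z v : 'rV[R]_m) :
  is_derive z v (fun z : 'rV[R]_m => z 0 i) (v 0 i).
Proof.
have E : (fun h : R => h^-1 *: (((fun z : 'rV[R]_m => z 0 i) \o shift z) (h *: v)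
            - z 0 i)) @ 0^' --> v 0 i.
  have : (fun=> v 0 i) @ (0:R)^' --> v 0 i by exact: cvg_cst.
  apply: cvg_trans; apply: near_eq_cvg; near=> h.
  rewrite /= !mxE addrK; apply/esym/mulKf.
  by near: h; exact: nbhs_dnbhs_neq.
by split; [apply/cvg_ex; exists (v 0 i)|exact/cvg_lim].
Unshelve. all: by end_near. Qed.

Lemma Ck_coord m k (Z : set 'rV[R]_m) (i : 'I_m) : Ck k Z (fun z => z 0 i).
Proof.
case: k => [|k]; split=> //; try by move=> z _; exact: coord_continuous.
move=> j; split=> [z _|]; first by have [] := is_derive_coord i z 'e_j.
have -> : (fun x => 'D_'e_j (fun z : 'rV[R]_m => z 0 i) x) =
    (fun=> ('e_j : 'rV[R]_m) 0 i).
  by apply: funext => z; have [] := is_derive_coord i z 'e_j.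
exact: Ck_cst.
Qed.

Lemma CkV m k (Z : set 'rV[R]_m) f :
  open Z -> (forall z, Z z -> f z != 0) -> Ck k Z f -> Ck k Z (fun z => (f z)^-1).
Proof.
move=> oZ f0; elim: k => [|k IH] Cf.
  by split=> // z Zz; exact: (cvgV (f0 z Zz) (Cf.1 z Zz)).
split=> [z Zz|i]; first by exact: (cvgV (f0 z Zz) (Cf.1 z Zz)).
have [di Cdi] := Cf.2 i.
split=> [z Zz|]; first by apply: derivableV; [exact: f0|exact: di].
have CV := IH (Ck_pred Cf).
apply: (Ck_ext (f := fun z => -1 * ((f z)^-1 * (f z)^-1 * 'D_'e_i f z))) => //.
  move=> z Zz; rewrite deriveV; [|exact: f0|exact: di].
  by rewrite mulN1r scaleNr expr2 invfM.
by apply: CkM => //; [exact: Ck_cst|apply: CkM => //; exact: CkM].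
Qed.

(** A particular case of [unif_cvg_deriv_comp], with curves that are constant in
time. *)
Lemma chain_rule (W : normedModType R) n (U : set 'rV[R]_n) f
    (G : W -> 'rV[R]_n) z v :
  open U -> Ck 1 U f -> U (G z) ->
  (forall j, {for z, continuous (fun z => G z 0 j)}) ->
  (forall j, derivable (fun z => G z 0 j) z v) ->
  is_derive z v (fun z => f (G z))
    (\sum_j 'D_'e_j f (G z) * 'D_v (fun z => G z 0 j) z).
Proof.
move=> oU Cf Uz cG dG.
pose x' := \row_j 'D_v (fun z => G z 0 j) z.
have H : unif_cvg 0^'
    (fun (h : R) t => h^-1 * (f (G (h *: v + z)) - f (G z)))
    (fun=> \sum_j 'D_'e_j f (G z) * x' 0 j).
  apply: (@unif_cvg_deriv_comp R n U f (fun h _ => G (h *: v + z))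
    (fun=> G z) (fun=> x')) => //; try by move=> ?; exact: cvg_cst.
  - move=> j e e0.
    have cj : (fun h : R => G (h *: v + z) 0 j) @ 0^' --> G z 0 j.
      exact: (cvg_comp _ _ (@cvg_line R _ z v) (cG j)).
    move/cvgrPdist_le : cj => /(_ _ e0); apply: filterS => h Hh t _.
    by rewrite distrC.
  - move=> j e e0; have /cvgrPdist_le /(_ _ e0) := dG j.
    apply: filterS => h Hh t _; rewrite distrC [x' 0 j]mxE; exact: Hh.
have E : (fun h : R => h^-1 *: (((fun z => f (G z)) \o shift z) (h *: v)
    - f (G z))) @ 0^' --> \sum_j 'D_'e_j f (G z) * 'D_v (fun z => G z 0 j) z.
  apply/cvgrPdist_le => e e0; have := H e e0; apply: filterS => h Hh.
  have := Hh 0; rewrite lexx ler01 => /(_ isT); rewrite distrC.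
  by under eq_bigr do rewrite mxE.
by split; [apply/cvg_ex; eexists; exact: E|exact/cvg_lim].
Qed.

Lemma is_derive_shift_arg m (f : 'rV[R]_m -> R) a w v :
  derivable f (w + a) v -> is_derive w v (fun w => f (w + a)) ('D_v f (w + a)).
Proof.
have E : (fun h : R => h^-1 *: (((fun w => f (w + a)) \o shift w) (h *: v)
            - f (w + a))) =
   (fun h => h^-1 *: ((f \o shift (w + a)) (h *: v) - f (w + a))).
  by apply/funext => h /=; rewrite -addrA.
by move=> df; split; rewrite /derivable /derive E.
Qed.

(** The mean value theorem applied twice: the second difference is the increment
along 'e_i of the function g w = f (w + h *: 'e_j) - f w, whose derivative is
an increment along 'e_j of 'D_'e_i f. *)
Lemma clairaut_quotient m (f : 'rV[R]_m -> R) x (i j : 'I_m) A e r h :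
  0 < h -> h + h < r ->
  (forall y, ball x r y -> [/\ derivable f y 'e_i,
     derivable (fun z => 'D_'e_i f z) y 'e_j &
     `|'D_'e_j (fun z => 'D_'e_i f z) y - A| <= e]) ->
  `|f (x + h *: 'e_i + h *: 'e_j) - f (x + h *: 'e_i) - f (x + h *: 'e_j) + f x
    - A * h * h| <= e * h * h.
Proof.
move=> h0 hr H.
pose g w := f (w + h *: 'e_j) - f w.
have ne (k : 'I_m) : `|'e_k : 'rV[R]_m| <= 1.
  apply: norm_le_coord => // a b; rewrite !mxE.
  by case: (_ && _); rewrite ?normr1 ?normr0.
have Hb s t : between 0 h s -> between 0 h t ->
    ball x r (x + s *: 'e_i + t *: 'e_j).
  rewrite /between (min_idPl (ltW h0)) (max_idPr (ltW h0)) => /andP[s0 sh] /andP[t0 th].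
  rewrite -ball_normE /ball_ /= -addrA opprD addrA subrr add0r normrN.
  apply: le_lt_trans hr; rewrite (le_trans (ler_normD _ _)) // !normrZ.
  rewrite !ger0_norm //; apply: lerD.
    by rewrite (le_trans _ sh) // ler_piMr.
  by rewrite (le_trans _ th) // ler_piMr.
have b0 : between 0 h (0:R).
  by rewrite /between (min_idPl (ltW h0)) (max_idPr (ltW h0)) lexx ltW.
have Hi s : between 0 h s -> derivable g (x + s *: 'e_i) 'e_i /\
    `|'D_'e_i g (x + s *: 'e_i) - A * h| <= e * h.
  move=> bs.
  have d1 : derivable f (x + s *: 'e_i + h *: 'e_j) 'e_i.
    have [] // := H (x + s *: 'e_i + h *: 'e_j); apply: Hb => //.
    by rewrite /between (min_idPl (ltW h0)) (max_idPr (ltW h0)) lexx ltW.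
  have d2 : derivable f (x + s *: 'e_i) 'e_i.
    by have [] // := H (x + s *: 'e_i); have := Hb s 0 bs b0;
       rewrite scale0r addr0.
  have I1 := is_derive_shift_arg d1.
  have I2 : is_derive (x + s *: 'e_i) 'e_i f ('D_'e_i f (x + s *: 'e_i)) by [].
  have [D1 D2] := is_deriveB I1 I2.
  split; first exact: D1.
  rewrite [X in X - _]D2.
  have := @mvt_line R _ (fun z => 'D_'e_i f z) (x + s *: 'e_i) 'e_j A e 0 h.
  rewrite scale0r addr0 subr0 (ger0_norm (ltW h0)); apply => t bt.
  by have [] := H _ (Hb s t bs bt).
have := @mvt_line R _ g x 'e_i (A * h) (e * h) 0 h Hi.
rewrite scale0r addr0 subr0 (ger0_norm (ltW h0)) /g.
by rewrite opprB [f x - _]addrC addrA.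
Qed.

(** The second difference is symmetric in i and j, and by [clairaut_quotient] it
approximates h^2 times either of the mixed derivatives. *)
Lemma clairaut m (U : set 'rV[R]_m) f x i j :
  open U -> Ck 2 U f -> U x ->
  'D_'e_j (fun z => 'D_'e_i f z) x = 'D_'e_i (fun z => 'D_'e_j f z) x.
Proof.
move=> oU Cf Ux; apply/eqP; rewrite -subr_eq0 -normr_le0.
apply/ler_addgt0Pr => e e0; rewrite add0r.
have e20 : 0 < e / 2 by rewrite divr_gt0.
have N a b : \forall y \near x, [/\ derivable f y 'e_a,
     derivable (fun z => 'D_'e_a f z) y 'e_b &
     `|'D_'e_b (fun z => 'D_'e_a f z) y - 'D_'e_b (fun z => 'D_'e_a f z) x|
       <= e / 2].
  have N1 : \forall y \near x, U y by exact: open_nbhs_nbhs.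
  have /cvgrPdist_le /(_ _ e20) N2 := ((Cf.2 a).2.2 b).2.1 x Ux.
  apply: filterS2 N1 N2 => y Uy Hy; split.
  - exact: (Cf.2 a).1.
  - exact: ((Cf.2 a).2.2 b).1.
  - by rewrite distrC.
have [r /= r0 Hr] := (@nbhs_ballP _ _ _ _).1 (filterI (N i j) (N j i)).
pose h := r / 3; have h0 : 0 < h by rewrite divr_gt0.
have hr : h + h < r by rewrite /h; lra.
have H1 := clairaut_quotient h0 hr (fun y xy => (Hr y xy).1).
have H2 := clairaut_quotient h0 hr (fun y xy => (Hr y xy).2).
have E : f (x + h *: 'e_i + h *: 'e_j) - f (x + h *: 'e_i) - f (x + h *: 'e_j)
  + f x = f (x + h *: 'e_j + h *: 'e_i) - f (x + h *: 'e_j) - f (x + h *: 'e_i)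
  + f x by rewrite [x + _ + _]addrAC; congr (_ + _); rewrite [LHS]addrAC.
move: H1 H2; rewrite E; move: (_ + f x) => S.
move: ('D_'e_j _ x) ('D_'e_i _ x) => A B H1 H2.
have hh : 0 < h * h by rewrite mulr_gt0.
rewrite -(ler_pM2r hh) -[h * h in leLHS](ger0_norm (ltW hh)) -normrM.
have -> : (A - B) * (h * h) = (S - B * h * h) - (S - A * h * h) by ring.
have -> : e * (h * h) = e / 2 * h * h + e / 2 * h * h by field.
by rewrite (le_trans (ler_normB _ _)) // lerD.
Qed.

End CkTheory.

(** * Primitives and the contraction principle for curves *)

(** Curves are total functions of which only the restriction to [0, 1] matters.
Freezing them outside of this interval makes them determined by that
restriction, so that fixed points are equalities of functions. *)
Definition clamp (R : realType) (t : R) : R := Num.max 0 (Num.min 1 t).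

Section Primitive.
Context (R : realType).
Implicit Types (f g : R -> R) (t : R).

Lemma clamp_itv t : 0 <= clamp t <= 1.
Proof. by rewrite /clamp le_max lexx /= ge_max ler01 ge_min lexx. Qed.

Lemma clamp_id t : 0 <= t <= 1 -> clamp t = t.
Proof. by move=> /andP[t0 t1]; rewrite /clamp min_r // max_r. Qed.

Lemma clampK t : clamp (clamp t) = clamp t.
Proof. exact/clamp_id/clamp_itv. Qed.

Lemma clamp_continuous : continuous (@clamp R).
Proof.
move=> t; apply: continuous_max; first exact: cst_continuous.
by apply: continuous_min; [exact: cst_continuous|exact: cvg_id].
Qed.

Lemma primitive_exists f : continuous f ->
  exists F : R -> R, forall t, 0 <= t <= 1 -> is_derive t (1:R) F (f t).
Proof.
move=> cf.
(* The base point -1 and the bound 2 leave [0, 1] inside of an open interval. *)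
exists (fun x => (\int[lebesgue_measure]_(t in `[-1, x]) f t)%R) => t /andP[t0 t1].
have i2 : lebesgue_measure.-integrable `[-1, 2] (EFin \o f).
  apply: continuous_compact_integrable; first exact: segment_compact.
  exact: continuous_subspaceT.
have t2 : t < 2 by rewrite (le_lt_trans t1) // ltr1n.
have tm : -1 < t by rewrite (lt_le_trans _ t0) // ltrN10.
have [d e] := continuous_FTC1_closed t2 i2 tm (cf t).
by split; [exact: d|rewrite -derive1E; exact: e].
Qed.

(** Any choice will do, since [integ_unique] pins down the increments. *)
Definition primitive f : R -> R :=
  xget (fun=> 0) [set F | forall t, 0 <= t <= 1 -> is_derive t (1:R) F (f t)].

Lemma primitiveP f : continuous f ->
  forall t, 0 <= t <= 1 -> is_derive t (1:R) (primitive f) (f t).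
Proof.
move=> /primitive_exists[F HF]; rewrite /primitive.
by case: xgetP => [G _ HG|/(_ F)]; [exact: HG|case/(_ HF)].
Qed.

Definition integ f t : R := primitive f (clamp t) - primitive f 0.

Lemma integ_clamp f t : integ f (clamp t) = integ f t.
Proof. by rewrite /integ clampK. Qed.

Lemma derivable_cont (f : R -> R) (t d : R) :
  is_derive t (1:R) f d -> {for t, continuous f}.
Proof.
move=> [df _]; apply: differentiable_continuous.
exact/derivable1_diffP.
Qed.

Lemma integ_continuous f : continuous f -> continuous (integ f).
Proof.
move=> cf t; apply: cvgB; last exact: cvg_cst.
apply: (continuous_comp (@clamp_continuous t)).
exact: derivable_cont (primitiveP cf (clamp_itv t)).
Qed.

Lemma integ_le f M : continuous f ->
  (forall t, 0 <= t <= 1 -> `|f t| <= M) -> forall t, `|integ f t| <= M.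
Proof.
move=> cf fM t; have /andP[c0 c1] := clamp_itv t.
have H s : between 0 (clamp t) s -> derivable (primitive f) (0 + s *: 1) 1 /\
   `|'D_1 (primitive f) (0 + s *: 1) - 0| <= M.
  rewrite /between min_l // max_r // => /andP[s0 s1].
  have s01 : 0 <= s <= 1 by rewrite s0 (le_trans s1).
  rewrite add0r [s *: 1]mulr1 subr0.
  by have [d ->] := primitiveP cf s01; split => //; exact: fM.
have := mvt_line H; rewrite mul0r !subr0 !add0r [_ *: 1]mulr1 scale0r.
rewrite (ger0_norm c0) => /le_trans; apply.
by rewrite ler_piMr // (le_trans _ (fM 0 _)) // lexx ler01.
Qed.

(** The derivative is asked for on the open interval only, where a clamped curve
has the derivative of the original one. *)
Lemma integ_unique f F : continuous f -> continuous F ->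
  (forall t, 0 < t < 1 -> is_derive t (1:R) F (f t)) ->
  forall t, 0 <= t <= 1 -> integ f t = F t - F 0.
Proof.
move=> cf cF dF t /andP[t0 t1]; rewrite /integ clamp_id ?t0 //.
move: t0; rewrite le_eqVlt => /orP[/eqP <-|t0]; first by rewrite !subrr.
pose G := primitive f - F.
have dG s : s \in `]0, t[ -> is_derive s (1:R) G 0.
  rewrite in_itv /= => /andP[s0 st]; rewrite -(subrr (f s)).
  apply: is_deriveB; first by apply: primitiveP; rewrite // !ltW // (lt_le_trans st).
  by apply: dF; rewrite s0 (lt_le_trans st).
have cG : {within `[0, t], continuous G}.
  apply: continuous_in_subspaceT => s; rewrite inE /= in_itv /= => /andP[s0 st].
  apply: cvgB; last exact: cF.
  by apply: derivable_cont (primitiveP cf _); rewrite s0 (le_trans st).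
have [s _] := MVT_segment (ltW t0) dG cG.
by rewrite mul0r /G !fctE => /eqP; rewrite subr_eq0 => /eqP; lra.
Qed.

Lemma integ0 f : integ f 0 = 0.
Proof. by rewrite /integ clamp_id ?lexx ?ler01 // subrr. Qed.

Lemma integ_derive f t : continuous f -> 0 < t < 1 ->
  is_derive t (1:R) (integ f) (f t).
Proof.
move=> cf /andP[t0 t1].
have H : is_derive t (1:R) (primitive f - cst (primitive f 0)) (f t).
  rewrite -[f t]subr0; apply: is_deriveB.
  by apply: primitiveP; rewrite // !ltW.
apply: near_eq_is_derive H; near=> s.
rewrite /integ clamp_id //; apply/andP; split; apply/ltW.
  by near: s; exact: lt_nbhsr.
by near: s; exact: lt_nbhsl.
Unshelve. all: by end_near. Qed.

Lemma integD f g t : continuous f -> continuous g ->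
  integ (fun t => f t + g t) t = integ f t + integ g t.
Proof.
move=> cf cg; rewrite -[LHS]integ_clamp -(integ_clamp f) -(integ_clamp g).
have icf : continuous (integ f) := integ_continuous cf.
have icg : continuous (integ g) := integ_continuous cg.
have c1 : continuous (fun t => f t + g t).
  by move=> s; exact: (cvgD (cf s) (cg s)).
have c2 : continuous (fun t => integ f t + integ g t).
  by move=> s; exact: (cvgD (icf s) (icg s)).
have d (s : R) : 0 < s < 1 ->
    is_derive s (1:R) (fun t => integ f t + integ g t) (f s + g s).
  by move=> s01; apply: is_deriveD; exact: integ_derive.
rewrite (integ_unique c1 c2 d (clamp_itv t)) !integ0.
by rewrite !addr0 subr0.
Qed.

Lemma integZ c f t : continuous f ->
  integ (fun t => c * f t) t = c * integ f t.
Proof.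
move=> cf; rewrite -[LHS]integ_clamp -(integ_clamp f).
have icf : continuous (integ f) := integ_continuous cf.
have c1 : continuous (fun t => c * f t).
  by move=> s; exact: (cvgM (cvg_cst c) (cf s)).
have c2 : continuous (fun t => c * integ f t).
  by move=> s; exact: (cvgM (cvg_cst c) (icf s)).
have d (s : R) : 0 < s < 1 ->
    is_derive s (1:R) (fun t => c * integ f t) (c * f s).
  by move=> s01; apply: is_deriveZ; exact: integ_derive.
by rewrite (integ_unique c1 c2 d (clamp_itv t)) integ0 mulr0 subr0.
Qed.

Lemma integB f g t : continuous f -> continuous g ->
  integ (fun t => f t - g t) t = integ f t - integ g t.
Proof.
move=> cf cg; have c1 : continuous (fun t => -1 * g t).
  by move=> s; exact: (cvgM (cvg_cst (-1 : R)) (cg s)).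
rewrite -mulN1r -integZ // -integD //.
by under [in RHS]eq_fun do rewrite mulN1r.
Qed.

End Primitive.

Section Integv.
Context (R : realType) (n : nat).
Implicit Types (x y : R -> 'rV[R]_n).

Definition integv x t : 'rV[R]_n := \row_i integ (fun s => x s 0 i) t.

Lemma continuous_coord x i : continuous x -> continuous (fun t => x t 0 i).
Proof.
by move=> cx t; exact: (continuous_comp (cx t) (@coord_continuous _ _ _ 0 i _)).
Qed.

Lemma integv_continuous x : continuous x -> continuous (integv x).
Proof.
move=> cx; apply: continuous_rV => i; under eq_fun do rewrite mxE.
exact/integ_continuous/continuous_coord.
Qed.

Lemma integv_clamp x t : integv x (clamp t) = integv x t.
Proof. by apply/rowP => i; rewrite !mxE integ_clamp. Qed.

Lemma integv_le x M : continuous x ->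
  (forall t, 0 <= t <= 1 -> `|x t| <= M) -> forall t, `|integv x t| <= M.
Proof.
move=> cx H t; apply: norm_le_coord.
  by apply: le_trans (H 0 _); rewrite ?lexx ?ler01.
move=> i j; rewrite mxE; apply: integ_le; first exact: continuous_coord.
by move=> s s01; apply: le_trans (H s s01); exact: coord_le_norm.
Qed.

Lemma integvB x y t : continuous x -> continuous y ->
  integv (fun t => x t - y t) t = integv x t - integv y t.
Proof.
move=> cx cy; apply/rowP => i; rewrite !mxE -integB; try exact: continuous_coord.
by congr (integ _ t); apply: funext => s; rewrite !mxE.
Qed.

(** The bound of the hypothesis is applied to M = the maximum of the norm of r,
which exists since r is continuous on a compact interval. *)
Lemma contraction_bound (r : R -> 'rV[R]_n) e :
  continuous r ->
  (forall M, 0 <= M -> (forall t, 0 <= t <= 1 -> `|r t| <= M) ->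
     forall t, 0 <= t <= 1 -> `|r t| <= e + M / 2) ->
  forall t, 0 <= t <= 1 -> `|r t| <= 2 * e.
Proof.
move=> cr H.
have car : {within `[(0:R), 1], continuous (fun t => `|r t|)}.
  by apply: continuous_subspaceT => t; apply: cvg_norm; exact: cr.
have [c + Hc] := EVT_max (ler01 : (0:R) <= 1) car.
rewrite in_itv /= => c01 t t01.
have {}Hc s : 0 <= s <= 1 -> `|r s| <= `|r c| by move=> ?; apply: Hc; rewrite in_itv.
have := H _ (normr_ge0 (r c)) Hc c c01; have := Hc t t01; lra.
Qed.

(** The contraction principle for continuous curves in a closed set, with ratio
1/2.  The iterates are Cauchy uniformly on [0, 1], and the limit is continuous
as a uniform limit.  The map has to produce curves invariant under [clamp], so
that uniform convergence on [0, 1] is uniform convergence on the line. *)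
Lemma picard_fixed_point (K : set 'rV[R]_n) (T : (R -> 'rV[R]_n) -> R -> 'rV[R]_n)
    (x0 : R -> 'rV[R]_n) :
  closed K ->
  (forall x, continuous x -> (forall t, K (x t)) ->
     [/\ continuous (T x), forall t, K (T x t) &
         forall t, T x (clamp t) = T x t]) ->
  (forall x y (M : R), continuous x -> (forall t, K (x t)) ->
     continuous y -> (forall t, K (y t)) -> 0 <= M ->
     (forall t, 0 <= t <= 1 -> `|x t - y t| <= M) ->
     forall t, 0 <= t <= 1 -> `|T x t - T y t| <= M / 2) ->
  continuous x0 -> (forall t, K (x0 t)) ->
  exists x, [/\ continuous x, forall t, K (x t) & forall t, x t = T x t].
Proof.
move=> cK HT HC cx0 Kx0.
(* Starting from T x0 rather than x0 makes all of the iterates invariant under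
   clamp. *)
pose y k := iter k T (T x0).
have yP k : [/\ continuous (y k), forall t, K (y k t) &
                forall t, y k (clamp t) = y k t].
  by elim: k => [|k [c1 c2 c3]]; apply: HT.
have cyd i j : continuous (fun t => y i t - y j t).
  have [ci _ _] := yP i; have [cj _ _] := yP j.
  by move=> t; exact: (cvgB (ci t) (cj t)).
have [M M0 HM] : exists2 M, 0 < M & forall t, 0 <= t <= 1 -> `|y 1%N t - y 0%N t| <= M.
  have cn : continuous (fun t => `|y 1%N t - y 0%N t|).
    by move=> t; apply: cvg_norm; exact: cyd.
  have [M M0 H] := itv01_bounded cn; exists M => // t t01.
  by have := H t t01; rewrite normr_id.
have step k t : 0 <= t <= 1 -> `|y k.+1 t - y k t| <= M / 2 ^+ k.
  elim: k t => [|k IH] t t01; first by rewrite expr0 divr1; exact: HM.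
  have [c1 k1 _] := yP k.+1; have [c2 k2 _] := yP k.
  have Mk : 0 <= M / 2 ^+ k by rewrite divr_ge0 // ?exprn_ge0 // ltW.
  have := HC _ _ _ c1 k1 c2 k2 Mk IH t t01.
  by rewrite exprSr invfM mulrA.
have dist k j t : `|y (k + j)%N t - y k t| <= 2 * M / 2 ^+ k.
  have [_ _ <-] := yP (k + j)%N; have [_ _ <-] := yP k.
  have t01 := clamp_itv t; move: (clamp t) t01 => s s01.
  (* The partial sums of the geometric series are what the induction carries. *)
  suff : `|y (k + j)%N s - y k s| <= 2 * M / 2 ^+ k * (1 - 1 / 2 ^+ j).
    move=> /le_trans; apply; rewrite ler_piMr //.
      by rewrite divr_ge0 ?exprn_ge0 // mulr_ge0 // ltW.
    by rewrite gerBl divr_ge0 // exprn_ge0.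
  elim: j => [|j IH]; first by rewrite addn0 subrr normr0 expr0 divr1 subrr mulr0.
  rewrite addnS -(subrKA (y (k + j)%N s)).
  rewrite (le_trans (ler_normD _ _)) //.
  apply: le_trans (lerD (step _ _ s01) IH) _.
  rewrite exprD exprS; have := expf_neq0 k (lt0r_neq0 (ltr0n R 2)).
  have := expf_neq0 j (lt0r_neq0 (ltr0n R 2)).
  by move=> j0 k0; rewrite le_eqVlt; apply/orP; left; apply/eqP; field; rewrite j0 k0.
have small e : 0 < e -> exists k, 2 * M / 2 ^+ k < e.
  move=> e0.
  have h1 : `|2^-1 : R| < 1 by rewrite ger0_norm ?invr_ge0 // invf_lt1 // ltr1n.
  have /cvgrPdist_lt/(_ _ e0) := cvg_geometric (2 * M) h1.
  move=> /filter_ex[k]; rewrite sub0r normrN /geometric /= exprVn => Hk.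
  by exists k; apply: le_lt_trans Hk; exact: ler_norm.
pose x t : 'rV[R]_n := \row_i limn (fun k => y k t 0 i).
have cvx t : (fun k => y k t) @ \oo --> x t.
  apply: cvg_rV => i; rewrite mxE.
  apply/cauchy_cvgP/cauchy_exP => e e0; have [k Hk] := small e e0.
  exists (y k t 0 i).
  suff : \forall m \near \oo, ball (y k t 0 i) e (y m t 0 i) by [].
  near=> m.
  rewrite -ball_normE /= distrC; apply: le_lt_trans Hk.
  have km : (k <= m)%N by near: m; exact: nbhs_infty_ge.
  apply: le_trans (dist k (m - k)%N t); rewrite subnKC //.
  by have := coord_le_norm (y m t - y k t) 0 i; rewrite !mxE.
have xd k t : `|x t - y k t| <= 2 * M / 2 ^+ k.
  apply/ler_addgt0Pl => e e0.
  have /cvgrPdist_lt/(_ _ e0) N1 := cvx t.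
  have /filter_ex[m [H1 km]] :
      \forall m \near \oo, `|x t - y m t| < e /\ (k <= m)%N.
    by apply: filterI N1 _; exact: nbhs_infty_ge.
  rewrite -(subrKA (y m t)) (le_trans (ler_normD _ _)) //.
  apply: lerD; first exact: ltW.
  by have := dist k (m - k)%N t; rewrite subnKC.
have Kx t : K (x t).
  apply: (closed_cvg K) (cvx t) => //; apply: nearW => k.
  by have [_ ? _] := yP k.
have cx : continuous x.
  move=> t; apply/cvgrPdist_le => e e0.
  have e30 : 0 < e / 3 by rewrite divr_gt0.
  have [k Hk] := small _ e30.
  have [ck _ _] := yP k.
  have /cvgrPdist_le/(_ _ e30) := ck t; apply: filterS => s Hs.
  have -> : x t - x s = (x t - y k t) + (y k t - y k s) - (x s - y k s).
    by rewrite subrKA opprB addrA addrNK.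
  rewrite (le_trans (ler_normB _ _)) //.
  have -> : e = e / 3 + e / 3 + e / 3 by field.
  apply: lerD; last exact: le_trans (xd k s) (ltW Hk).
  rewrite (le_trans (ler_normD _ _)) //.
  by apply: lerD => //; exact: le_trans (xd k t) (ltW Hk).
have xc t : x (clamp t) = x t.
  apply/rowP => i; rewrite !mxE; congr (lim (_ @ \oo)).
  by apply: funext => k; have [_ _ ->] := yP k.
exists x; split => // t.
have [_ _ Tc] := HT x cx Kx; rewrite -xc -Tc.
have t01 := clamp_itv t; move: (clamp t) t01 => s s01.
apply/eqP; rewrite -subr_eq0 -normr_le0; apply/ler_addgt0Pr => e e0; rewrite add0r.
have e20 : 0 < e / 2 by rewrite divr_gt0.
have [k Hk] := small _ e20.
have [c1 k1 _] := yP k.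
have m0 : 0 <= 2 * M / 2 ^+ k by apply: le_trans (xd k s).
have H1 := HC _ _ _ cx Kx c1 k1 m0 (fun t _ => xd k t) s s01.
rewrite -(subrKA (y k.+1 s)) (splitr e) (le_trans (ler_normD _ _)) //.
apply: lerD.
  apply: le_trans (xd k.+1 s) (le_trans _ (ltW Hk)).
  rewrite exprS invfM mulrCA ler_piMl // invf_le1 // ler1n //.
rewrite distrC; apply: le_trans H1 (le_trans _ (ltW Hk)).
by rewrite ler_pdivrMr // ler_peMr // ler1n.
Unshelve. all: by end_near. Qed.
End Integv.

Lemma unif_cvg_integ (R : realType) (T : Type) (F : set_system T)
    (u : T -> R -> R) v :
  Filter F -> (\forall s \near F, continuous (u s)) -> continuous v ->
  unif_cvg F u v -> unif_cvg F (fun s => integ (u s)) (integ v).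
Proof.
move=> FF cu cv uv e e0; apply: filterS2 cu (uv e e0) => s cus H t _.
rewrite -integB //; apply: integ_le => //.
by move=> r; exact: (cvgB (cus r) (cv r)).
Qed.

(** Integration over [0, t] with t <= 1 does not increase the uniform norm, so it
commutes with the uniform limits of difference quotients. *)
Lemma Ck_curve_integ (R : realType) (m k : nat) (Z : set 'rV[R]_m) u :
  open Z -> Ck_curve k Z u -> Ck_curve k Z (fun z => integ (u z)).
Proof.
move=> oZ; have nZ z : Z z -> \forall y \near z, Z y.
  by move=> Zz; exact: open_nbhs_nbhs.
have base w j : Ck_curve j Z w ->
   (forall z, Z z -> continuous (integ (w z))) /\
   (forall z, Z z -> unif_cvg (nbhs z) (fun z => integ (w z)) (integ (w z))).
  move=> Cw; have cw z (Zz : Z z) : continuous (w z) := Ck_curve_cont Cw Zz.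
  split=> z Zz; first exact: integ_continuous (cw z Zz).
  apply: unif_cvg_integ; [|exact: cw|exact: Ck_curve_unif Cw Zz].
  by apply: filterS (nZ z Zz) => y; exact: cw.
elim: k u => [|k IH] u Cu; have [? ?] := base u _ Cu; split=> // i.
have [_ _ /(_ i)[v Cv Hv]] := Cu; exists (fun z => integ (v z)); first exact: IH.
move=> z Zz.
have cu y (Zy : Z y) : continuous (u y) := Ck_curve_cont Cu Zy.
have cv : continuous (v z) := Ck_curve_cont Cv Zz.
have N : \forall h \near (0:R)^', Z (h *: 'e_i + z).
  exact: (@cvg_line R _ z 'e_i _ (nZ z Zz)).
have cd h : Z (h *: 'e_i + z) -> continuous (fun t => u (h *: 'e_i + z) t - u z t).
  by move=> Zh t; exact: (cvgB (cu _ Zh t) (cu _ Zz t)).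
have FF : Filter (0:R)^' by exact: dnbhs_filter.
suff : unif_cvg 0^'
   (fun h : R => integ (fun t => h^-1 * (u (h *: 'e_i + z) t - u z t))) (integ (v z)).
  apply: unif_cvg_ext => //; apply: filterS N => h Zh t _.
  by rewrite integZ ?integB //; [exact: cu|exact: cu|exact: cd].
apply: unif_cvg_integ => //; last exact: Hv.
apply: filterS N => h Zh t; exact: (cvgM (cvg_cst h^-1) (cd h Zh t)).
Qed.

(** * Linear integral equations *)

Section Linear.
Context (R : realType) (n : nat).

Lemma continuous_mulmx (x : R -> 'rV[R]_n) (a : R -> 'M[R]_n) :
  continuous x -> (forall i j, continuous (fun t => a t i j)) ->
  continuous (fun t => x t *m a t).
Proof.
move=> cx ca; apply: continuous_rV => i; under eq_fun do rewrite mxE.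
move=> t; apply: (@cvg_sum_ord R _ (nbhs t)) => j.
have cxj : continuous (fun t => x t 0 j) := continuous_coord (i := j) cx.
exact: (cvgM (cxj t) (ca j i t)).
Qed.

Lemma integvZ (c : R) (x : R -> 'rV[R]_n) t : continuous x ->
  integv (fun t => c *: x t) t = c *: integv x t.
Proof.
move=> cx; apply/rowP => i; rewrite !mxE -integZ; last exact: continuous_coord.
by congr (integ _ t); apply: funext => s; rewrite !mxE.
Qed.

Lemma integvD (x y : R -> 'rV[R]_n) t : continuous x -> continuous y ->
  integv (fun t => x t + y t) t = integv x t + integv y t.
Proof.
move=> cx cy; apply/rowP => i; rewrite !mxE -integD; try exact: continuous_coord.
by congr (integ _ t); apply: funext => s; rewrite !mxE.
Qed.

Definition contracting (a : R -> 'M[R]_n) : Prop :=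
  forall t, 0 <= t <= 1 -> forall x : 'rV[R]_n, `|x *m a t| <= `|x| / 2.

(** Stability of the equation r = e + int (g + r a).  Since a contracts by 1/2,
the solution is at most twice as large as the data e and g, which tend to 0.
It is applied to the equations that differences of solutions, and errors of
difference quotients, satisfy. *)
Lemma linear_perturbation (T : Type) (F : set_system T)
    (r e g : T -> R -> 'rV[R]_n) (a : T -> R -> 'M[R]_n) :
  Filter F ->
  (\forall s \near F, [/\ continuous (r s), continuous (g s),
     forall i j, continuous (fun t => a s t i j), contracting (a s) &
     forall t, 0 <= t <= 1 ->
       r s t = e s t + integv (fun t => g s t + r s t *m a s t) t]) ->
  (forall i, unif_cvg F (fun s t => e s t 0 i) (fun=> 0)) ->
  (forall i, unif_cvg F (fun s t => g s t 0 i) (fun=> 0)) ->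
  forall i, unif_cvg F (fun s t => r s t 0 i) (fun=> 0).
Proof.
move=> FF H He Hg i d d0.
have d40 : 0 < d / 4 by rewrite divr_gt0.
have small (y : T -> R -> 'rV[R]_n) :
    (forall i, unif_cvg F (fun s t => y s t 0 i) (fun=> 0)) ->
    \forall s \near F, forall t, 0 <= t <= 1 -> `|y s t| <= d / 4.
  move=> Hy; have Hi j : \forall s \near F, forall t, 0 <= t <= 1 ->
      `|y s t 0 j - 0| <= d / 4 by exact: Hy.
  have := filter_forall FF Hi; apply: filterS => s Hs t t01.
  apply: norm_le_coord => [|i0 j]; first exact: ltW.
  by rewrite ord1; have := Hs j t t01; rewrite subr0.
have H1 := small e He; have H2 := small g Hg.
near=> s => t t01; rewrite subr0.
have [cr cg ca Ca E] : [/\ continuous (r s), continuous (g s),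
     forall i j, continuous (fun t => a s t i j), contracting (a s) &
     forall t, 0 <= t <= 1 ->
       r s t = e s t + integv (fun t => g s t + r s t *m a s t) t].
  by near: s; exact: H.
have es : forall x, 0 <= x <= 1 -> `|e s x| <= d / 4 by near: s.
have gs : forall x, 0 <= x <= 1 -> `|g s x| <= d / 4 by near: s.
apply: le_trans (coord_le_norm _ _ _) _.
have -> : d = 2 * (d / 2) by field.
move: t t01; apply: contraction_bound => // M M0 HM t t01.
have cgr : continuous (fun t => g s t + r s t *m a s t).
  have crm := continuous_mulmx cr ca.
  by move=> x; exact: (cvgD (cg x) (crm x)).
rewrite E // (le_trans (ler_normD _ _)) //.
have -> : d / 2 + M / 2 = d / 4 + (d / 4 + M / 2) by field.
apply: lerD; first exact: es.
apply: integv_le => // x x01; rewrite (le_trans (ler_normD _ _)) //.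
apply: lerD; first exact: gs.
by rewrite (le_trans (Ca x x01 _)) // ler_wpM2r // ?HM // invr_ge0.
Unshelve. all: by end_near. Qed.

Lemma linear_solution (b : R -> 'rV[R]_n) (a : R -> 'M[R]_n) :
  continuous b -> (forall i j, continuous (fun t => a t i j)) -> contracting a ->
  exists2 x : R -> 'rV[R]_n, continuous x & forall t, 0 <= t <= 1 ->
    x t = b t + integv (fun t => x t *m a t) t.
Proof.
move=> cb ca Ca.
pose T (x : R -> 'rV[R]_n) t : 'rV[R]_n :=
  b (clamp t) + integv (fun t => x t *m a t) (clamp t).
have cc : continuous (@clamp R) := @clamp_continuous R.
have cT (x : R -> 'rV[R]_n) : continuous x -> continuous (T x).
  move=> cx t; have cxa := continuous_mulmx cx ca.
  have ci := integv_continuous cxa.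
  exact: (cvgD (continuous_comp (cc t) (cb _)) (continuous_comp (cc t) (ci _))).
have HT (x : R -> 'rV[R]_n) : continuous x -> (forall t, setT (x t)) ->
    [/\ continuous (T x), forall t, setT (T x t) & forall t, T x (clamp t) = T x t].
  by move=> cx _; split=> // [|t]; [exact: cT|rewrite /T clampK].
have HC (x y : R -> 'rV[R]_n) (M : R) : continuous x -> (forall t, setT (x t)) ->
     continuous y -> (forall t, setT (y t)) -> 0 <= M ->
     (forall t, 0 <= t <= 1 -> `|x t - y t| <= M) ->
     forall t, 0 <= t <= 1 -> `|T x t - T y t| <= M / 2.
  move=> cx _ cy _ M0 H t t01; rewrite /T clamp_id //.
  have cxa := continuous_mulmx cx ca; have cya := continuous_mulmx cy ca.
  rewrite opprD addrACA subrr add0r -(integvB t cxa cya).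
  apply: integv_le => [s|s s01]; first exact: (cvgB (cxa s) (cya s)).
  by rewrite -mulmxBl (le_trans (Ca s s01 _)) // ler_wpM2r ?invr_ge0 // H.
have [|x [cx _ Ex]] := picard_fixed_point closedT HT HC (x0 := fun=> 0) _ (fun=> I).
  by move=> t; exact: cvg_cst.
by exists x => // t t01; rewrite {1}Ex /T clamp_id.
Qed.

End Linear.

Lemma unif_cvg_sub0 (R : realType) (T : Type) (F : set_system T)
    (u : T -> R -> R) v :
  unif_cvg F u v -> unif_cvg F (fun s t => u s t - v t) (fun=> 0).
Proof.
by move=> + e e0 => /(_ e e0) H; under eq_near do under eq_forall do rewrite subr0.
Qed.

Lemma unif_cvg_mulmx0 (R : realType) (n : nat) (T : Type) (F : set_system T)
    (x : R -> 'rV[R]_n) (d : T -> R -> 'M[R]_n) :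
  Filter F -> continuous x ->
  (forall i j, unif_cvg F (fun s t => d s t i j) (fun=> 0)) ->
  forall i, unif_cvg F (fun s t => (x t *m d s t) 0 i) (fun=> 0).
Proof.
move=> FF cx Hd i.
have H : unif_cvg F (fun s t => \sum_j x t 0 j * d s t j i)
                    (fun t => \sum_j x t 0 j * 0).
  apply: (unif_cvg_sum (FF := FF)) => j.
  apply: (unif_cvgM (FF := FF)) (unif_cvg_cst (FF := FF) _) (Hd j i).
    exact: continuous_coord.
  exact: cst_continuous.
apply: (unif_cvg_ext (FF := FF)) H => [|t _].
  by apply: nearW => s t _; rewrite mxE.
by rewrite big1 // => j _; rewrite mulr0.
Qed.

Section CkCurveLinear.
Context (R : realType) (m n : nat) (Z : set 'rV[R]_m).
Hypothesis oZ : open Z.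

Let nZ z : Z z -> \forall y \near z, Z y.
Proof. by move=> Zz; exact: open_nbhs_nbhs. Qed.

Let nZl z (w : 'rV[R]_m) : Z z -> \forall h \near (0:R)^', Z (h *: w + z).
Proof. by move=> Zz; exact: (@cvg_line R _ z w _ (nZ Zz)). Qed.

Variable a : 'rV[R]_m -> R -> 'M[R]_n.
Hypothesis Ca : forall z, Z z -> contracting (a z).

Definition linear_system (b q : 'rV[R]_m -> R -> 'rV[R]_n) : Prop :=
  (forall z, Z z -> continuous (q z)) /\
  (forall z, Z z -> forall t, 0 <= t <= 1 ->
     q z t = b z t + integv (fun t => q z t *m a z t) t).

Lemma linear_system_unif k (b q : 'rV[R]_m -> R -> 'rV[R]_n) z i :
  (forall i j, Ck_curve k Z (fun z t => a z t i j)) ->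
  (forall i, Ck_curve k Z (fun z t => b z t 0 i)) -> linear_system b q -> Z z ->
  unif_cvg (nbhs z) (fun z t => q z t 0 i) (fun t => q z t 0 i).
Proof.
move=> Ka Kb [cq Eq] Zz.
have ca y : Z y -> forall i j, continuous (fun t => a y t i j).
  by move=> Zy k1 k2; exact: Ck_curve_cont (Ka k1 k2) Zy.
have H : unif_cvg (nbhs z) (fun s t => (q s t - q z t) 0 i) (fun=> 0).
  move: i; apply: (@linear_perturbation R n _ (nbhs z) _ (fun s t => b s t - b z t)
    (fun s t => q z t *m (a s t - a z t)) a).
  - apply: filterS (nZ Zz) => s Zs; split.
    + by move=> t; exact: (cvgB (cq s Zs t) (cq z Zz t)).
    + apply: continuous_mulmx; first exact: cq.
      move=> i j t; under eq_fun do rewrite !mxE.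
      exact: (cvgB (ca s Zs i j t) (ca z Zz i j t)).
    + exact: ca.
    + exact: Ca.
    + move=> t t01; rewrite !Eq // opprD addrACA; congr (_ + _).
      have c1 := continuous_mulmx (cq s Zs) (ca s Zs).
      have c2 := continuous_mulmx (cq z Zz) (ca z Zz).
      rewrite -(integvB t c1 c2); congr (integv _ t); apply: funext => x.
      by rewrite mulmxBr mulmxBl [RHS]addrC subrKA.
  - move=> i; have := unif_cvg_sub0 (Ck_curve_unif (Kb i) Zz).
    by apply: unif_cvg_ext => //; apply: nearW => s t _; rewrite !mxE.
  - apply: unif_cvg_mulmx0; first exact: cq.
    move=> i j; have := unif_cvg_sub0 (Ck_curve_unif (Ka i j) Zz).
    by apply: unif_cvg_ext => //; apply: nearW => s t _; rewrite !mxE.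
move=> e e0; have := H e e0; apply: filterS => s Hs t t01.
by have := Hs t t01; rewrite !mxE subr0.
Qed.

(** Differentiating q = b + int q a in the i-th parameter gives the equation
w = b' + int q a' + int w a with the same matrix a.  The error between the
difference quotient of q and w satisfies a linear equation, with the matrix a
at the displaced parameter and with data that tend to 0. *)
Lemma linear_system_deriv k (b q : 'rV[R]_m -> R -> 'rV[R]_n) i (a' : 'rV[R]_m -> R -> 'M[R]_n)
    (b' w : 'rV[R]_m -> R -> 'rV[R]_n) :
  (forall i j, Ck_curve k Z (fun z t => a z t i j)) ->
  (forall i j, Ck_curve 0 Z (fun z t => a' z t i j)) ->
  (forall z k l, Z z -> unif_cvg 0^' (fun (h : R) t =>
     h^-1 * (a (h *: 'e_i + z) t k l - a z t k l)) (fun t => a' z t k l)) ->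
  (forall z l, Z z -> unif_cvg 0^' (fun (h : R) t =>
     h^-1 * (b (h *: 'e_i + z) t 0 l - b z t 0 l)) (fun t => b' z t 0 l)) ->
  linear_system b q ->
  linear_system
    (fun z t => b' z t + integv (fun t => q z t *m a' z t) t) w ->
  forall z l, Z z -> unif_cvg 0^' (fun (h : R) t =>
     h^-1 * (q (h *: 'e_i + z) t 0 l - q z t 0 l)) (fun t => w z t 0 l).
Proof.
move=> Ka Ka' Da Db [cq Eq] [cw Ew] z l Zz.
have FF : Filter (0:R)^' by exact: dnbhs_filter.
have ca y : Z y -> forall i j, continuous (fun t => a y t i j).
  by move=> Zy k1 k2; exact: Ck_curve_cont (Ka k1 k2) Zy.
have ca' i1 j1 : continuous (fun t => a' z t i1 j1).
  exact: Ck_curve_cont (Ka' i1 j1) Zz.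
pose p h : 'rV[R]_m := h *: 'e_i + z.
have H : unif_cvg 0^' (fun (h : R) t =>
    (h^-1 *: (q (p h) t - q z t) - w z t) 0 l) (fun=> 0).
  move: l; apply: (@linear_perturbation R n _ (0:R)^' _
    (fun h t => h^-1 *: (b (p h) t - b z t) - b' z t)
    (fun h t => q z t *m (h^-1 *: (a (p h) t - a z t) - a' z t) +
                w z t *m (a (p h) t - a z t)) (fun h => a (p h))).
  - apply: filterS (nZl 'e_i Zz) => h Zs; rewrite -/(p h) in Zs.
    have cqh := cq _ Zs; have cqz := cq _ Zz; have cwz := cw _ Zz.
    have cah := ca _ Zs; have caz := ca _ Zz.
    have cm1 := continuous_mulmx cqh cah; have cm2 := continuous_mulmx cqz caz.
    have cm3 := continuous_mulmx cqz ca'; have cm4 := continuous_mulmx cwz caz.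
    have cd1 : continuous (fun t => h^-1 *: (q (p h) t *m a (p h) t - q z t *m a z t)).
      by move=> t; exact: (cvgZl_tmp (cvgB (cm1 t) (cm2 t))).
    have cd0 : continuous (fun t => q (p h) t *m a (p h) t - q z t *m a z t).
      by move=> t; exact: (cvgB (cm1 t) (cm2 t)).
    have cd2 : continuous (fun t => h^-1 *: (q (p h) t *m a (p h) t - q z t *m a z t)
        - q z t *m a' z t).
      by move=> t; exact: (cvgB (cd1 t) (cm3 t)).
    split.
    + by move=> t; exact: (cvgB (cvgZl_tmp (cvgB (cqh t) (cqz t))) (cwz t)).
    + have C1 : continuous (fun t => q z t *m (h^-1 *: (a (p h) t - a z t) - a' z t)).
        apply: continuous_mulmx => // i1 j1 t; under eq_fun do rewrite !mxE.
        exact: (cvgB (cvgM (cvg_cst h^-1) (cvgB (cah i1 j1 t) (caz i1 j1 t)))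
                 (ca' i1 j1 t)).
      have C2 : continuous (fun t => w z t *m (a (p h) t - a z t)).
        apply: continuous_mulmx => // i1 j1 t; under eq_fun do rewrite !mxE.
        exact: (cvgB (cah i1 j1 t) (caz i1 j1 t)).
      by move=> t; exact: (cvgD (C1 t) (C2 t)).
    + exact: cah.
    + exact: Ca.
    + move=> t t01; rewrite !Eq // Ew //.
      transitivity (h^-1 *: (b (p h) t - b z t) - b' z t +
        (h^-1 *: (integv (fun t => q (p h) t *m a (p h) t) t -
                  integv (fun t => q z t *m a z t) t) -
         integv (fun t => q z t *m a' z t) t - integv (fun t => w z t *m a z t) t)).
        move: (integv _ t) (integv _ t) (integv _ t) (integv _ t).
        move: (b (p h) t) (b z t) (b' z t) => v1 v2 v3 v4 v5 v6 v7.
        by apply/rowP => j; rewrite !mxE; ring.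
      congr (_ + _); rewrite -(integvB t cm1 cm2) -(integvZ h^-1 t cd0).
      rewrite -(integvB t cd1 cm3) -(integvB t cd2 cm4).
      congr (integv _ t); apply: funext => x.
      rewrite !(mulmxBr, mulmxBl) -!(scalemxAl, scalemxAr) !(mulmxBr, mulmxBl).
      move: (q (p h) x *m a (p h) x) (q z x *m a z x) (q z x *m a' z x)
        (w z x *m a z x) (q z x *m a (p h) x) (w z x *m a (p h) x).
      by move=> v1 v2 v3 v4 v5 v6; apply/rowP => j; rewrite !mxE; ring.
  - move=> l; have := unif_cvg_sub0 (Db z l Zz).
    by apply: unif_cvg_ext => //; apply: nearW => s t _; rewrite !mxE.
  - move=> l.
    have H1 : unif_cvg 0^' (fun (h : R) t =>
       (q z t *m (h^-1 *: (a (p h) t - a z t) - a' z t)) 0 l) (fun=> 0).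
      apply: (@unif_cvg_mulmx0 _ _ _ _ (q z) 
        (fun h t => h^-1 *: (a (p h) t - a z t) - a' z t)); first exact: cq.
      move=> i1 j1; have := unif_cvg_sub0 (Da z i1 j1 Zz).
      by apply: unif_cvg_ext => //; apply: nearW => s t _; rewrite !mxE.
    have H2 : unif_cvg 0^' (fun (h : R) t =>
       (w z t *m (a (p h) t - a z t)) 0 l) (fun=> 0).
      apply: (@unif_cvg_mulmx0 _ _ _ _ (w z) (fun h t => a (p h) t - a z t)); first exact: cw.
      move=> i1 j1; have := unif_cvg_sub0 (Ck_curve_unif_line 'e_i (Ka i1 j1) Zz).
      by apply: unif_cvg_ext => //; apply: nearW => s t _; rewrite !mxE.
    have := unif_cvgD (FF := FF) H1 H2; apply: unif_cvg_ext => [|t _].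
      by apply: nearW => s t _; rewrite [RHS]mxE.
    by rewrite addr0.
move=> e e0; have := H e e0; apply: filterS => s Hs t t01.
by have := Hs t t01; rewrite !mxE subr0.
Qed.

(** The derivative of the solution in a parameter solves a system with the same
matrix and with data built from q and the derivatives of a and b; these are
of class C^k when q is, so that the order grows by one at each step of the
induction. *)
Lemma Ck_curve_linear k (b q : 'rV[R]_m -> R -> 'rV[R]_n) :
  (forall i j, Ck_curve k Z (fun z t => a z t i j)) ->
  (forall i, Ck_curve k Z (fun z t => b z t 0 i)) ->
  linear_system b q -> forall i, Ck_curve k Z (fun z t => q z t 0 i).
Proof.
elim: k b q => [|k IH] b q Ka Kb Sq l; have [cq Eq] := Sq.
  split=> // z Zz; first by apply: continuous_coord; exact: cq.
  exact: linear_system_unif Ka Kb Sq Zz.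
split=> [z Zz|z Zz|i]; first by apply: continuous_coord; exact: cq.
  exact: linear_system_unif Ka Kb Sq Zz.
have Ka0 i1 j1 := Ck_curve_pred (Ka i1 j1); have Kb0 i1 := Ck_curve_pred (Kb i1).
have Kq := IH b q Ka0 Kb0 Sq.
have Ha (ij : 'I_n * 'I_n) : exists v, Ck_curve k Z v /\ forall z, Z z ->
    unif_cvg 0^' (fun (h : R) t =>
      h^-1 * (a (h *: 'e_i + z) t ij.1 ij.2 - a z t ij.1 ij.2)) (v z).
  by have [_ _ /(_ i)[v ? ?]] := Ka ij.1 ij.2; exists v.
have [a1 Ha1] := choice Ha.
have Hb j : exists v, Ck_curve k Z v /\ forall z, Z z ->
    unif_cvg 0^' (fun (h : R) t =>
      h^-1 * (b (h *: 'e_i + z) t 0 j - b z t 0 j)) (v z).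
  by have [_ _ /(_ i)[v ? ?]] := Kb j; exists v.
have [b1 Hb1] := choice Hb.
pose a' z t : 'M[R]_n := \matrix_(i1, j1) a1 (i1, j1) z t.
pose b' z t : 'rV[R]_n := \row_j b1 j z t.
have a'E i1 j1 : (fun z t => a' z t i1 j1) = a1 (i1, j1).
  by apply: funext => z; apply: funext => t; rewrite mxE.
have b'E j1 : (fun z t => b' z t 0 j1) = b1 j1.
  by apply: funext => z; apply: funext => t; rewrite mxE.
have Ka' i1 j1 : Ck_curve k Z (fun z t => a' z t i1 j1) by rewrite a'E; exact: (Ha1 _).1.
(* The data of the differentiated system. *)
pose c z t := b' z t + integv (fun t => q z t *m a' z t) t.
have Kc j : Ck_curve k Z (fun z t => c z t 0 j).
  have : Ck_curve k Z (fun z t => b' z t 0 j +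
      integ (fun t => \sum_i1 q z t 0 i1 * a' z t i1 j) t).
    apply: Ck_curveD; first by rewrite b'E; exact: (Hb1 _).1.
    apply: Ck_curve_integ => //; apply: Ck_curve_sum => i1; exact: Ck_curveM.
  apply: Ck_curve_ext => // z Zz t; rewrite [in RHS]mxE; congr (_ + _).
  rewrite mxE; congr (integ _ t); apply: funext => s; by rewrite mxE.
have cc z : Z z -> continuous (c z).
  by move=> Zz; apply: continuous_rV => j; exact: Ck_curve_cont (Kc j) Zz.
have Hw z : exists w : R -> 'rV[R]_n, Z z -> continuous w /\
    forall t, 0 <= t <= 1 -> w t = c z t + integv (fun t => w t *m a z t) t.
  have [Zz|nZz] := pselect (Z z); last by exists (fun=> 0).
  have caz i1 j1 : continuous (fun t => a z t i1 j1) by exact: Ck_curve_cont (Ka i1 j1) Zz.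
  have [w cw Ew] := linear_solution (cc z Zz) caz (Ca Zz).
  by exists w.
have [w Pw] := choice Hw.
have Sw : linear_system c w by split=> z Zz; have [] := Pw z Zz.
exists (fun z t => w z t 0 l); first exact: IH Sw l.
move=> z Zz; apply: (@linear_system_deriv k.+1 b q i a' b') => //.
- by move=> i1 j1; elim: (k) (Ka' i1 j1) => // j IHj /Ck_curve_pred.
- by move=> y i1 j1 Zy; have := (Ha1 (i1, j1)).2 y Zy; rewrite -a'E.
- by move=> y j1 Zy; have := (Hb1 j1).2 y Zy; rewrite -b'E.
Qed.

End CkCurveLinear.

(** * The flow of a vector field *)

Lemma between_dist_le (R : realType) (a b s c r : R) :
  between a b s -> `|c - a| <= r -> `|c - b| <= r -> `|c - s| <= r.
Proof.
rewrite /between ge_min le_max => /andP[/orP[]l /orP[]u];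
rewrite !ler_norml => /andP[? ?] /andP[? ?]; apply/andP; split; lra.
Qed.

(** The field V is bounded by M, with all of its partial derivatives, on the
closed ball B of radius r, hence has there the Lipschitz constant L = (n+1) M.
The parameters z in N are so small that the trajectories cannot leave B, half
of r being granted to the initial displacement z P and half to the motion, and
that the integral equation contracts by 1/2.  The row i0 of P vanishes: the
coordinate i0 of z is the time scale, and does not move the initial point. *)
Section Flow.
Context (R : realType) (n : nat).
Notation vec := 'rV[R]_n.+1.
Variables (U : set vec) (V : vec -> vec) (x0 : vec) (P : 'M[R]_n.+1)
  (i0 : 'I_n.+1) (r M : R) (N : set vec).
Hypotheses (oU : open U) (sV : forall i, smooth_on U (fun x => V x 0 i)).
Hypotheses (P0 : forall j, P i0 j = 0) (r0 : 0 < r) (M0 : 0 < M).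
Let L := n.+1%:R * M.
Let B : set vec := closed_ball_ (fun x : vec => `|x|) x0 r.
Hypothesis BU : B `<=` U.
Hypothesis BV : forall x : vec, B x -> `|V x| <= M.
Hypothesis BD : forall x : vec, B x -> forall i j, `|'D_'e_i (fun x => V x 0 j) x| <= M.
Hypotheses (oN : open N).
Hypothesis NM : forall z, N z -> `|z 0 i0| * M <= r / 2.
Hypothesis NL : forall z, N z -> `|z 0 i0| * L <= 2^-1.
Hypothesis NP : forall z, N z -> `|z *m P| <= r / 2.

Let L0 : 0 <= L.
Proof. by rewrite mulr_ge0 // ltW. Qed.

Let DV (x : vec) : 'M[R]_n.+1 := \matrix_(i, j) 'D_'e_i (fun x => V x 0 j) x.

Let contV x : U x -> {for x, continuous V}.
Proof.
by move=> Ux; apply: (@cvg_rV _ _ (nbhs x)) => i; exact: ((sV i 0%N).1 x Ux).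
Qed.

Lemma vector_field_lipschitz (x y : vec) : B x -> B y -> `|V y - V x| <= L * `|y - x|.
Proof.
move=> Bx By; apply: norm_le_coord => [|i j]; first exact: mulr_ge0.
have H (z : vec) : (forall i, between (x 0 i) (y 0 i) (z 0 i)) -> forall i,
    derivable (fun x => V x 0 j) z 'e_i /\
    `|'D_'e_i (fun x => V x 0 j) z - 0| <= M.
  move=> Hz k.
  have Bz : B z.
    apply: norm_le_coord => [|i1 j1]; first exact: ltW.
    rewrite !mxE ord1; apply: between_dist_le (Hz j1) _ _.
    + by have := le_trans (coord_le_norm (x0 - x) 0 j1) Bx; rewrite !mxE.
    + by have := le_trans (coord_le_norm (x0 - y) 0 j1) By; rewrite !mxE.
  by rewrite subr0; split; [exact: ((sV j 1%N).2 k).1 (BU Bz)|exact: BD].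
have := mvt_box H; rewrite big1 => [|? _]; last by rewrite mul0r.
rewrite subr0 !mxE ord1 => /le_trans; apply.
rewrite /L mulrAC [leLHS]mulrC; apply: ler_wpM2r; first exact: ltW.
by have := sum_coord_le (y - x); under eq_bigr do rewrite !mxE.
Qed.

(** The solution at time z_i0 t of the differential equation of V, issued from
x0 + z P, in integral form. *)
Definition trajectory (z : vec) (x : R -> vec) : Prop :=
  [/\ continuous x, forall t, B (x t) &
      forall t, x t = x0 + z *m P + z 0 i0 *: integv (fun s => V (x s)) t].

Let contVx (x : R -> vec) : continuous x -> (forall t, B (x t)) ->
  continuous (fun t => V (x t)).
Proof. by move=> cx Bx t; exact: (continuous_comp (cx t) (contV (BU (Bx t)))). Qed.

Lemma trajectory_exists z : N z -> exists x, trajectory z x.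
Proof.
move=> Nz.
pose T (x : R -> vec) t := x0 + z *m P + z 0 i0 *: integv (fun s => V (x s)) t.
have HT (x : R -> vec) : continuous x -> (forall t, B (x t)) ->
    [/\ continuous (T x), forall t, B (T x t) & forall t, T x (clamp t) = T x t].
  move=> cx Bx; have cVx := contVx cx Bx; split=> t.
  - have ci := integv_continuous cVx.
    exact: (cvgD (cvg_cst _) (cvgZl_tmp (ci t))).
  - rewrite /B /closed_ball_ /= /T !opprD !addrA subrr add0r.
    rewrite (le_trans (ler_normB _ _)) // normrN normrZ (splitr r).
    apply: lerD; first exact: NP.
    apply: le_trans (NM Nz); apply: ler_wpM2l => //.
    by apply: integv_le => // s _; exact: BV.
  - by rewrite /T integv_clamp.
have HC (x y : R -> vec) (m : R) : continuous x -> (forall t, B (x t)) ->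
    continuous y -> (forall t, B (y t)) -> 0 <= m ->
    (forall t, 0 <= t <= 1 -> `|x t - y t| <= m) ->
    forall t, 0 <= t <= 1 -> `|T x t - T y t| <= m / 2.
  move=> cx Bx cy By m0 H t t01; rewrite /T opprD addrACA subrr add0r.
  have cVx := contVx cx Bx; have cVy := contVx cy By.
  rewrite -scalerBr -(integvB t cVx cVy) normrZ.
  have LI : `|integv (fun t => V (x t) - V (y t)) t| <= L * m.
    apply: integv_le => [s|s s01]; first exact: (cvgB (cVx s) (cVy s)).
    apply: le_trans (vector_field_lipschitz (By s) (Bx s)) _.
    by apply: ler_wpM2l => //; exact: H.
  apply: le_trans (ler_wpM2l (normr_ge0 _) LI) _.
  by rewrite mulrA mulrC; apply: ler_wpM2l => //; exact: NL.
have cB : closed B by exact: closed_closed_ball_.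
have B0 (t : R) : B x0 by rewrite /B /closed_ball_ /= subrr normr0 ltW.
have [|x [cx Bx Ex]] := picard_fixed_point cB HT HC (x0 := fun=> x0) _ B0.
  by move=> t; exact: cvg_cst.
by exists x; split.
Qed.

Variable X : vec -> R -> vec.
Hypothesis HX : forall z, N z -> trajectory z (X z).

Let cX z : N z -> continuous (X z).
Proof. by case/HX. Qed.
Arguments cX {z} _ _.
Let BX z t : N z -> B (X z t).
Proof. by case/HX. Qed.
Let EX z t : N z ->
  X z t = x0 + z *m P + z 0 i0 *: integv (fun s => V (X z s)) t.
Proof. by case/HX. Qed.
Let cVX z : N z -> continuous (fun t => V (X z t)).
Proof. by move=> Nz; apply: contVx; [exact: cX|move=> t; exact: BX]. Qed.
Arguments cVX {z} _ _.

(** The difference of two trajectories is bounded by a multiple of s - z coming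
from the initial points and the time scales, plus a contracting term. *)
Lemma trajectory_lipschitz : exists2 C, 0 <= C & forall s z, N s -> N z ->
  forall t, 0 <= t <= 1 -> `|X s t - X z t| <= C * `|s - z|.
Proof.
have [p p0 Hp] : exists2 p, 0 <= p & forall v : vec, `|v *m P| <= p * `|v|.
  exists (n.+1%:R * `|P|); first by rewrite mulr_ge0.
  move=> v; apply: norm_le_coord; first by rewrite !mulr_ge0.
  move=> i j; rewrite mxE ord1; under eq_bigr do rewrite mulrC.
  by apply: sum_mul_coord_le => k; exact: coord_le_norm.
exists (2 * (p + M)); first by rewrite mulr_ge0 // addr_ge0 // ltW.
move=> s z Ns Nz t t01; rewrite -mulrA; move: t t01.
apply: contraction_bound => [t|m m0 H t t01].
  exact: (cvgB (cX Ns t) (cX Nz t)).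
have cs := cVX Ns; have cz := cVX Nz.
have -> : X s t - X z t = (s - z) *m P +
    (s - z) 0 i0 *: integv (fun t => V (X s t)) t +
    z 0 i0 *: integv (fun t => V (X s t) - V (X z t)) t.
  rewrite (integvB t cs cz) EX // [X z t]EX // mulmxBl.
  move: (integv _ t) (integv _ t) (s *m P) (z *m P) => v1 v2 v3 v4.
  by apply/rowP => j; rewrite !mxE; ring.
rewrite (le_trans (ler_normD _ _)) //; apply: lerD.
  rewrite (le_trans (ler_normD _ _)) // mulrDl; apply: lerD; first exact: Hp.
  rewrite normrZ mulrC; apply: ler_pM => //; last exact: coord_le_norm.
  by apply: (integv_le cs) => u _; apply: BV; exact: BX.
rewrite normrZ.
have LI : `|integv (fun t => V (X s t) - V (X z t)) t| <= L * m.
  apply: integv_le => [u|u u01]; first exact: (cvgB (cs u) (cz u)).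
  apply: le_trans (vector_field_lipschitz (BX u Nz) (BX u Ns)) _.
  by apply: ler_wpM2l => //; exact: H.
apply: le_trans (ler_wpM2l (normr_ge0 _) LI) _.
by rewrite mulrA mulrC; apply: ler_wpM2l => //; exact: NL.
Qed.

Let a (z : vec) (t : R) : 'M[R]_n.+1 := z 0 i0 *: DV (X z t).

Let contractive z : N z -> contracting (a z).
Proof.
move=> Nz t t01 x; rewrite /a -scalemxAr normrZ.
have H : `|x *m DV (X z t)| <= L * `|x|.
  apply: norm_le_coord => [|i j]; first exact: mulr_ge0.
  rewrite mxE ord1; under eq_bigr do rewrite mulrC mxE.
  by apply: sum_mul_coord_le => k; apply: BD; exact: BX.
apply: le_trans (ler_wpM2l (normr_ge0 _) H) _.
by rewrite mulrA mulrC; apply: ler_wpM2l => //; exact: NL.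
Qed.

Let nN z (w : vec) : N z -> \forall h \near (0:R)^', N (h *: w + z).
Proof.
move=> Nz; have nz : \forall y \near z, N y by exact: open_nbhs_nbhs.
exact: (@cvg_line R _ z w _ nz).
Qed.

Let contDV z i j : N z -> continuous (fun t => DV (X z t) i j).
Proof.
move=> Nz t; under eq_fun do rewrite mxE.
exact: (continuous_comp (cX Nz t) (((sV j 1%N).2 i).2.1 _ (BU (BX t Nz)))).
Qed.
Arguments contDV {z i j} _ _.

(** The equation of y is the formal derivative of the equation of X in the i-th
parameter.  The error of the difference quotient satisfies the same linear
equation with data made of dl (V(X_h) - V(X)), which is O(h), and of the Taylor
remainder of V divided by h, which is small by [compact_taylor] together with
the Lipschitz bound X_h - X = O(h). *)
Lemma trajectory_deriv z i (y : R -> vec) : N z -> continuous y ->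
  (forall t, 0 <= t <= 1 -> y t =
     row i P + ('e_i : vec) 0 i0 *: integv (fun t => V (X z t)) t +
     integv (fun t => y t *m a z t) t) ->
  forall l, unif_cvg 0^' (fun (h : R) t =>
    h^-1 * (X (h *: 'e_i + z) t 0 l - X z t 0 l)) (fun t => y t 0 l).
Proof.
move=> Nz cy Ey.
have FF : Filter (0:R)^' by exact: dnbhs_filter.
pose p h : vec := h *: 'e_i + z.
(* dl is 1 when the i-th parameter is the time scale, and 0 otherwise. *)
pose dl : R := ('e_i : vec) 0 i0.
have [C C0 HC] := trajectory_lipschitz.
have ne : `|'e_i : vec| <= 1.
  apply: norm_le_coord => // i1 j1; rewrite !mxE.
  by case: (_ && _); rewrite ?normr1 ?normr0.
have Xh h t : N (p h) -> 0 <= t <= 1 -> `|X (p h) t - X z t| <= C * `|h|.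
  move=> Nh t01; apply: le_trans (HC _ _ Nh Nz t t01) _.
  by rewrite addrK normrZ ler_wpM2l // ler_piMr.
pose rem h t := V (X (p h) t) - V (X z t) - (X (p h) t - X z t) *m DV (X z t).
have ca i1 j1 : continuous (fun t => a z t i1 j1).
  by move=> t; under eq_fun do rewrite mxE; exact: (cvgM (cvg_cst (z 0 i0)) (contDV Nz t)).
have H : forall l, unif_cvg 0^' (fun (h : R) t =>
    (h^-1 *: (X (p h) t - X z t) - y t) 0 l) (fun=> 0).
  apply: (@linear_perturbation R n.+1 _ (0:R)^' _ (fun _ _ => 0)
    (fun h t => dl *: (V (X (p h) t) - V (X z t)) +
                z 0 i0 *: (h^-1 *: rem h t)) (fun _ => a z)).
  - near=> h.
    have Nh : N (p h) by near: h; exact: nN.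
    have h0 : h != 0 by near: h; exact: nbhs_dnbhs_neq.
    have cVh := cVX Nh; have cVz := cVX Nz.
    have cXd : continuous (fun t => X (p h) t - X z t).
      by move=> t; exact: (cvgB (cX Nh t) (cX Nz t)).
    have cVd : continuous (fun t => V (X (p h) t) - V (X z t)).
      by move=> t; exact: (cvgB (cVh t) (cVz t)).
    have cXDV : continuous (fun t => (X (p h) t - X z t) *m DV (X z t)).
      by apply: continuous_mulmx => // i1 j1; exact: contDV.
    have cr : continuous (rem h) by move=> t; exact: (cvgB (cVd t) (cXDV t)).
    have cg : continuous (fun t => dl *: (V (X (p h) t) - V (X z t)) +
                z 0 i0 *: (h^-1 *: rem h t)).
      move=> t; exact: (cvgD (cvgZl_tmp (cVd t)) (cvgZl_tmp (cvgZl_tmp (cr t)))).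
    have cya := continuous_mulmx cy ca.
    have cd1 : continuous (fun t => dl *: (V (X (p h) t) - V (X z t))).
      by move=> t; exact: (cvgZl_tmp (cVd t)).
    have cd2 : continuous (fun t => (z 0 i0 / h) *: (V (X (p h) t) - V (X z t))).
      by move=> t; exact: (cvgZl_tmp (cVd t)).
    have cd3 : continuous (fun t => dl *: (V (X (p h) t) - V (X z t)) +
       (z 0 i0 / h) *: (V (X (p h) t) - V (X z t))).
      by move=> t; exact: (cvgD (cd1 t) (cd2 t)).
    split.
    + by move=> t; exact: (cvgB (cvgZl_tmp (cXd t)) (cy t)).
    + exact: cg.
    + exact: ca.
    + exact: contractive.
    + move=> t t01; rewrite add0r Ey // EX // [X z t]EX //.
      have -> : p h *m P = h *: row i P + z *m P.
        by rewrite /p mulmxDl -scalemxAl -rowE.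
      have -> : p h 0 i0 = h * dl + z 0 i0 by rewrite /p mxE [X in X + _]mxE.
      transitivity (dl *: (integv (fun t => V (X (p h) t)) t -
                           integv (fun t => V (X z t)) t) +
        (z 0 i0 / h) *: (integv (fun t => V (X (p h) t)) t -
                         integv (fun t => V (X z t)) t) -
        integv (fun t => y t *m a z t) t).
        rewrite -/dl; move: (integv _ t) (integv _ t) (integv _ t) (row i P) (z *m P).
        by move=> v1 v2 v3 v4 v5; apply/rowP => j; rewrite !mxE; field.
      rewrite -(integvB t cVh cVz) -(integvZ dl t cVd) -(integvZ _ t cVd).
      rewrite -(integvD t cd1 cd2) -(integvB t cd3 cya).
      congr (integv _ t); apply: funext => x; rewrite /rem /a.
      rewrite !mulmxBl -!(scalemxAl, scalemxAr) !mulmxBl.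
      move: (V _) (V _) (X _ _ *m _) (X _ _ *m _) (y _ *m _) => v1 v2 v3 v4 v5.
      by apply/rowP => j; rewrite !mxE; field.
  - by move=> l e e0; apply: nearW => h t _; rewrite mxE subrr normr0 ltW.
  - move=> l e e0.
    have KU : X z @` [set t | 0 <= t <= 1] `<=` U.
      by move=> _ [t _ <-]; apply: BU; exact: BX.
    pose e1 := e / 2 / (`|z 0 i0| * C + 1).
    have q0 : 0 < `|z 0 i0| * C + 1 by rewrite ltr_wpDl // mulr_ge0.
    have e10 : 0 < e1 by rewrite !divr_gt0.
    have [d d0 Hd] := compact_taylor oU (sV l 1%N) (compact_curve (cX Nz)) KU e10.
    near=> h => t t01.
    have Nh : N (p h) by near: h; exact: nN.
    have h0 : h != 0 by near: h; exact: nbhs_dnbhs_neq.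
    have h1 : `|h| < d / (C + 1).
      by near: h; apply: dnbhs0_lt; rewrite divr_gt0 // ltr_wpDl.
    have h2 : `|h| < e / 2 / (L * C + 1).
      near: h; apply: dnbhs0_lt; rewrite !divr_gt0 // ltr_wpDl //.
      by rewrite mulr_ge0.
    rewrite subr0 mxE (splitr e) (le_trans (ler_normD _ _)) //; apply: lerD.
      rewrite mxE normrM.
      apply: (@le_trans _ _ (1 * (L * (C * `|h|)))).
        apply: ler_pM => //.
          by apply: le_trans ne; exact: coord_le_norm.
        apply: le_trans (coord_le_norm _ _ _) _.
        apply: le_trans (vector_field_lipschitz (BX t Nz) (BX t Nh)) _.
        by apply: ler_wpM2l => //; exact: Xh.
      rewrite mul1r mulrA; apply: (@le_trans _ _ ((L * C + 1) * `|h|)).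
        by rewrite ler_wpM2r // lerDl.
      have q1 : 0 < L * C + 1 by rewrite ltr_wpDl // mulr_ge0.
      by rewrite -ler_pdivlMl // mulrC ltW.
    rewrite mxE mxE normrM normrM.
    have R1 : `|rem h t 0 l| <= e1 * (C * `|h|).
      have Bd : ball (X z t) d (X (p h) t).
        rewrite -ball_normE /ball_ /= distrC; apply: le_lt_trans (Xh h t Nh t01) _.
        apply: (@le_lt_trans _ _ ((C + 1) * `|h|)).
          by rewrite ler_wpM2r // lerDl.
        by rewrite mulrC -ltr_pdivlMr // ltr_wpDl.
      have Kt : (X z @` [set t | 0 <= t <= 1]) (X z t) by exists t.
      have := Hd _ _ Kt Bd.
      have -> : \sum_i1 'D_'e_i1 (fun x => V x 0 l) (X z t) *
        (X (p h) t - X z t) 0 i1 = ((X (p h) t - X z t) *m DV (X z t)) 0 l.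
        by rewrite [RHS]mxE; apply: eq_bigr => k _; rewrite [DV _ _ _]mxE mulrC.
      rewrite /rem [(_ - _ - _ : vec) 0 l]mxE [(_ - _ : vec) 0 l]mxE.
      rewrite [(- V _) 0 l]mxE [(- (_ *m DV _)) 0 l]mxE => /le_trans; apply.
      by apply: ler_wpM2l; [exact: ltW|exact: Xh].
    apply: (@le_trans _ _ (`|z 0 i0| * (`|h^-1| * (e1 * (C * `|h|))))).
      by apply: ler_wpM2l => //; apply: ler_wpM2l.
    have -> : `|z 0 i0| * (`|h^-1| * (e1 * (C * `|h|))) = e1 * (`|z 0 i0| * C).
      by rewrite normfV; field; rewrite normr_eq0.
    rewrite /e1 mulrAC ler_pdivrMr //; apply: ler_wpM2l; last by rewrite lerDl.
    by rewrite divr_ge0 // ltW.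
move=> l e e0; have := H l e e0; apply: filterS => h Hh t t01.
by have := Hh t t01; rewrite !mxE subr0.
Unshelve. all: by end_near. Qed.

(** If X is of class C^k in z, so are the matrix z_i0 DV(X) and the data of the
linear equation of its derivatives; hence these are of class C^k by
[Ck_curve_linear]. *)
Lemma trajectory_smooth k i : Ck_curve k N (fun z t => X z t 0 i).
Proof.
have [C C0 HC] := trajectory_lipschitz.
have U0 z l : N z ->
    unif_cvg (nbhs z) (fun z t => X z t 0 l) (fun t => X z t 0 l).
  move=> Nz e e0.
  have N1 : \forall s \near z, N s by exact: open_nbhs_nbhs.
  have e10 : 0 < e / (C + 1) by rewrite divr_gt0 // ltr_wpDl.
  have N2 : \forall s \near z, ball z (e / (C + 1)) s by exact: nbhsx_ballx.
  apply: filterS2 N1 N2 => s Ns; rewrite -ball_normE /ball_ /= => Hs t t01.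
  have := coord_le_norm (X s t - X z t) 0 l; rewrite !mxE => /le_trans; apply.
  apply: le_trans (HC s z Ns Nz t t01) _; rewrite distrC.
  apply: (@le_trans _ _ ((C + 1) * `|z - s|)); first by rewrite ler_wpM2r // lerDl.
  have q0 : 0 < C + 1 by rewrite ltr_wpDl.
  by rewrite -ler_pdivlMl // mulrC ltW.
elim: k i => [|k IH] l.
  by split=> // z Nz; [exact: continuous_coord (cX Nz)|exact: U0].
split=> [z Nz|z Nz|i]; [exact: continuous_coord (cX Nz)|exact: U0|].
pose b z t := row i P + ('e_i : vec) 0 i0 *: integv (fun t => V (X z t)) t.
have UX z t : N z -> U (X z t) by move=> Nz; exact/BU/BX.
have Ka i1 j1 : Ck_curve k N (fun z t => a z t i1 j1).
  have : Ck_curve k N (fun z t => z 0 i0 *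
      'D_'e_i1 (fun x => V x 0 j1) (X z t)).
    apply: Ck_curveM; first exact/Ck_curve_of_Ck/Ck_coord.
    exact: (Ck_curve_comp oU ((sV j1 k.+1).2 i1).2 IH UX).
  by apply: Ck_curve_ext => // z Nz t; rewrite !mxE.
have Kb j : Ck_curve k N (fun z t => b z t 0 j).
  have : Ck_curve k N (fun z t => P i j + ('e_i : vec) 0 i0 *
      integ (fun t => V (X z t) 0 j) t).
    apply: Ck_curveD; first exact: Ck_curve_cst.
    apply: Ck_curveZ; apply: Ck_curve_integ => //.
    exact: (Ck_curve_comp oU (sV j k) IH UX).
  by apply: Ck_curve_ext => // z Nz t; rewrite /b [RHS]mxE [X in _ = X + _]mxE
    [X in _ = _ + X]mxE [X in _ = _ + _ * X]mxE.
have Hw z : exists w : R -> vec, N z -> continuous w /\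
    forall t, 0 <= t <= 1 -> w t = b z t + integv (fun t => w t *m a z t) t.
  have [Nz|nNz] := pselect (N z); last by exists (fun=> 0).
  have cb : continuous (b z).
    by apply: continuous_rV => j; exact: Ck_curve_cont (Kb j) Nz.
  have ca i1 j1 : continuous (fun t => a z t i1 j1) by exact: Ck_curve_cont (Ka i1 j1) Nz.
  have [w cw Ew] := linear_solution cb ca (contractive Nz).
  by exists w.
have [w Pw] := choice Hw.
have Sw : linear_system N a b w by split=> z Nz; have [] := Pw z Nz.
exists (fun z t => w z t 0 l); first exact: (Ck_curve_linear oN contractive Ka Kb Sw l).
by move=> z Nz; have [cw Ew] := Pw z Nz; exact: (trajectory_deriv Nz cw Ew l).
Qed.

Lemma trajectory_is_derive z k (s : R) : N z -> 0 < s < 1 ->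
  is_derive s (1:R) (fun t => X z t 0 k) (z 0 i0 * V (X z s) 0 k).
Proof.
move=> Nz s01.
have cVk : continuous (fun t => V (X z t) 0 k).
  exact: continuous_coord (cVX Nz).
have -> : (fun t => X z t 0 k) =
  cst ((x0 + z *m P) 0 k) + z 0 i0 \*: integ (fun t => V (X z t) 0 k).
  by apply: funext => t; rewrite EX // mxE [X in _ + X]mxE [integv _ _ _ _]mxE.
rewrite -[_ * _]add0r; apply: is_deriveD.
by apply: is_deriveZ; exact: integ_derive.
Qed.

(** As X' = z_i0 V(X), the product rule gives
(t V(X))' = V(X) + t z_i0 V(X) DV(X): the curve t V(X) solves the linear
equation that characterizes the derivative of X in the time scale. *)
Lemma trajectory_time z l : N z ->
  unif_cvg 0^' (fun (h : R) t =>
    h^-1 * (X (h *: 'e_i0 + z) t 0 l - X z t 0 l)) (fun t => t * V (X z t) 0 l).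
Proof.
move=> Nz.
pose y (t : R) := t *: V (X z t).
have cV := cVX Nz.
have cy : continuous y by move=> t; exact: (cvgZ cvg_id (cV t)).
suff H : forall t, 0 <= t <= 1 -> y t =
     row i0 P + ('e_i0 : vec) 0 i0 *: integv (fun t => V (X z t)) t +
     integv (fun t => y t *m a z t) t.
  have := trajectory_deriv Nz cy H l.
  by apply: unif_cvg_ext => [|t _]; [exact: nearW|rewrite mxE].
have ca i1 j1 : continuous (fun t => a z t i1 j1).
  by move=> t; under eq_fun do rewrite mxE;
    exact: (cvgM (cvg_cst (z 0 i0)) (contDV Nz t)).
have cya := continuous_mulmx cy ca.
have cs : continuous (fun t => V (X z t) + y t *m a z t).
  by move=> t; exact: (cvgD (cV t) (cya t)).
have ->: row i0 P = 0 by apply/rowP => j; rewrite !mxE P0.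
move=> t t01; rewrite add0r mxE !eqxx scale1r -(integvD t cV cya).
apply/rowP => j; rewrite [RHS]mxE.
have csj : continuous (fun t => (V (X z t) + y t *m a z t) 0 j).
  exact: continuous_coord cs.
have cF : continuous (fun t : R => t * V (X z t) 0 j).
  have cVj : continuous (fun t => V (X z t) 0 j) by exact: continuous_coord cV.
  by move=> s; exact: (cvgM cvg_id (cVj s)).
have dF (s : R) : 0 < s < 1 -> is_derive s (1:R) (fun t : R => t * V (X z t) 0 j)
    ((V (X z s) + y s *m a z s) 0 j).
  move=> s01.
  have Xd k := trajectory_is_derive k Nz s01.
  have cXk k : continuous (fun t => X z t 0 k) by exact: continuous_coord (cX Nz).
  have dV := @chain_rule R R n.+1 U (fun x => V x 0 j) (X z) s 1 oU (sV j 1%N)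
    (BU (BX s Nz)) (fun k => cXk k s)
    (fun k => @ex_derive _ _ _ _ _ _ _ (Xd k)).
  have D : is_derive s (1:R) (fun t : R => t * V (X z t) 0 j)
     (s *: (\sum_k 'D_'e_k (fun x => V x 0 j) (X z s) *
        'D_1 (fun t => X z t 0 k) s) + V (X z s) 0 j *: 1).
    exact: (is_deriveM (is_derive_id s (1:R)) dV).
  apply: is_derive_eq.
  rewrite [in RHS]mxE [LHS]addrC; congr (_ + _).
    exact: mulr1.
  rewrite mxE /GRing.scale /= mulr_sumr; apply: eq_bigr => k _.
  rewrite (@derive_val _ _ _ _ _ _ _ (Xd k)) /y /a !mxE.
  by ring.
rewrite (integ_unique csj cF dF t01) mul0r subr0 /y mxE.
by [].
Qed.

End Flow.

(** Phi z is the trajectory of z at time 1.  By [trajectory_time] at t = 1 its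
derivative in the time scale is V (Phi z). *)
Lemma flow_map (R : realType) (n : nat) (U : set 'rV[R]_n.+1)
    (V : 'rV[R]_n.+1 -> 'rV[R]_n.+1) x0 (P : 'M[R]_n.+1) i0 :
  open U -> (forall i, smooth_on U (fun x => V x 0 i)) -> U x0 ->
  (forall j, P i0 j = 0) ->
  exists2 rho, 0 < rho & exists Phi : 'rV[R]_n.+1 -> 'rV[R]_n.+1,
    [/\ forall z : 'rV[R]_n.+1, ball 0 rho z -> U (Phi z),
        forall i, smooth_on (ball 0 rho) (fun z : 'rV[R]_n.+1 => Phi z 0 i),
        forall z : 'rV[R]_n.+1, ball 0 rho z -> forall i,
          'D_'e_i0 (fun z : 'rV[R]_n.+1 => Phi z 0 i) z = V (Phi z) 0 i &
        forall z : 'rV[R]_n.+1, ball 0 rho z -> z 0 i0 = 0 -> Phi z = x0 + z *m P].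
Proof.
move=> oU sV Ux0 P0.
pose M0 := 1 + `|V x0| + \sum_i \sum_j `|'D_'e_i (fun x => V x 0 j) x0|.
have s0 : 0 <= \sum_i \sum_j `|'D_'e_i (fun x => V x 0 j) x0|.
  by apply: sumr_ge0 => i _; apply: sumr_ge0.
have M00 : 0 < M0 by rewrite /M0 ltr_wpDr // ltr_pwDl.
have n1 : \forall x \near x0, U x by exact: open_nbhs_nbhs.
have n2 : \forall x \near x0, `|V x| <= M0.
  have cV : V @ x0 --> V x0.
    by apply: (@cvg_rV _ _ (nbhs x0)) => i; exact: ((sV i 0%N).1 x0 Ux0).
  move/cvgrPdist_le : cV => /(_ 1 ltr01); apply: filterS => x Hx.
  rewrite -[V x](subrK (V x0)) (le_trans (ler_normD _ _)) //.
  by rewrite distrC (le_trans (lerD Hx (lexx _))) // /M0 lerDl.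
have n3 : \forall x \near x0, forall ij : 'I_n.+1 * 'I_n.+1,
    `|'D_'e_ij.1 (fun x => V x 0 ij.2) x| <= M0.
  have n3' (ij : 'I_n.+1 * 'I_n.+1) : \forall x \near x0,
      `|'D_'e_ij.1 (fun x => V x 0 ij.2) x| <= M0.
    case: ij => i j /=.
    have /cvgrPdist_le/(_ 1 ltr01) := ((sV j 1%N).2 i).2.1 x0 Ux0.
    apply: filterS => x Hx.
    rewrite -['D_'e_i _ x](subrK ('D_'e_i (fun x => V x 0 j) x0)).
    rewrite (le_trans (ler_normD _ _)) // distrC (le_trans (lerD Hx (lexx _))) //.
    rewrite /M0 -addrA lerD2l ler_wpDl //.
    rewrite (bigD1 i) //= (bigD1 j) //= -addrA lerDl addr_ge0 //.
      by apply: sumr_ge0.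
    by apply: sumr_ge0 => k _; apply: sumr_ge0.
  exact: filter_forall n3'.
have [r1 /= r10 H] := (@nbhs_ballP _ _ _ _).1 (filterI n1 (filterI n2 n3)).
pose r := r1 / 2; have r0 : 0 < r by rewrite divr_gt0.
have Bb (x : 'rV[R]_n.+1) : closed_ball_ (fun x : 'rV[R]_n.+1 => `|x|) x0 r x -> ball x0 r1 x.
  rewrite -ball_normE /closed_ball_ /ball_ /= => /le_lt_trans; apply.
  by rewrite /r ltr_pdivrMr // ltr_pMr // ltr1n.
pose L := n.+1%:R * M0.
pose p := n.+1%:R * `|P|.
have L0 : 0 < L by rewrite mulr_gt0 // ltr0n.
have p0 : 0 <= p by rewrite mulr_ge0.
(* The three entries ensure respectively that the motion stays within r / 2, that
   the equation contracts, and that the initial displacement is at most r / 2. *)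
pose rho := Num.min (r / 2 / M0) (Num.min (2^-1 / L) (r / 2 / (p + 1))).
have rho0 : 0 < rho.
  by rewrite !lt_min !divr_gt0 ?invr_gt0 // ltr_wpDl.
exists rho => //.
have Nz (z : 'rV[R]_n.+1) : ball 0 rho z -> `|z| < rho by rewrite -ball_normE /= sub0r normrN.
have NM (z : 'rV[R]_n.+1) : ball 0 rho z -> `|z 0 i0| * M0 <= r / 2.
  move=> /Nz zr; rewrite -ler_pdivlMr // (le_trans (coord_le_norm _ _ _)) //.
  by rewrite (le_trans (ltW zr)) // ge_min lexx.
have NL (z : 'rV[R]_n.+1) : ball 0 rho z -> `|z 0 i0| * L <= 2^-1.
  move=> /Nz zr; rewrite -ler_pdivlMr // (le_trans (coord_le_norm _ _ _)) //.
  by rewrite (le_trans (ltW zr)) // !ge_min lexx orbT.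
have NP (z : 'rV[R]_n.+1) : ball 0 rho z -> `|z *m P| <= r / 2.
  move=> /Nz zr; apply: (@le_trans _ _ ((p + 1) * `|z|)).
    apply: (@le_trans _ _ (p * `|z|)); last by rewrite ler_wpM2r // lerDl.
    apply: norm_le_coord; first by rewrite !mulr_ge0.
    move=> i j; rewrite mxE ord1; under eq_bigr do rewrite mulrC.
    by apply: sum_mul_coord_le => k; exact: coord_le_norm.
  have q0 : 0 < p + 1 by rewrite ltr_wpDl.
  rewrite -ler_pdivlMl // mulrC (le_trans (ltW zr)) //.
  by rewrite !ge_min lexx !orbT.
have BU (x : 'rV[R]_n.+1) : closed_ball_ (fun x : 'rV[R]_n.+1 => `|x|) x0 r x -> U x.
  by move=> /Bb/H[].
have BV (x : 'rV[R]_n.+1) : closed_ball_ (fun x : 'rV[R]_n.+1 => `|x|) x0 r x -> `|V x| <= M0.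
  by move=> /Bb/H[_ []].
have BD (x : 'rV[R]_n.+1) : closed_ball_ (fun x : 'rV[R]_n.+1 => `|x|) x0 r x -> forall i j,
    `|'D_'e_i (fun x => V x 0 j) x| <= M0.
  by move=> /Bb/H[_ [_ h]] i j; exact: (h (i, j)).
have oN : open (ball (0 : 'rV[R]_n.+1) rho) by exact: ball_open.
have ex (z : 'rV[R]_n.+1) : exists x : R -> 'rV[R]_n.+1, ball 0 rho z ->
    trajectory V x0 P i0 r z x.
  have [bz|nbz] := pselect (ball 0 rho z); last by exists (fun=> 0).
  have [x Hx] := trajectory_exists sV r0 M00 BU BV BD NM NL NP bz.
  by exists x.
have [X HX] := choice ex.
have l11 : 0 <= (1:R) <= 1 by rewrite ler01 lexx.
have TS := trajectory_smooth oU sV r0 M00 BU BV BD oN NL HX.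
have TT := trajectory_time oU sV P0 r0 M00 BU BV BD oN NL HX.
exists (fun z => X z 1); split.
- by move=> z /HX[_ Bx _]; exact: BU.
- by move=> i k; exact: Ck_of_Ck_curve oN l11 (TS k i).
- move=> z bz i; apply: cvg_lim => //; apply/cvgrPdist_le => e e0.
  have := TT z i bz e e0; apply: filterS => h Hh.
  by have := Hh 1 l11; rewrite mul1r distrC; exact.
- move=> z /HX[_ _ EX] z0; by rewrite EX z0 scale0r addr0.
Qed.

(** * The inverse function theorem *)

Lemma open_near (T : topologicalType) (A : set T) :
  (forall x, A x -> \forall y \near x, A y) -> open A.
Proof. by move=> H; rewrite openE => x /H. Qed.

Lemma norm_mulmx_le (R : realType) (m n : nat) (v : 'rV[R]_m) (A : 'M[R]_(m, n)) :
  `|v *m A| <= m%:R * `|A| * `|v|.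
Proof.
apply: norm_le_coord; first by rewrite !mulr_ge0.
move=> i j; rewrite mxE ord1; under eq_bigr do rewrite mulrC.
by apply: sum_mul_coord_le => k; exact: coord_le_norm.
Qed.

Lemma Ck_det (R : realType) (m n k : nat) (Z : set 'rV[R]_m)
    (A : 'rV[R]_m -> 'M[R]_n) :
  open Z -> (forall i j, Ck k Z (fun z => A z i j)) -> Ck k Z (fun z => \det (A z)).
Proof.
move=> oZ H; apply: Ck_sum => // s; apply: CkM => //; first exact: Ck_cst.
by apply: Ck_prod.
Qed.

(** Cramer's rule: the entries of the inverse are cofactors divided by the
determinant. *)
Lemma Ck_invmx (R : realType) (m n k : nat) (Z : set 'rV[R]_m)
    (A : 'rV[R]_m -> 'M[R]_n) i j :
  open Z -> (forall i j, Ck k Z (fun z => A z i j)) ->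
  (forall z, Z z -> A z \in unitmx) -> Ck k Z (fun z => invmx (A z) i j).
Proof.
move=> oZ H uA.
apply: (Ck_ext (f := fun z => (\det (A z))^-1 * \adj (A z) i j)) => // [z Zz|].
  by rewrite /invmx uA // !mxE.
apply: CkM => //; first apply: CkV => //.
- by move=> z /uA; rewrite unitmxE unitfE.
- exact: Ck_det.
under eq_fun do rewrite !mxE /cofactor.
apply: CkM => //; first exact: Ck_cst.
by apply: Ck_det => // i1 j1; under eq_fun do rewrite !mxE; exact: H.
Qed.

(** The Jacobian matrix in terms of partial derivatives; differentials act on
rows from the right, hence the derivatives in the i-th variable form the i-th
row. *)
Definition jac (R : realType) (m n : nat) (f : 'rV[R]_m -> 'rV[R]_n) x : 'M[R]_(m, n) :=
  \matrix_(i, j) 'D_'e_i (fun x => f x 0 j) x.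

Lemma C1_strict_vec (R : realType) (m n : nat) (U : set 'rV[R]_m)
    (f : 'rV[R]_m -> 'rV[R]_n) x e :
  open U -> (forall j, Ck 1 U (fun x => f x 0 j)) -> U x -> 0 < e ->
  \forall r \near 0^'+, forall y z, ball x r y -> ball x r z ->
    `|f z - f y - (z - y) *m jac f x| <= e * `|z - y|.
Proof.
move=> oU Cf Ux e0.
have H j := C1_strict oU (Cf j) Ux e0.
near=> r => y z xy xz.
have Hr : forall j, ball x r `<=` U /\ forall y z, ball x r y -> ball x r z ->
    `|f z 0 j - f y 0 j - \sum_i 'D_'e_i (fun x => f x 0 j) x * (z - y) 0 i|
      <= e * `|z - y|.
  by near: r; exact: filter_forall H.
apply: norm_le_coord => [|i j]; first by rewrite mulr_ge0 // ltW.
have [_ /(_ y z xy xz)] := Hr j; rewrite ord1.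
rewrite [(f z - f y - _) 0 j]mxE [(f z - f y) 0 j]mxE [(- f y) 0 j]mxE.
rewrite [(- (_ *m _)) 0 j]mxE [(_ *m jac _ _) 0 j]mxE.
by under [X in _ -> `|_ - X| <= _]eq_bigr do rewrite mulrC mxE.
Unshelve. all: by end_near. Qed.

(** Psi is Phi followed by the inverse of its differential at a, so that it is
close to the identity near a; c bounds the norm of that inverse matrix. *)
Section InverseMap.
Context (R : realType) (n : nat).
Notation vec := 'rV[R]_n.
Variables (O : set vec) (Phi : vec -> vec) (a : vec).
Hypotheses (oO : open O) (sPhi : forall i, smooth_on O (fun z => Phi z 0 i)).
Hypotheses (Oa : O a) (uJ : jac Phi a \in unitmx).

Let Qi : 'M[R]_n := invmx (jac Phi a).
Let c : R := n%:R * `|Qi| + 1.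
Let c0 : 0 < c. Proof. by rewrite ltr_wpDl // mulr_ge0. Qed.
Let Qi_le (v : vec) : `|v *m Qi| <= c * `|v|.
Proof. by apply: le_trans (norm_mulmx_le v Qi) _; rewrite ler_wpM2r // lerDl. Qed.

Let Psi (z : vec) : vec := Phi z *m Qi.

Lemma near_identity : exists2 r, 0 < r & ball a r `<=` O /\
  forall y z, ball a r y -> ball a r z ->
    `|Psi z - Psi y - (z - y)| <= `|z - y| / 2.
Proof.
(* Composing with Qi costs a factor c; what remains is the ratio 1/2. *)
have e0 : 0 < (2 * c)^-1 by rewrite invr_gt0 mulr_gt0.
have N1 := C1_strict_vec oO (fun j => sPhi j 1%N) Oa e0.
have N2 : \forall r \near (0:R)^'+, ball a r `<=` O.
  have [r1 /= r10 H] := (@nbhs_ballP _ _ a O).1 (open_nbhs_nbhs (conj oO Oa)).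
  near=> r; apply: subset_trans H; apply: le_ball.
  by near: r; exact: nbhs_right_le.
have /filter_ex[r [[H1 H2] r0]] : \forall r \near (0:R)^'+,
  ((forall y z, ball a r y -> ball a r z ->
    `|Phi z - Phi y - (z - y) *m jac Phi a| <= (2 * c)^-1 * `|z - y|) /\
   ball a r `<=` O) /\ 0 < r.
  by apply: filterI (filterI N1 N2) _; exact: nbhs_right_gt.
exists r => //; split=> // y z ay az.
have -> : Psi z - Psi y - (z - y) = (Phi z - Phi y - (z - y) *m jac Phi a) *m Qi.
  by rewrite !mulmxBl !mulmxK // /Psi.
apply: le_trans (Qi_le _) _.
apply: le_trans (ler_wpM2l (ltW c0) (H1 y z ay az)) _.
by rewrite mulrA invfM mulrCA mulfV ?mulr1 ?lt0r_neq0 // mulrC.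
Unshelve. all: by end_near. Qed.

Variable r : R.
Hypotheses (r0 : 0 < r) (rO : ball a r `<=` O).
Hypothesis rPsi : forall y z, ball a r y -> ball a r z ->
    `|Psi z - Psi y - (z - y)| <= `|z - y| / 2.

(** Psi is the identity up to a map of Lipschitz constant 1/2. *)
Lemma expanding y z : ball a r y -> ball a r z -> `|z - y| <= 2 * `|Psi z - Psi y|.
Proof.
move=> ay az; have := rPsi ay az.
have : `|z - y| <= `|Psi z - Psi y - (z - y)| + `|Psi z - Psi y|.
  move: (Psi z - Psi y) (z - y) => w u.
  by rewrite -{1}(subKr w u) [leRHS]addrC; exact: ler_normB.
lra.
Qed.

Let rad := r / 2.
Let rad0 : 0 < rad. Proof. by rewrite divr_gt0. Qed.
Let W : set vec := [set x | `|x *m Qi - Psi a| < rad / 2].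
Let N : set vec := [set z | ball a rad z /\ W (Phi z)].

Let rad_r z : `|a - z| <= rad -> ball a r z.
Proof.
rewrite -ball_normE /ball_ /= => /le_lt_trans; apply.
by rewrite ltr_pdivrMr // ltr_pMr // ltr1n.
Qed.

Let contPhi z : O z -> {for z, continuous Phi}.
Proof.
by move=> Oz; apply: (@cvg_rV _ _ (nbhs z)) => i; exact: ((sPhi i 0%N).1 z Oz).
Qed.

Let Qi_cont : continuous (fun x : vec => x *m Qi).
Proof.
move=> x; apply: (@cvg_rV _ _ (nbhs x)) => j; rewrite mxE.
under eq_fun do rewrite mxE.
apply: (@cvg_sum_ord R _ (nbhs x)) => i.
exact: (cvgM (@coord_continuous _ _ _ 0 i x) (cvg_cst (Qi i j))).
Qed.

Let contPsi z : O z -> {for z, continuous Psi}.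
Proof.
by move=> Oz; exact: (continuous_comp (contPhi Oz) (@Qi_cont (Phi z))).
Qed.

Lemma target_open : open W.
Proof.
have -> : W = (fun x => x *m Qi) @^-1` ball (Psi a) (rad / 2).
  apply/seteqP; split=> x; rewrite /W /preimage -ball_normE /ball_ /=.
    by rewrite distrC.
  by rewrite distrC.
apply: open_comp; first by move=> x _; exact: Qi_cont.
by apply: ball_open; rewrite divr_gt0.
Qed.

Let NO z : N z -> O z.
Proof.
move=> [bz _]; apply/rO/rad_r; move: bz.
by rewrite -ball_normE /ball_ /= => /ltW.
Qed.
Let Nr z : N z -> ball a r z.
Proof.
move=> [bz _]; apply/rad_r; move: bz.
by rewrite -ball_normE /ball_ /= => /ltW.
Qed.

Lemma source_open : open N.
Proof.
apply: open_near => z Nz; have [bz Wz] := Nz.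
apply: filterI; first by apply: open_nbhs_nbhs; split => //; exact: ball_open.
apply: (contPhi (NO Nz)); apply: open_nbhs_nbhs; split => //; exact: target_open.
Qed.

Lemma source_center : N a.
Proof.
split; first exact: ballxx.
by rewrite /W /= /Psi subrr normr0 divr_gt0.
Qed.

(** With y = x Qi, a solution of Psi z = y is a fixed point of
u |-> y - Psi u + u, which contracts by 1/2 near a.  It is found by
[picard_fixed_point] applied pointwise in time. *)
Lemma target_reached x : W x -> exists2 z, N z & Phi z = x.
Proof.
move=> Wx; pose y := x *m Qi.
pose K : set vec := closed_ball_ (fun x : vec => `|x|) a rad.
pose T (u : R -> vec) (t : R) := y - Psi (u (clamp t)) + u (clamp t).
have cc : continuous (@clamp R) := @clamp_continuous R.
have HT (u : R -> vec) : continuous u -> (forall t, K (u t)) ->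
    [/\ continuous (T u), forall t, K (T u t) & forall t, T u (clamp t) = T u t].
  move=> cu Ku; split=> [t|t|t]; last by rewrite /T clampK.
    have c1 : {for t, continuous (fun t => u (clamp t))}.
      exact: (continuous_comp (cc t) (cu _)).
    have c2 : {for t, continuous (fun t => Psi (u (clamp t)))}.
      exact: (continuous_comp c1 (contPsi (rO (rad_r (Ku _))))).
    exact: (cvgD (cvgB (cvg_cst y) c2) c1).
  rewrite /K /closed_ball_ /= /T.
  (* Half of rad bounds the contracted distance from u to a, the other half the
     distance from y to Psi a. *)
  have := rPsi (ballxx a r0) (rad_r (Ku (clamp t))).
  have := Ku (clamp t); rewrite /K /closed_ball_ /= distrC.
  move: Wx; rewrite /W /= -/y.
  move: (u (clamp t)) => v h1 h2 h3.
  have -> : a - (y - Psi v + v) = (Psi v - Psi a - (v - a)) - (y - Psi a).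
    by apply/rowP => j; rewrite !mxE; ring.
  rewrite (le_trans (ler_normB _ _)) //; lra.
have HC (u v : R -> vec) (m : R) : continuous u -> (forall t, K (u t)) ->
    continuous v -> (forall t, K (v t)) -> 0 <= m ->
    (forall t, 0 <= t <= 1 -> `|u t - v t| <= m) ->
    forall t, 0 <= t <= 1 -> `|T u t - T v t| <= m / 2.
  move=> cu Ku cv Kv m0 H t t01; rewrite /T clamp_id //.
  have -> : y - Psi (u t) + u t - (y - Psi (v t) + v t) =
     - (Psi (u t) - Psi (v t) - (u t - v t)).
    by move: (Psi _) (Psi _) => p q; apply/rowP => j; rewrite !mxE; ring.
  rewrite normrN (le_trans (rPsi (rad_r (Kv t)) (rad_r (Ku t)))) //.
  by rewrite ler_wpM2r ?invr_ge0 // H.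
have cK : closed K by exact: closed_closed_ball_.
have K0 (t : R) : K a by rewrite /K /closed_ball_ /= subrr normr0 ltW.
have [|u [cu Ku Eu]] := picard_fixed_point cK HT HC (x0 := fun=> a) _ K0.
  by move=> t; exact: cvg_cst.
pose z := u (clamp 0).
have Ez : Psi z = y.
  have := Eu (clamp 0); rewrite /T clampK -/z => /eqP.
  by rewrite -subr_eq subrr eq_sym subr_eq0 => /eqP.
have Pz : Phi z = x.
  have : Phi z *m Qi *m jac Phi a = x *m Qi *m jac Phi a by rewrite -/(Psi z) Ez.
  by rewrite !mulmxKV.
exists z => //; split; last by rewrite Pz.
have := expanding (ballxx a r0) (rad_r (Ku (clamp 0))).
rewrite -/z Ez -ball_normE /= distrC => /le_lt_trans; apply.
by rewrite mulrC -ltr_pdivlMr.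
Qed.

Lemma source_injective y z : N y -> N z -> `|z - y| <= 2 * c * `|Phi z - Phi y|.
Proof.
move=> Ny Nz; apply: le_trans (expanding (Nr Ny) (Nr Nz)) _.
by rewrite /Psi -mulmxBl -mulrA ler_wpM2l.
Qed.

(** A vector u in the kernel of the differential at z would give
Phi (z + h u) - Phi z = o(h), against the lower bound of [source_injective]. *)
Lemma jac_unit z : N z -> jac Phi z \in unitmx.
Proof.
move=> Nz; rewrite -row_free_unit -kermx_eq0.
apply/rowV0P => u /sub_kermxP uJ0; apply/eqP.
(* A half of the ratio 1 / (2 c) by which Phi may shrink distances. *)
have e0 : 0 < (4 * c)^-1 by rewrite invr_gt0 mulr_gt0.
have N1 := C1_strict_vec oO (fun j => sPhi j 1%N) (NO Nz) e0.
have /filter_ex[d [H d0]] : \forall r \near (0:R)^'+, (forall x y, ball z r x ->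
   ball z r y -> `|Phi y - Phi x - (y - x) *m jac Phi z| <= (4 * c)^-1 * `|y - x|)
   /\ 0 < r.
  by apply: filterI N1 _; exact: nbhs_right_gt.
have l : (fun h : R => h *: u + z) @ 0^' --> z by exact: cvg_line.
have n1 : \forall h \near (0:R)^', N (h *: u + z).
  apply: (l N); apply: open_nbhs_nbhs; split => //; exact: source_open.
have n2 : \forall h \near (0:R)^', ball z d (h *: u + z).
  by apply: (l (ball z d)); exact: nbhsx_ballx.
have n3 : \forall h \near (0:R)^', h != 0 by exact: nbhs_dnbhs_neq.
have /filter_ex[h [[Nh bh] h0]] : \forall h \near (0:R)^',
    (N (h *: u + z) /\ ball z d (h *: u + z)) /\ h != 0.
  by apply: filterI (filterI n1 n2) n3.
have := H z _ (ballxx z d0) bh; have := source_injective Nz Nh.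
rewrite !addrK -scalemxAl uJ0 scaler0 subr0.
move: (Phi _ - Phi z) => w H1 H2.
have : `|h *: u| <= 2^-1 * `|h *: u|.
  apply: le_trans H1 _; have c2 : 0 <= 2 * c by rewrite mulr_ge0 // ltW.
  apply: le_trans (ler_wpM2l c2 H2) _; rewrite mulrA.
  suff -> : 2 * c * (4 * c)^-1 = 2^-1 by [].
  by field; exact: lt0r_neq0.
rewrite -subr_ge0 -{2}[`|h *: u|]mul1r -mulrBl => H3.
have : `|h *: u| <= 0 by have := normr_ge0 (h *: u); lra.
by rewrite normr_le0 scaler_eq0 (negPf h0).
Qed.

Variable Gam : vec -> vec.
Hypothesis GamP : forall x, W x -> N (Gam x) /\ Phi (Gam x) = x.

Lemma inverse_lipschitz x y : W x -> W y -> `|Gam y - Gam x| <= 2 * c * `|y - x|.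
Proof.
move=> /GamP[Nx Ex] /GamP[Ny Ey].
by have := source_injective Nx Ny; rewrite Ex Ey.
Qed.

Lemma inverse_continuous x i : W x -> {for x, continuous (fun x => Gam x 0 i)}.
Proof.
move=> Wx; apply/(@cvgrPdist_le _ _ _ (nbhs x)) => e e0.
have n1 : \forall y \near x, W y.
  by apply: open_nbhs_nbhs; split => //; exact: target_open.
have c2 : 0 < 2 * c by rewrite mulr_gt0.
have n2 : \forall y \near x, ball x (e / (2 * c)) y.
  by apply: nbhsx_ballx; rewrite divr_gt0.
apply: filterS2 n1 n2 => y Wy; rewrite -ball_normE /= => Hy.
have := coord_le_norm (Gam x - Gam y) 0 i; rewrite !mxE => /le_trans; apply.
apply: le_trans (inverse_lipschitz Wy Wx) _.
by rewrite -ler_pdivlMl // mulrC ltW.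
Qed.

(** For w the increment of Gam along h 'e_i, differentiability of Phi gives
h 'e_i = w J + o(w), and w = O(h) since Gam is Lipschitz; now multiply by the
inverse of J. *)
Lemma inverse_derive x i j : W x ->
  is_derive x ('e_i : vec) (fun x => Gam x 0 j) (invmx (jac Phi (Gam x)) i j).
Proof.
move=> Wx; have [Nz Ez] := GamP Wx.
set z := Gam x in Nz Ez *; set J := jac Phi z.
have uJz : J \in unitmx by exact: jac_unit.
suff D : (fun h : R => h^-1 *: (((fun x => Gam x 0 j) \o shift x) (h *: 'e_i)
    - Gam x 0 j)) @ 0^' --> invmx J i j.
  by split; [apply/cvg_ex; eexists; exact: D|exact/cvg_lim].
apply/cvgrPdist_le => e e0.
pose k : R := n%:R * `|invmx J| + 1.
have k0 : 0 < k by rewrite ltr_wpDl // mulr_ge0.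
pose d := e / (k * (2 * c)).
have d0 : 0 < d by rewrite divr_gt0 // !mulr_gt0.
have N1 := C1_strict_vec oO (fun j => sPhi j 1%N) (NO Nz) d0.
have /filter_ex[s [H s0]] : \forall r \near (0:R)^'+, (forall x y, ball z r x ->
   ball z r y -> `|Phi y - Phi x - (y - x) *m jac Phi z| <= d * `|y - x|) /\ 0 < r.
  by apply: filterI N1 _; exact: nbhs_right_gt.
near=> h.
have h0 : h != 0 by near: h; exact: nbhs_dnbhs_neq.
have Wh : W (h *: 'e_i + x).
  near: h; apply: (@cvg_line R _ x ('e_i : vec) W).
  by apply: open_nbhs_nbhs; split => //; exact: target_open.
have ne : `|'e_i : vec| <= 1.
  apply: norm_le_coord => // i1 j1; rewrite !mxE.
  by case: (_ && _); rewrite ?normr1 ?normr0.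
have [Nh Eh] := GamP Wh.
have L : `|Gam (h *: 'e_i + x) - z| <= 2 * c * `|h|.
  apply: le_trans (inverse_lipschitz Wx Wh) _; rewrite addrK normrZ.
  apply: ler_wpM2l; first by rewrite mulr_ge0 // ltW.
  exact: ler_piMr.
have hs : `|h| < s / (2 * c).
  by near: h; apply: dnbhs0_lt; rewrite divr_gt0 // mulr_gt0.
have bh : ball z s (Gam (h *: 'e_i + x)).
  rewrite -ball_normE /ball_ /= distrC; apply: le_lt_trans L _.
  by rewrite mulrC -ltr_pdivlMr // mulr_gt0.
have := H z _ (ballxx z s0) bh; rewrite Eh Ez addrK.
set w := Gam _ - z in L * => H1.
have H2 : `|h *: 'e_i *m invmx J - w| <= k * (d * (2 * c * `|h|)).
  have -> : h *: 'e_i *m invmx J - w = (h *: 'e_i - w *m J) *m invmx J.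
    by rewrite mulmxBl mulmxK.
  apply: le_trans (norm_mulmx_le _ _) _.
  apply: (@le_trans _ _ (k * `|h *: 'e_i - w *m J|)).
    by apply: ler_wpM2r => //; rewrite lerDl.
  apply: ler_wpM2l; first exact: ltW.
  by apply: le_trans H1 _; apply: ler_wpM2l => //; exact: ltW.
rewrite /= /shift /=.
have -> : invmx J i j - h^-1 *: (Gam (h *: 'e_i + x) 0 j - z 0 j) =
   h^-1 * (h *: 'e_i *m invmx J - w) 0 j.
  have E1 : (h *: ('e_i : vec) *m invmx J) 0 j = h * invmx J i j.
    by rewrite -scalemxAl -rowE !mxE.
  have E2 : w 0 j = Gam (h *: 'e_i + x) 0 j - z 0 j by rewrite !mxE.
  rewrite mxE E1 mxE E2 mulrBr mulKf //.
rewrite normrM; apply: (@le_trans _ _ (`|h^-1| * (k * (d * (2 * c * `|h|))))).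
  by apply: ler_wpM2l => //; apply: le_trans H2; exact: coord_le_norm.
have cn : c != 0 by exact: lt0r_neq0.
have kn : k != 0 by exact: lt0r_neq0.
rewrite le_eqVlt; apply/orP; left; apply/eqP.
by rewrite normfV /d; field; rewrite cn kn normr_eq0.
Unshelve. all: by end_near. Qed.

(** The formula for the derivatives of Gam expresses them by Gam itself and the
derivatives of Phi: each order of smoothness of Gam yields the next. *)
Lemma inverse_smooth j : smooth_on W (fun x => Gam x 0 j).
Proof.
move=> k; elim: k j => [|k IH] j; first by split=> // x Wx; exact: inverse_continuous.
split=> [x Wx|i]; first exact: inverse_continuous.
split=> [x Wx|]; first by have [] := inverse_derive i j Wx.
apply: (Ck_ext (f := fun x => invmx (jac Phi (Gam x)) i j)); first exact: target_open.
  by move=> x Wx; have [_ ->] := inverse_derive i j Wx.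
apply: Ck_invmx; first exact: target_open.
  move=> i1 j1; under eq_fun do rewrite mxE.
  apply: (Ck_comp (f := fun y => 'D_'e_i1 (fun x => Phi x 0 j1) y) target_open oO _ IH).
    exact: ((sPhi j1 k.+1).2 i1).2.
  by move=> x /GamP[/NO].
by move=> x /GamP[/jac_unit].
Qed.

End InverseMap.

Lemma inverse_map (R : realType) (n : nat) (O : set 'rV[R]_n)
    (Phi : 'rV[R]_n -> 'rV[R]_n) (a : 'rV[R]_n) :
  open O -> (forall i, smooth_on O (fun z => Phi z 0 i)) -> O a ->
  jac Phi a \in unitmx ->
  exists N W (Gam : 'rV[R]_n -> 'rV[R]_n),
    [/\ open N, open W, N a /\ N `<=` O,
        forall z, N z -> [/\ W (Phi z), Gam (Phi z) = z & jac Phi z \in unitmx] &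
        (forall x, W x -> N (Gam x) /\ Phi (Gam x) = x) /\
        forall i, smooth_on W (fun x => Gam x 0 i)].
Proof.
move=> oO sPhi Oa uJ.
have [r r0 [rO rPsi]] := near_identity oO sPhi Oa uJ.
pose rad := r / 2.
pose W := [set x | `|x *m invmx (jac Phi a) - Phi a *m invmx (jac Phi a)| < rad / 2].
pose N := [set z | ball a rad z /\ W (Phi z)].
have Hreach x : exists z, W x -> N z /\ Phi z = x.
  have [Wx|nWx] := pselect (W x); last by exists 0.
  by have [z Nz Ez] := target_reached sPhi uJ r0 rO rPsi Wx; exists z.
have [Gam HG] := choice Hreach.
exists N, W, Gam; split.
- exact (source_open sPhi r0 rO).
- exact: target_open.
- split; first exact: source_center.
  by move=> z [bz _]; apply: rO; apply: le_ball bz; rewrite ler_pdivrMr // ler_pMr // ler1n.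
- move=> z Nz; have Wz : W (Phi z) by case: Nz.
  split=> //; last exact: (jac_unit oO sPhi r0 rO rPsi Nz).
  have [Ng Eg] := HG _ Wz.
  apply/eqP; rewrite -subr_eq0 -normr_le0.
  have := source_injective r0 rPsi Nz Ng.
  by rewrite Eg subrr normr0 mulr0.
- split; first exact: HG.
  by move=> i; exact: (inverse_smooth oO sPhi r0 rO rPsi HG).
Qed.

(** * Flow boxes and adapted charts *)

(** Replace the row i0 of a permutation matrix by v; the permutation exchanges i0
with an index k such that v_k is not zero, so that the rows other than
i0 are the unit vectors other than 'e_k. *)
Lemma unitmx_with_row (R : realType) (n : nat) (v : 'rV[R]_n) (i0 : 'I_n) :
  v != 0 -> exists2 Q : 'M[R]_n, Q \in unitmx & row i0 Q = v.
Proof.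
move=> v0; have [k vk] : exists k, v 0 k != 0.
  apply/existsP; apply: contraNT v0 => /existsPn H.
  by apply/eqP/rowP => j; rewrite mxE; apply/eqP; have := H j; rewrite negbK.
pose s := tperm k i0.
pose Q : 'M[R]_n := \matrix_(i, j) if i == i0 then v 0 j else (s i == j)%:R.
exists Q; last by apply/rowP => j; rewrite !mxE eqxx.
rewrite -row_free_unit -kermx_eq0; apply/rowV0P => u /sub_kermxP uQ.
have E j : u 0 i0 * v 0 j + (j != k)%:R * u 0 (s j) = 0.
  have : (u *m Q) 0 j = 0 by rewrite uQ mxE.
  rewrite mxE (bigD1 i0) //= mxE eqxx => <-; congr (_ + _).
  have [->|jk] := eqVneq j k.
    rewrite mul0r big1 // => i ii0; rewrite mxE (negPf ii0).
    rewrite -[X in _ == X](tpermR k i0) -/s (inj_eq perm_inj) (negPf ii0).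
    by rewrite mulr0.
  have sj : s j != i0.
    by rewrite -[X in _ == X](tpermL k i0) -/s (inj_eq perm_inj).
  rewrite (bigD1 (s j)) //= mxE (negPf sj) tpermK eqxx mulr1 mul1r big1 ?addr0 //.
  move=> i /andP[ii0 isj]; rewrite mxE (negPf ii0).
  case: eqP => [sij|_]; last by rewrite mulr0.
  by move: isj; rewrite -sij tpermK eqxx.
have u0 : u 0 i0 = 0.
  have := E k; rewrite eqxx mul0r addr0 => /eqP; rewrite mulf_eq0 (negPf vk) orbF.
  by move/eqP.
apply/rowP => j; rewrite mxE -(tpermK k i0 j) -/s.
have := E (s j); rewrite u0 mul0r add0r.
have [sjk _|_] := eqVneq (s j) k; last by rewrite mul1r.
by rewrite sjk /s tpermL u0.
Qed.

Lemma Ck_subset (R : realType) (n k : nat) (Z Z' : set 'rV[R]_n) f :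
  Z' `<=` Z -> Ck k Z f -> Ck k Z' f.
Proof.
move=> ZZ; elim: k f => [|k IH] f [cf df]; first by split=> // z /ZZ; exact: cf.
split=> [z /ZZ|l]; first exact: cf.
by split=> [z /ZZ|]; [exact: (df l).1|apply: IH; exact: (df l).2].
Qed.

(** The hypersurface from which the flow starts is given by the rows other than
i0 of an invertible matrix Q whose row i0 is V x0.  The differential at 0 of
the flow map is Q, and the inverse function theorem applies. *)
Lemma flow_box (R : realType) (n : nat) (U : set 'rV[R]_n.+1)
    (V : 'rV[R]_n.+1 -> 'rV[R]_n.+1) (x0 : 'rV[R]_n.+1) (i0 : 'I_n.+1) :
  open U -> (forall i, smooth_on U (fun x => V x 0 i)) -> U x0 -> V x0 != 0 ->
  exists N W (Phi Gam : 'rV[R]_n.+1 -> 'rV[R]_n.+1),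
    [/\ [/\ open N, open W, W x0 & W `<=` U],
        forall z, N z -> [/\ W (Phi z), Gam (Phi z) = z & jac Phi z \in unitmx],
        forall x, W x -> N (Gam x) /\ Phi (Gam x) = x,
        forall i, smooth_on N (fun z => Phi z 0 i) /\
                  smooth_on W (fun x => Gam x 0 i) &
        forall z, N z -> row i0 (jac Phi z) = V (Phi z)].
Proof.
move=> oU sV Ux0 V0.
have [Q uQ rQ] := unitmx_with_row i0 V0.
pose P : 'M[R]_n.+1 := \matrix_(i, j) if i == i0 then 0 else Q i j.
have P0 j : P i0 j = 0 by rewrite mxE eqxx.
have [rho rho0 [Phi [PU sPhi DPhi Pl]]] := flow_map oU sV Ux0 P0.
have b0 : ball (0 : 'rV[R]_n.+1) rho 0 by exact: ballxx.
have ob : open (ball (0 : 'rV[R]_n.+1) rho) by exact: ball_open.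
have Phi0 : Phi 0 = x0 by rewrite Pl // ?mxE // mul0mx addr0.
have J0 : jac Phi 0 = Q.
  apply/matrixP => i j; rewrite mxE.
  (* In the direction i0 the flow map moves along V; in the others it is the
     affine map z |-> x0 + z P. *)
  have [->|ii0] := eqVneq i i0.
    by rewrite DPhi // Phi0 -rQ mxE.
  apply: cvg_lim => //.
  have : (fun=> Q i j) @ (0:R)^' --> Q i j by exact: cvg_cst.
  apply: cvg_trans; apply: near_eq_cvg; near=> h.
  have h0 : h != 0 by near: h; exact: nbhs_dnbhs_neq.
  have bh : ball (0 : 'rV[R]_n.+1) rho (h *: 'e_i + 0).
    near: h; apply: (@cvg_line R _ (0 : 'rV[R]_n.+1) 'e_i (ball 0 rho)).
    exact: nbhsx_ballx.
  rewrite /= /shift /= [Phi (_ + 0)]Pl // ?Phi0; last first.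
    by rewrite !mxE eqxx eq_sym (negPf ii0) mulr0 addr0.
  rewrite addr0 mxE [x0 0 j + _]addrC addrK -scalemxAl -rowE !mxE (negPf ii0).
  by apply/esym/mulKf.
have uJ : jac Phi 0 \in unitmx by rewrite J0.
have [N [W [Gam [oN oW [N0 NO] HN [HW sG]]]]] := inverse_map ob sPhi b0 uJ.
exists N, W, Phi, Gam; split=> //.
- split=> //; first by have [] := HN 0 N0; rewrite Phi0.
  by move=> x /HW[Ng <-]; apply: PU; exact: NO.
- move=> i; split; last exact: sG.
  by move=> k; exact: Ck_subset NO (sPhi i k).
- by move=> z /NO bz; apply/rowP => j; rewrite !mxE; exact: DPhi.
Unshelve. all: by end_near. Qed.

(** A C^1 function is Frechet differentiable by [C1_strict_vec], so that the
matrix of its differential is that of its partial derivatives. *)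
Lemma jacobianE (R : realType) (m n : nat) (U : set 'rV[R]_m)
    (f : 'rV[R]_m -> 'rV[R]_n) x :
  open U -> (forall j, Ck 1 U (fun x => f x 0 j)) -> U x -> 'J f x = jac f x.
Proof.
move=> oU Cf Ux.
pose df : {linear 'rV[R]_m -> 'rV[R]_n} := mulmxr (jac f x).
have cl : continuous df.
  move=> y; apply: (@cvg_rV _ _ (nbhs y)) => j; rewrite /df /= mxE.
  under eq_fun do rewrite mxE.
  apply: (@cvg_sum_ord R _ (nbhs y)) => i.
  exact: (cvgM (@coord_continuous _ _ _ 0 i y) (cvg_cst (jac f x i j))).
have E : f \o shift x = cst (f x) + df +o_ (0 : 'rV[R]_m) id.
  apply/eqaddoP => e e0.
  have /filter_ex [r [Hr r0]] : \forall r \near 0^'+,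
     (forall y z, ball x r y -> ball x r z ->
       `|f z - f y - (z - y) *m jac f x| <= e * `|z - y|) /\ 0 < r.
    apply: filterI; first by apply: C1_strict_vec Cf Ux e0.
    exact: nbhs_right_gt.
  near=> v.
  have Hv : ball x r (v + x).
    rewrite -ball_normE /ball_ /= opprD addrCA subrr addr0 normrN.
    by near: v; exact: cvgr0_norm_lt.
  have := Hr x (v + x) (ballxx _ r0) Hv.
  by rewrite addrK !fctE /= opprD addrA.
have dE : 'd f x = df :> (_ -> _) by apply: diff_unique.
by apply/matrixP => i j; rewrite /jacobian /lin1_mx mxE dE /df /= -rowE mxE.
Unshelve. all: by end_near. Qed.

Lemma jac_near (R : realType) (m n : nat) (U : set 'rV[R]_m)
    (f g : 'rV[R]_m -> 'rV[R]_n) x :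
  open U -> U x -> (forall y, U y -> f y = g y) -> jac f x = jac g x.
Proof.
move=> oU Ux fg; apply/matrixP => i j; rewrite !mxE; apply: near_eq_derive.
have := near_eq_on oU (fun y Uy => fg y Uy) Ux.
by apply: filterS => y ->.
Qed.

Lemma open_inter_preimage (T S : topologicalType) (A : set T) (B : set S)
    (f : T -> S) :
  open A -> (forall x, A x -> {for x, continuous f}) -> open B ->
  open (A `&` f @^-1` B).
Proof.
move=> oA cf oB; apply: open_near => x [Ax Bx].
apply: filterI; first exact: open_nbhs_nbhs.
by apply: (cf x Ax); exact: open_nbhs_nbhs.
Qed.

Section Charts.
Context (R : realType) (n : nat) (X : topologicalType).
Implicit Types c : chart R n X.

Lemma chart_imgK c x : is_chart c -> cimg c x ->
  cdom c (cinv c x) /\ cmap c (cinv c x) = x.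
Proof. by case=> _ _ K _ _ [q cq <-]; rewrite K. Qed.

Lemma chart_image_open c A : is_chart c -> open A ->
  open (cmap c @` (cdom c `&` A)).
Proof.
move=> Hc oA; have [_ oc K _ ci] := Hc.
have -> : cmap c @` (cdom c `&` A) = cimg c `&` cinv c @^-1` A.
  apply/seteqP; split=> x.
    by move=> [q [cq Aq] <-]; split; [exists q|rewrite /= K].
  by move=> [ix Ax]; have [d <-] := chart_imgK Hc ix; exists (cinv c x).
exact: open_inter_preimage.
Qed.

Lemma transition_mem c c' x : is_chart c ->
  (cmap c @` (cdom c `&` cdom c')) x ->
  cdom c' (cinv c x) /\ (cmap c' @` (cdom c' `&` cdom c)) (transition c c' x).
Proof.
move=> [_ _ K _ _] [q [cq c'q] <-].
by rewrite /transition /= K //; split => //; exists q.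
Qed.

End Charts.

Lemma trans_jacE (R : realType) (n : nat) (M : smooth_manifold R n)
    (c c' : chart R n M) p : atlas c -> atlas c' -> cdom c p -> cdom c' p ->
  trans_jac c c' p = jac (transition c c') (cmap c p).
Proof.
move=> Ac Ac' cp c'p; have [S _] := atlas_compatible Ac Ac'.
apply: (@jacobianE _ _ _ (cmap c @` (cdom c `&` cdom c'))).
- apply: chart_image_open; first exact: atlas_chart.
  by have [] := atlas_chart Ac'.
- by move=> j; exact: (S j 1%N).
- by exists p.
Qed.

(** The chart c followed by the inverse of a flow box of the expression of xi in
c.  It is compatible with all of the atlas, hence belongs to it by maximality,
and xi has there the components of the last basis vector because the last row
of the Jacobian matrix of the flow box is xi itself. *)
Lemma adapted_chart_exists (R : realType) (n : nat) (M : smooth_manifold R n.+1)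
    (xi : vector_field M) (c : chart R n.+1 M) (p : M) :
  atlas c -> cdom c p -> xi c p != 0 ->
  exists c', [/\ adapted xi c', cdom c' p & trans_jac c' c p \in unitmx].
Proof.
move=> Ac cp xi0.
have Hc := atlas_chart Ac; have [oc oi K cm ci] := Hc.
pose V x := xi c (cinv c x).
have ip : cimg c (cmap c p) by exists p.
have V0 : V (cmap c p) != 0 by rewrite /V K.
have [N [W [Phi [Gam [[oN oW Wp WU] HN HW sPG DPhi]]]]] :=
  flow_box ord_max oi (vf_smooth xi Ac) ip V0.
pose c' := Chart (cdom c `&` cmap c @^-1` W) (Gam \o cmap c) (cinv c \o Phi).
have cPhi z : N z -> {for z, continuous Phi}.
  move=> Nz; apply: (@cvg_rV _ _ (nbhs z)) => i.
  exact: (((sPG i).1 0%N).1 z Nz).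
have cGam x : W x -> {for x, continuous Gam}.
  move=> Wx; apply: (@cvg_rV _ _ (nbhs x)) => i.
  exact: (((sPG i).2 0%N).1 x Wx).
have imgE : cimg c' = N.
  apply/seteqP; split=> z; first by move=> [q [_ Wq] <-]; exact: (HW _ Wq).1.
  move=> Nz; have [Wz Ez _] := HN z Nz; have [d e] := chart_imgK Hc (WU _ Wz).
  by exists (cinv c (Phi z)); rewrite /= ?e.
have Hc' : is_chart c'.
  split.
  - exact: open_inter_preimage.
  - by rewrite imgE.
  - by move=> q [cq Wq] /=; rewrite (HW _ Wq).2 K.
  - by move=> q [cq Wq]; exact: continuous_comp (cm q cq) (cGam _ Wq).
  - move=> z; rewrite imgE => Nz; have [Wz _ _] := HN z Nz.
    exact: continuous_comp (cPhi z Nz) (ci _ (WU _ Wz)).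
have compat c'' : atlas c'' -> compatible_charts c' c''.
  move=> Ac''; have Hc'' := atlas_chart Ac''; have [oc'' _ K'' _ _] := Hc''.
  have [S1 S2] := atlas_compatible Ac Ac''.
  have o1 : open (cmap c @` (cdom c `&` cdom c'')) by exact: chart_image_open.
  have o2 : open (cmap c'' @` (cdom c'' `&` cdom c)) by exact: chart_image_open.
  split=> j k.
  - apply: (@Ck_subset _ _ _ (N `&` Phi @^-1` (cmap c @` (cdom c `&` cdom c'')))).
      move=> _ [q [[cq Wq] c''q] <-]; have [Nq Eq] := HW _ Wq; split=> //=.
      by exists q => //; rewrite Eq.
    apply: (Ck_comp (f := fun x => transition c c'' x 0 j) _ o1 (S1 j k)).
    + exact: open_inter_preimage.
    + by move=> i; apply: Ck_subset ((sPG i).1 k) => z [].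
    + by move=> z [].
  - pose A := cmap c'' @` (cdom c'' `&` cdom c).
    have cT x : A x -> {for x, continuous (transition c'' c)}.
      move=> Ax; apply: (@cvg_rV _ _ (nbhs x)) => i.
      exact: ((S2 i 0%N).1 x Ax).
    apply: (@Ck_subset _ _ _ (A `&` transition c'' c @^-1` W)).
      move=> _ [q [c''q [cq Wq]] <-]; split; first by exists q.
      by rewrite /transition /= K''.
    apply: (Ck_comp (f := fun x => Gam x 0 j) (G := transition c'' c)
             _ oW ((sPG j).2 k)).
    + exact: open_inter_preimage.
    + by move=> i; apply: Ck_subset (S2 i k) => z [].
    + by move=> z [].
have Ac' : atlas c' by exact: atlas_maximal.
have tE q : cdom c' q -> trans_jac c' c q = jac Phi (cmap c' q).
  move=> [cq Wq]; rewrite trans_jacE //.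
  apply: (jac_near oN); first exact: (HW _ Wq).1.
  move=> z Nz; have [Wz _ _] := HN z Nz.
  by have [_] := chart_imgK Hc (WU _ Wz).
have uE q : cdom c' q -> jac Phi (cmap c' q) \in unitmx.
  by move=> [_ Wq]; have [_ _] := HN _ (HW _ Wq).1.
exists c'; split.
- split=> // q c'q; have [cq Wq] := c'q.
  have := vf_change xi Ac' Ac c'q cq; rewrite tE // => E.
  have := DPhi _ (HW _ Wq).1; rewrite (HW _ Wq).2 /V K // E rowE.
  by move/(can_inj (mulmxK (uE q c'q))).
- by [].
- by rewrite tE //; exact: uE.
Qed.

(** * Contact metrics in adapted charts *)

Lemma is_derive_mulmx (R : realType) (V : normedModType R) (m n p : nat)
    (A : V -> 'M[R]_(m, n)) (B : V -> 'M[R]_(n, p)) (dA : 'M[R]_(m, n))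
    (dB : 'M[R]_(n, p)) (z v : V) :
  (forall i j, is_derive z v (fun z => A z i j) (dA i j)) ->
  (forall i j, is_derive z v (fun z => B z i j) (dB i j)) ->
  forall i j, is_derive z v (fun z => (A z *m B z) i j)
                            ((dA *m B z + A z *m dB) i j).
Proof.
move=> HA HB i j.
have -> : (fun z => (A z *m B z) i j) =
  \sum_k (fun z => A z i k) * (fun z => B z k j).
  by apply: funext => y; rewrite mxE fct_sumE.
have D := @is_derive_sum R V R n (fun k => (fun z => A z i k) * (fun z => B z k j))
  z v (fun k => A z i k *: dB k j + B z k j *: dA i k)
  (fun k => is_deriveM (HA i k) (HB k j)).
apply: is_derive_eq; rewrite !mxE -big_split; apply: eq_bigr => k _ /=.
by rewrite addrC /GRing.scale /= [B z k j * _]mulrC.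
Qed.

Section Contact.
Context (R : realType) (n : nat) (M : smooth_manifold R n.+1).
Variables (phi : tensor11 M) (xi : vector_field M) (eta : one_form M)
  (gt : tensor02 M).
Hypothesis hacm : almost_contact_metric phi xi eta gt.

Lemma eval2_linear_l (B : 'M[R]_n.+1) a (u v w : 'rV[R]_n.+1) :
  eval2 B (u - a *: v) w = eval2 B u w - a * eval2 B v w.
Proof. by rewrite /eval2 !mulmxBl -!scalemxAl !mxE. Qed.

Lemma eval2_linear_r (B : 'M[R]_n.+1) a (u v w : 'rV[R]_n.+1) :
  eval2 B w (u - a *: v) = eval2 B w u - a * eval2 B w v.
Proof.
by rewrite /eval2 linearB linearZ /= mulmxBr -scalemxAr !mxE.
Qed.

Lemma eval2_delta (B : 'M[R]_n.+1) i j : eval2 B 'e_i 'e_j = B i j.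
Proof. by rewrite /eval2 trmx_delta -rowE -colE !mxE. Qed.

Lemma eval1_delta (w : 'cV[R]_n.+1) i : eval1 w 'e_i = w i 0.
Proof. by rewrite /eval1 -rowE mxE. Qed.

Lemma eval1_linear (w : 'cV[R]_n.+1) a (u v : 'rV[R]_n.+1) :
  eval1 w (u - a *: v) = eval1 w u - a * eval1 w v.
Proof. by rewrite /eval1 mulmxBl -scalemxAl !mxE. Qed.

(** Compatibility of the metric with phi, for the pair (xi, v): the left-hand
side vanishes as phi xi = 0, and eta (xi) = 1. *)
Lemma xi_dual_eta c q : atlas c -> cdom c q ->
  (forall v, eval2 (gt c q) (xi c q) v = eval1 (eta c q) v) /\
  (forall v, eval2 (gt c q) v (xi c q) = eval1 (eta c q) v).
Proof.
move=> Ac cq; have [hp /(_ c Ac q cq)[e1 p0 _ _ gp]] := hacm.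
have [gs _] := hp c Ac q cq.
have H v : eval2 (gt c q) (xi c q) v = eval1 (eta c q) v.
  have := gp (xi c q) v; rewrite p0 e1 mul1r /eval2 !mul0mx mxE => /esym/eqP.
  by rewrite subr_eq0 => /eqP.
by split=> // v; rewrite gs H.
Qed.

Lemma xi_neq0 c q : atlas c -> cdom c q -> xi c q != 0.
Proof.
move=> Ac cq; have [_ /(_ c Ac q cq)[e1 _ _ _ _]] := hacm.
apply/eqP => x0; move: e1; rewrite x0 /eval1 mul0mx mxE => /eqP.
by rewrite eq_sym oner_eq0.
Qed.

(** Expand gt (e_a - eta_a xi, e_b - eta_b xi) with gt (xi, .) = eta: the three
products of eta_a and eta_b add up to - eta_a eta_b. *)
Lemma frame_metric (g : tensor02 M) c q a b :
  admissible_metric xi eta gt g -> atlas c -> cdom c q ->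
  eval2 (g c q) (frame_D xi eta c a q) (frame_D xi eta c b q) =
  gt c q (lift ord_max a) (lift ord_max b) -
    eta c q (lift ord_max a) 0 * eta c q (lift ord_max b) 0.
Proof.
move=> hg Ac cq; have [gD _ _] := hg c Ac q cq.
have [_ /(_ c Ac q cq)[e1 _ _ _ _]] := hacm.
have [gl gr] := xi_dual_eta Ac cq.
rewrite gD /frame_D /proj_D; try by rewrite eval1_linear e1 mulr1 subrr.
rewrite eval2_linear_l !eval2_linear_r !gl !gr e1 eval2_delta !eval1_delta.
by ring.
Qed.

Lemma dcoord_cst c q i (F : M -> R) (k : R) :
  atlas c -> cdom c q -> (forall q, cdom c q -> F q = k) -> dcoord c i F q = 0.
Proof.
move=> Ac cq Fk; have Hc := atlas_chart Ac; have [_ oi _ _ _] := Hc.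
rewrite /dcoord -(derive_cst k (cmap c q) 'e_i); apply: near_eq_derive.
apply: (near_eq_on oi (g := cst k)) => [x ix|]; last by exists q.
by apply: Fk; have [] := chart_imgK Hc ix.
Qed.

Hypothesis hker : ker_d_eq_span eta xi.

(** The component (xi, e_i) of d eta is the last derivative of eta_i minus the
i-th derivative of eta (xi) = 1. *)
Lemma dcoord_eta c q i : adapted xi c -> cdom c q ->
  dcoord c ord_max (fun q => eta c q i 0) q = 0.
Proof.
move=> [Ac xiE] cq.
have H : eval2 (ext_d eta c q) (xi c q) 'e_i = 0.
  by apply/(hker Ac cq (xi c q)).2; exists 1; rewrite scale1r.
move: H; rewrite xiE // eval2_delta mxE => /eqP; rewrite subr_eq0 => /eqP ->.
apply: (@dcoord_cst _ _ _ _ 1) => // q' cq'.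
have [_ /(_ c Ac q' cq')[e1 _ _ _ _]] := hacm.
by move: e1; rewrite xiE // eval1_delta.
Qed.

(** The components of xi are constant in the chart, which leaves only the term
that differentiates the tensor. *)
Lemma lie_derivative_adapted (h : tensor02 M) c q i j : adapted xi c -> cdom c q ->
  lie_derivative xi h c q i j = dcoord c ord_max (fun q => h c q i j) q.
Proof.
move=> [Ac xiE] cq; rewrite mxE.
have dxi k l : dcoord c k (fun q => xi c q 0 l) q = 0.
  by apply: (@dcoord_cst _ _ _ _ (('e_ord_max : 'rV[R]_n.+1) 0 l)) => // ? ?;
    rewrite xiE.
rewrite (bigD1 ord_max) //= big1 => [|k kn].
  by rewrite !dxi !mulr0 !addr0 xiE // mxE !eqxx mul1r.
by rewrite !dxi !mulr0 !addr0 xiE // mxE (negPf kn) mul0r.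
Qed.

Lemma dcoord_frame_metric (g : tensor02 M) c q a b :
  admissible_metric xi eta gt g -> adapted xi c -> cdom c q ->
  dcoord c ord_max
    (fun q => eval2 (g c q) (frame_D xi eta c a q) (frame_D xi eta c b q)) q =
  dcoord c ord_max
    (fun q => gt c q (lift ord_max a) (lift ord_max b)) q.
Proof.
move=> hg Hca cq; have [Ac xiE] := Hca.
have Hc := atlas_chart Ac; have [_ oi _ _ _] := Hc.
have iq : cimg c (cmap c q) by exists q.
pose E i := (fun q => eta c q i 0) \o cinv c.
pose G := (fun q => gt c q (lift ord_max a) (lift ord_max b)) \o cinv c.
have dE i : is_derive (cmap c q) 'e_ord_max (E i) 0.
  split; first exact: ((of_smooth eta Ac i 1%N).2 ord_max).1.
  exact: (dcoord_eta i Hca cq).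
have dG : is_derive (cmap c q) 'e_ord_max G ('D_'e_ord_max G (cmap c q)).
  split => //.
  exact: ((t02_smooth gt Ac (lift ord_max a) (lift ord_max b) 1%N).2 ord_max).1.
have D := is_deriveB dG (is_deriveM (dE (lift ord_max a)) (dE (lift ord_max b))).
rewrite /dcoord.
transitivity ('D_'e_ord_max (G - E (lift ord_max a) * E (lift ord_max b)) (cmap c q)).
  apply: near_eq_derive; apply: (near_eq_on oi) iq => x ix.
  by rewrite /= (frame_metric _ _ hg Ac) //; have [] := chart_imgK Hc ix.
by rewrite (@derive_val _ _ _ _ _ _ _ D) !scaler0 addr0 subr0.
Qed.

(** For two indices other than the last this is [dcoord_frame_metric]; otherwise
the component is one of eta and [dcoord_eta] applies. *)
Lemma adapted_dcoord_metric_eq0 (g : tensor02 M) c q :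
  admissible_metric xi eta gt g -> quasi_integrable xi eta g ->
  adapted xi c -> cdom c q ->
  forall i j, dcoord c ord_max (fun q => gt c q i j) q = 0.
Proof.
move=> hg hq Hca cq i j; have [Ac xiE] := Hca.
have Hc := atlas_chart Ac; have [_ oi _ _ _] := Hc.
have iq : cimg c (cmap c q) by exists q.
have edge F k : (forall q, cdom c q -> F q = eta c q k 0) ->
    dcoord c ord_max F q = 0.
  move=> FE; rewrite -(dcoord_eta k Hca cq); apply: near_eq_derive.
  apply: (near_eq_on oi) iq => x ix; apply: FE.
  by have [] := chart_imgK Hc ix.
case: (unliftP ord_max i) => [a ->|->]; last first.
  apply: (edge _ j) => q' cq'; have [gl _] := xi_dual_eta Ac cq'.
  by rewrite -eval1_delta -gl xiE // eval2_delta.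
case: (unliftP ord_max j) => [b ->|->]; last first.
  apply: (edge _ (lift ord_max a)) => q' cq'; have [_ gr] := xi_dual_eta Ac cq'.
  by rewrite -eval1_delta -gr xiE // eval2_delta.
by rewrite -(dcoord_frame_metric a b hg Hca cq); exact: hq.
Qed.

End Contact.

(** * The Lie derivative in arbitrary charts *)

(** Let Phi be the change of coordinates from the adapted chart to c, with
Jacobian matrix J, and differentiate the transformation law h' = J h J^T in
the last coordinate.  The last row of J is xi o Phi, so that the symmetry of
second derivatives turns the last derivative of J into the derivatives of
xi o Phi, namely J A with A the matrix of the derivatives of xi; and the
derivative of h o Phi in this direction is its derivative B along xi.  The
product rule gives J (A h + B + h A^T) J^T. *)
Lemma lie_derivative_pullback (R : realType) (n : nat) (M : smooth_manifold R n.+1)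
    (xi : vector_field M) (h : tensor02 M) (c c' : chart R n.+1 M) p :
  adapted xi c' -> atlas c -> cdom c' p -> cdom c p ->
  \matrix_(i, j) dcoord c' ord_max (fun q => h c' q i j) p =
  trans_jac c' c p *m lie_derivative xi h c p *m (trans_jac c' c p)^T.
Proof.
move=> [Ac' xiE] Ac c'p cp.
have Hc := atlas_chart Ac; have Hc' := atlas_chart Ac'.
have [oc oi K _ _] := Hc; have [oc' oi' K' _ _] := Hc'.
pose S := cmap c' @` (cdom c' `&` cdom c).
have oS : open S by exact: chart_image_open.
have [sT _] := atlas_compatible Ac' Ac.
pose Phi := transition c' c; pose z0 := cmap c' p.
have S0 : S z0 by exists p.
have Phi0 : Phi z0 = cmap c p by rewrite /Phi /transition /= K'.
pose J z := jac Phi z.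
pose V x := xi c (cinv c x).
pose G x := h c (cinv c x).
have PhiU z : S z -> cimg c (Phi z).
  by move=> Sz; have [_ [q [cq _] E]] := transition_mem Hc' Sz; exists q.
have atz z : S z -> [/\ cdom c' (cinv c' z), cdom c (cinv c' z),
    cmap c' (cinv c' z) = z & cinv c (Phi z) = cinv c' z].
  by move=> [q [c'q cq] <-]; rewrite /Phi /transition /= K' // K.
have JE z : S z -> trans_jac c' c (cinv c' z) = J z.
  by move=> /atz[d1 d2 d3 _]; rewrite trans_jacE // d3.
have VE z : S z -> V (Phi z) = row ord_max (J z).
  move=> Sz; have [d1 d2 _ d4] := atz z Sz.
  by rewrite /V d4 (vf_change xi Ac' Ac d1 d2) JE // xiE // -rowE.
have hE z : S z -> h c' (cinv c' z) = J z *m G (Phi z) *m (J z)^T.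
  move=> Sz; have [d1 d2 _ d4] := atz z Sz.
  by rewrite (t02_change h Ac' Ac d1 d2) JE // /G d4.
pose A : 'M[R]_n.+1 := \matrix_(i, j) dcoord c i (fun q => xi c q 0 j) p.
pose B : 'M[R]_n.+1 := \matrix_(k, l)
  \sum_m xi c p 0 m * dcoord c m (fun q => h c q k l) p.
have LE : lie_derivative xi h c p = A *m h c p + B + h c p *m A^T.
  apply/matrixP => k l; rewrite !mxE -!big_split; apply: eq_bigr => m _ /=.
  by rewrite !mxE; ring.
have cP j : {for z0, continuous (fun z => Phi z 0 j)}.
  exact: (sT j 0%N).1 z0 S0.
have C1 f : smooth_on (cimg c) f -> is_derive z0 'e_ord_max (fun z => f (Phi z))
    (\sum_m 'D_'e_m f (Phi z0) * J z0 ord_max m).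
  move=> sf.
  have := chain_rule oi (sf 1%N) (PhiU z0 S0) cP
    (fun j => ((sT j 1%N).2 ord_max).1 z0 S0).
  move=> D; apply: is_derive_eq; apply: eq_bigr => m _.
  by rewrite [J _ _ _]mxE.
have dJ i k : is_derive z0 'e_ord_max (fun z => J z i k) ((J z0 *m A) i k).
  have -> : (fun z => J z i k) = fun z => 'D_'e_i (fun z => Phi z 0 k) z.
    by apply: funext => z; rewrite mxE.
  split; first exact: (((sT k 2%N).2 i).2.2 ord_max).1 z0 S0.
  rewrite (clairaut _ _ oS (sT k 2%N) S0).
  transitivity ('D_'e_i (fun z => V (Phi z) 0 k) z0).
    apply: near_eq_derive; apply: (near_eq_on oS) S0 => z Sz.
    by rewrite VE // !mxE.
  have sV : smooth_on (cimg c) (fun x => V x 0 k) by exact: (vf_smooth xi Ac k).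
  have [_ ->] := chain_rule oi (sV 1%N) (PhiU z0 S0) cP
    (fun j => ((sT j 1%N).2 i).1 z0 S0).
  rewrite mxE; apply: eq_bigr => m _; rewrite mulrC; congr (_ * _).
    by rewrite mxE.
  by rewrite mxE /dcoord Phi0.
have dG k l : is_derive z0 'e_ord_max (fun z => G (Phi z) k l) (B k l).
  have D := C1 _ (t02_smooth h Ac k l); apply: is_derive_eq.
  rewrite mxE; apply: eq_bigr => m _; rewrite mulrC Phi0; congr (_ * _).
  have [d1 d2 d3 d4] := atz z0 S0.
  have := VE z0 S0; rewrite /V Phi0 K // => ->; by rewrite [RHS]mxE.
have dJT i k : is_derive z0 'e_ord_max (fun z => (J z)^T i k) ((J z0 *m A)^T i k).
  have -> : (fun z => (J z)^T i k) = fun z => J z k i.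
    by apply: funext => z; rewrite mxE.
  by rewrite mxE; exact: dJ.
have D := is_derive_mulmx (is_derive_mulmx dJ dG) dJT.
apply/matrixP => i j; rewrite mxE /dcoord.
transitivity ('D_'e_ord_max (fun z => (J z *m G (Phi z) *m (J z)^T) i j) z0).
  by apply: near_eq_derive; apply: (near_eq_on oS) S0 => z Sz; rewrite /= hE.
have [_ ->] := D i j.
have -> : trans_jac c' c p = J z0.
  by have := JE z0 S0; rewrite {1}/z0 (K' p c'p).
have -> : G (Phi z0) = h c p by rewrite Phi0 /G (K p cp).
rewrite LE; move: (J z0) (h c p) => J0 h0; congr (fun_of_matrix _ i j).
by rewrite trmx_mul !(mulmxDr, mulmxDl, mulmxA).
Qed.

Theorem theorem10 (R : realType) (n : nat) (hn : odd n.+1)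
    (X : smooth_manifold R n.+1) (phi : tensor11 X) (xi : vector_field X)
    (eta : one_form X) (gt : tensor02 X)
    (hacm : almost_contact_metric phi xi eta gt)
    (hnondeg : d_nondegenerate_on_ker eta)
    (hker : ker_d_eq_span eta xi)
    (g : tensor02 X) (hg : admissible_metric xi eta gt g) :
  K_contact xi gt <-> quasi_integrable xi eta g.
Proof.
split=> [hK c Hca a b p cp|hq c Ac p cp].
  rewrite (dcoord_frame_metric hacm hker a b hg Hca cp).
  by rewrite -(lie_derivative_adapted _ _ _ Hca cp) hK ?mxE //; case: Hca.
have [c' [Hca c'p uJ]] := adapted_chart_exists Ac cp (xi_neq0 hacm Ac cp).
have := lie_derivative_pullback gt Hca Ac c'p cp.
set L := lie_derivative _ _ _ _; set J := trans_jac _ _ _.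
have -> : \matrix_(i, j) dcoord c' ord_max (fun q => gt c' q i j) p = 0.
  by apply/matrixP => i j; rewrite !mxE (adapted_dcoord_metric_eq0 hacm hker hg hq Hca c'p).
move=> E; have uJT : J^T \in unitmx by rewrite unitmx_tr.
have : invmx J *m (J *m L *m J^T) *m invmx J^T = 0 by rewrite -E mulmx0 mul0mx.
by rewrite mulmxA mulKmx // mulmxK.
Qed.
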